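(* Let $(C_B;\mu_B,\alpha_B,\beta_B)$ be an admissibly marked Boyle exterior. For the unknot $U$, if $\Phi_B:\partial(E_U\times S^1)\to\partial C_B$ is the geometric marking coming from the original decomposition $S^4=C_B\cup\nu B$, then the glued manifold $\Sigma_B(U)=(E_U\times S^1)\cup_{\Phi_B}C_B$ is diffeomorphic to $S^4$.
   Context: $E_U=S^3\setminus\operatorname{int}\nu U\cong S^1\times D^2$, so $E_U\times S^1\cong T^2\times D^2$. On $\partial(E_U\times S^1)$ use the ordered basis $(m_U,\lambda_U,x)$, where $m_U$ and $\lambda_U$ are a meridian and the preferred longitude of $U$ and $x$ is the extra $S^1$-factor. The gluing $\Phi_B$ is orientation reversing and induces (up to inverses) $m_U\mapsto\alpha_B$, $x\mapsto\beta_B$, $\lambda_U\mapsto\mu_B$. ''Geometric marking coming from $S^4=C_B\cup\nu B$'' means that $\Phi_B$ is the boundary map of an identification of $E_U\times S^1\cong T^2\times D^2$ with $\nu B$: the two core directions $m_U,x$ are sent to the two null slopes $\alpha_B,\beta_B$ of $C_B$, and the meridian $\lambda_U$ of $T^2\times D^2$ is sent to $\mu_B$, the meridian of $B$. Marked Boyle exterior. Let $B=T_{J,i,1}\subset S^4$ be a turned $1$-twist-spun torus of a knot $J$ in the sense of J. Boyle (''The turned torus knot in $S^4$''): inside $S^1\times B^3$ take the trace of a family of knots $J_\theta\subset\operatorname{int}B^3$, $\theta\in S^1$, isotopic to $J$, where as $\theta$ goes once around $S^1$ the knotted part of $J$ (in a small ball meeting $J$ in a knotted arc) makes one full twist about the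 axis through the endpoints of that arc; then include $S^1\times B^3$ in $S^4$ as a neighborhood of an unknotted circle, using the framing determined by $i$ modulo $2$ (equivalently, the whole ball $B^3$ makes $i$ full rotations). Put $C_B=S^4\setminus\operatorname{int}\nu B$. It is known that $\pi_1(C_B)\cong\mathbb Z$, generated by a meridian. An admissible marking of $C_B$ is a basis $(\mu_B,\alpha_B,\beta_B)$ of $H_1(\partial C_B;\mathbb Z)\cong\mathbb Z^3$ with $\mu_B$ a meridian generating $\pi_1(C_B)$ and $\alpha_B,\beta_B$ spanning $\ker(H_1(\partial C_B)\to H_1(C_B))$. *)

(* Defs.v *)
From HB Require Import structures.
From mathcomp Require Import all_boot all_order all_algebra.
From mathcomp Require Import all_classical all_reals all_analysis.

Set Implicit Arguments.
Unset Strict Implicit.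
Unset Printing Implicit Defensive.

Import Order.TTheory GRing.Theory Num.Theory.
Import numFieldNormedType.Exports.

Local Open Scope classical_set_scope.
Local Open Scope ring_scope.

Local Notation I01 := (`[0, 1]%classic).

(** All manifolds are subsets of some [R^n = 'rV[R]_n], and smoothness is the
    usual extrinsic one (Milnor, Guillemin-Pollack).  By Whitney's theorem this
    loses no generality. *)

Section Smooth.
Variable R : realType.

Fixpoint Ck (V W : normedModType R) (k : nat) (O : set V) (g : V -> W) : Prop :=
  match k with
  | 0 => forall x, O x -> {for x, continuous g}
  | k'.+1 => (forall x, O x -> differentiable g x) /\
             (forall v, Ck k' O (fun x => 'D_v g x))
  end.

Definition smooth_on (V W : normedModType R) (A : set V) (f : V -> W) : Prop :=
  forall x, A x -> exists (O : set V) (g : V -> W),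
    [/\ open O, O x, forall k, Ck k O g &
        forall y, A y -> O y -> g y = f y].

Definition is_diffeo (V W : normedModType R) (A : set V) (A' : set W)
    (f : V -> W) : Prop :=
  [/\ smooth_on A f, f @` A = A' &
      exists g : W -> V, smooth_on A' g /\ forall x, A x -> g (f x) = x].

Definition diffeomorphic (V W : normedModType R) (A : set V) (A' : set W) :=
  exists f : V -> W, is_diffeo A A' f.

Definition embedding (V W : normedModType R) (A : set V) (f : V -> W) :=
  is_diffeo A (f @` A) f.

Definition submanifold (k : nat) (V : normedModType R) (X : set V) : Prop :=
  forall x, X x -> exists (O : set V) (P : set 'rV[R]_k),
    [/\ open O, O x, open P & diffeomorphic (X `&` O) P].

(** [X] is a model of the adjunction space of [M] and [N] along [Phi], where
    [Phi] goes from the boundary [dM] of [M] to the boundary of [N], with a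
    smooth structure extending the given ones on both pieces.  Such an [X]
    exists and is unique up to diffeomorphism (Hirsch, Differential Topology,
    Chapter 8). *)
Definition smooth_gluing (k : nat) (V W Z : normedModType R)
    (M dM : set V) (N : set W) (Phi : V -> W) (X : set Z) : Prop :=
  submanifold k X /\
  exists (a : V -> Z) (b : W -> Z),
    [/\ embedding M a, embedding N b, a @` M `|` b @` N = X,
        a @` M `&` b @` N = a @` dM &
        forall z, dM z -> a z = b (Phi z)].

End Smooth.

Section Euclidean.
Variable R : realType.

Definition normsq n (x : 'rV[R]_n) : R := \sum_k x 0 k ^+ 2.

(** [sphere n] is the unit sphere of [R^n], of dimension [n - 1]. *)
Definition sphere n : set 'rV[R]_n := [set x | normsq x = 1].
Definition cball n : set 'rV[R]_n := [set x | normsq x <= 1].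
Definition oball n : set 'rV[R]_n := [set x | normsq x < 1].

Definition rprod m n (A : set 'rV[R]_m) (A' : set 'rV[R]_n) :
  set 'rV[R]_(m + n) := [set z | A (lsubmx z) /\ A' (rsubmx z)].

Arguments sphere n _ : clear implicits.
Arguments cball n _ : clear implicits.
Arguments oball n _ : clear implicits.

Definition torus : set 'rV[R]_(2 + 2) := rprod (sphere 2) (sphere 2).

Definition row2 (a b : R) : 'rV[R]_2 := \row_k (if k == 0 then a else b).

Definition circ (t : R) : 'rV[R]_2 :=
  row2 (cos (2 * pi * t)) (sin (2 * pi * t)).

End Euclidean.

Arguments sphere R n _ : clear implicits.
Arguments cball R n _ : clear implicits.
Arguments oball R n _ : clear implicits.
Arguments torus R _ : clear implicits.

(** ** Singular homology in degree one, and loops *)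

Section Homology.
Variables (R : realType) (V : normedModType R).
Implicit Types (X : set V) (g : R -> V) (s : R * R -> V).

Definition path_in X g : Prop :=
  {within I01, continuous g} /\ forall t, I01 t -> X (g t).

Definition loop_in X g : Prop := path_in X g /\ g 0 = g 1.

Definition chain0 : Type := V -> int.
Definition chain1 : Type := (R -> V) -> int.

(** The generator of the free abelian group on singular 1-simplices given by a
    path; only the values of the path on the unit interval matter. *)
Definition cls g : chain1 := \1_[set g \_ I01].

Definition is_chain1 X (c : chain1) : Prop :=
  finite_set [set g | c g != 0] /\
  forall g, c g != 0 -> path_in X g /\ g = g \_ I01.

Definition bdry1 (c : chain1) : chain0 :=
  \sum_(g \in [set: R -> V]) ((\1_[set g 1] : chain0) - \1_[set g 0]) *~ c g.

Definition cycle1 X (c : chain1) : Prop := is_chain1 X c /\ bdry1 c = 0.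

Definition simplex2 : set (R * R) :=
  [set p | [/\ 0 <= p.1, 0 <= p.2 & p.1 + p.2 <= 1]].

Definition triangle_in X s : Prop :=
  {within simplex2, continuous s} /\ forall p, simplex2 p -> X (s p).

(** The vertices of the 2-simplex are ordered [(0,0)], [(1,0)], [(0,1)]. *)
Definition bdry2 s : chain1 :=
  cls (fun t => s (1 - t, t)) - cls (fun t => s (0, t))
  + cls (fun t => s (t, 0)).

Definition homologous X (c c' : chain1) : Prop :=
  exists n (s : 'I_n -> R * R -> V) (k : 'I_n -> int),
    (forall i, triangle_in X (s i)) /\
    c - c' = \sum_i bdry2 (s i) *~ k i.

Definition H1_basis3 X (a b c : chain1) : Prop :=
  [/\ [/\ cycle1 X a, cycle1 X b & cycle1 X c],
      forall z, cycle1 X z ->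
        exists k l m : int, homologous X z (a *~ k + b *~ l + c *~ m) &
      forall k l m : int, homologous X (a *~ k + b *~ l + c *~ m) 0 ->
        [/\ k = 0, l = 0 & m = 0]].

(** [a] and [b] span the kernel of [H_1(Y) -> H_1(X)], for [Y] inside [X]. *)
Definition H1_kernel_spanned2 Y X (a b : chain1) : Prop :=
  [/\ cycle1 Y a /\ cycle1 Y b, homologous X a 0, homologous X b 0 &
      forall z, cycle1 Y z -> homologous X z 0 ->
        exists k l : int, homologous Y z (a *~ k + b *~ l)].

Definition path_homotopic X g g' : Prop :=
  exists H : R * R -> V,
    [/\ {within I01 `*` I01, continuous H},
        forall p, (I01 `*` I01) p -> X (H p),
        forall t, I01 t -> H (0, t) = g t /\ H (1, t) = g' t &
        forall r, I01 r -> H (r, 0) = g 0 /\ H (r, 1) = g 1].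

(** The loop [g] traversed [k] times; backwards when [k] is negative. *)
Definition loop_power g (k : int) : R -> V :=
  fun t => g (k%:~R * t - (Num.floor (k%:~R * t))%:~R).

(** The class of [g] generates the fundamental group of [X] at [g 0]. *)
Definition pi1_generator X g : Prop :=
  loop_in X g /\
  forall h, loop_in X h -> h 0 = g 0 ->
    exists k : int, path_homotopic X h (loop_power g k).

End Homology.

(** ** Tubular neighbourhoods, exteriors, meridians and longitudes *)

Section Tubular.
Variable R : realType.
Variables (m n : nat).
Implicit Types (A : set 'rV[R]_m) (T : 'rV[R]_(m + 2) -> 'rV[R]_n).

(** [T] parametrizes by [A * D^2] a closed tubular neighbourhood, in the unit
    sphere of [R^n], of the codimension two submanifold [K], where [K] is
    diffeomorphic to [A]. *)
Definition tubular A T (K : set 'rV[R]_n) : Prop :=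
  [/\ embedding (rprod A (cball R 2)) T,
      T @` rprod A (cball R 2) `<=` sphere R n &
      T @` rprod A [set 0] = K].

Definition tube A T : set 'rV[R]_n := T @` rprod A (cball R 2).

Definition exterior A T : set 'rV[R]_n :=
  sphere R n `\` T @` rprod A (oball R 2).

Definition exterior_bd A T : set 'rV[R]_n := T @` rprod A (sphere R 2).

(** Both directions of travel are allowed. *)
Definition meridian A T (g : R -> 'rV[R]_n) : Prop :=
  exists (p : 'rV[R]_m) (e : bool),
    A p /\ g = fun t => T (row_mx p (circ ((-1) ^+ e * t))).

End Tubular.

Section Knots.
Variable R : realType.

Definition is_knot n (K : set 'rV[R]_n) : Prop :=
  diffeomorphic (sphere R 2) K.

Definition unknot (U : set 'rV[R]_4) : Prop :=
  U `<=` sphere R 4 /\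
  exists d : 'rV[R]_2 -> 'rV[R]_4,
    [/\ embedding (cball R 2) d, d @` cball R 2 `<=` sphere R 4 &
        d @` sphere R 2 = U].

Definition preferred_longitude (tau : 'rV[R]_(2 + 2) -> 'rV[R]_4)
    (lam : R -> 'rV[R]_4) : Prop :=
  [/\ loop_in (exterior_bd (sphere R 2) tau) lam,
      {in `[0, 1[ &, injective lam},
      exists e : bool, homologous (tube (sphere R 2) tau) (cls lam)
        (cls (fun t => tau (row_mx (circ t) 0)) *~ (-1) ^+ e) &
      homologous (exterior (sphere R 2) tau) (cls lam) 0].

Definition isotopic (J J' : set 'rV[R]_3) : Prop :=
  exists H : R -> 'rV[R]_2 -> 'rV[R]_3,
    [/\ smooth_on (rprod [set r : 'rV[R]_1 | I01 (r 0 0)] (sphere R 2))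
          (fun z => H (lsubmx z 0 0) (rsubmx z)),
        forall r, I01 r -> embedding (sphere R 2) (H r),
        H 0 @` sphere R 2 = J & H 1 @` sphere R 2 = J'].

End Knots.

(** ** Boyle's turned 1-twist-spun tori *)

Section Boyle.
Variable R : realType.

(** Multiplication by [w] in [R^2 = C]. *)
Definition cmul (w p : 'rV[R]_2) : 'rV[R]_2 :=
  row2 (w 0 0 * p 0 0 - w 0 1 * p 0 1) (w 0 0 * p 0 1 + w 0 1 * p 0 0).

(** Rotation of [R^3 = C * R] about the last coordinate axis by the angle of
    [w] in the unit circle. *)
Definition rot (w : 'rV[R]_2) (x : 'rV[R]_(2 + 1)) : 'rV[R]_(2 + 1) :=
  row_mx (cmul w (lsubmx x)) (rsubmx x).

(** The knotted part of [J] lies in the ball of radius [r] about the origin: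
    near the boundary of that ball [J] runs along the axis of [rot], and outside
    it [J] is an arc in a plane, hence unknotted. *)
Definition twist_position (r : R) (J : set 'rV[R]_(2 + 1)) : Prop :=
  [/\ is_knot J, J `<=` oball R 3,
      exists e : R, [/\ 0 < e, e < r, r + e < 1 &
        forall x, (r - e) ^+ 2 <= normsq x <= (r + e) ^+ 2 ->
          (J x <-> lsubmx x = 0)] &
      forall x, J x -> r ^+ 2 <= normsq x -> lsubmx x 0 1 = 0].

(** The twisting map: as [w] runs once around the circle, the ball of radius
    [r] makes one full turn about the axis while its outside stays fixed.  For
    [J] in twist position the image of [J] is the knot [J_w]. *)
Definition twist (r : R) (w : 'rV[R]_2) (x : 'rV[R]_(2 + 1)) :
  'rV[R]_(2 + 1) := if normsq x <= r ^+ 2 then rot w x else x.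

(** The inclusion of [S^1 * B^3] in the unit sphere of [R^5 = R^2 * R^3] as a
    neighbourhood of the unknotted circle [S^1 * 0], with one of its two
    framings according to the parity of [i]. *)
Definition circle_nbhd (i : int) (w : 'rV[R]_2) (x : 'rV[R]_(2 + 1)) :
  'rV[R]_5 :=
  row_mx (Num.sqrt (1 - normsq x / 4) *: w)
         (2^-1 *: (if odd `|i|%N then rot w x else x)).

Definition turned_torus_model (r : R) (i : int) (J : set 'rV[R]_3) :
  set 'rV[R]_5 :=
  [set z | exists w x, [/\ sphere R 2 w, J x &
                           z = circle_nbhd i w (twist r w x)]].

(** [B] is a torus [T_{J,i,1}]; surfaces in the 4-sphere are considered up to
    diffeomorphisms of the sphere. *)
Definition turned_torus (J : set 'rV[R]_3) (i : int) (B : set 'rV[R]_5) :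
  Prop :=
  is_knot J /\
  exists (r : R) (J' : set 'rV[R]_3),
    [/\ isotopic J J', twist_position r J' &
        exists f : 'rV[R]_5 -> 'rV[R]_5,
          is_diffeo (sphere R 5) (sphere R 5) f /\
          f @` turned_torus_model r i J' = B].

End Boyle.

(** ** Orientations *)

Section Orientation.
Variable R : realType.

Definition velocity (V : normedModType R) (A : set V) (z v : V) : Prop :=
  exists c : R^o -> V,
    [/\ c 0 = z, \forall t \near (0 : R^o), A (c t) & is_derive (0 : R^o) (1 : R^o) c v].

Definition outward (V : normedModType R) (M dM : set V) (z u : V) : Prop :=
  (exists c : R^o -> V,
    [/\ c 0 = z, \forall t \near (0 : R)^'-, M (c t) & is_derive (0 : R^o) (1 : R^o) c u]) /\
  ~ velocity dM z u.

(** [v'] is the image of the tangent vector [v] to [A] at [z] under the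
    differential of [f], a map defined on [A]. *)
Definition pushes (V W : normedModType R) (A : set V) (f : V -> W)
    (z v : V) (v' : W) : Prop :=
  exists c : R^o -> V,
    [/\ c 0 = z, \forall t \near (0 : R^o), A (c t), is_derive (0 : R^o) (1 : R^o) c v &
        is_derive (0 : R^o) (1 : R^o) (f \o c) v'].

(** [M] and [N] are [(1 + d)]-manifolds with boundary, oriented by the normal
    frame fields [nuM] and [nuN]: a tangent frame is positive when it gives a
    positive basis of the ambient space once put after the normal frame.
    Boundaries are oriented by the outward-vector-first convention. *)
Definition orientation_reversing_bd (k l d : nat)
    (M dM : set 'rV[R]_(k + (1 + d)))
    (nuM : 'rV[R]_(k + (1 + d)) -> 'M[R]_(k, k + (1 + d)))
    (N dN : set 'rV[R]_(l + (1 + d)))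
    (nuN : 'rV[R]_(l + (1 + d)) -> 'M[R]_(l, l + (1 + d)))
    (Phi : 'rV[R]_(k + (1 + d)) -> 'rV[R]_(l + (1 + d))) : Prop :=
  forall z u u' (v : 'M[R]_(d, k + (1 + d))) (v' : 'M[R]_(d, l + (1 + d))),
    dM z -> outward M dM z u -> outward N dN (Phi z) u' ->
    (forall a, pushes dM Phi z (row a v) (row a v')) ->
    0 < \det (col_mx (nuM z) (col_mx u v)) ->
    \det (col_mx (nuN (Phi z)) (col_mx u' v')) < 0.

(** Normal frame of [S^3 * S^1] in [R^4 * R^2] inducing the product of the
    orientations of the two spheres as boundaries of balls: the order of the
    two normals makes up for moving the second one past a tangent frame of
    [S^3]. *)
Definition normal_S3S1 (z : 'rV[R]_(4 + 2)) : 'M[R]_(1 + 1, 4 + 2) :=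
  col_mx (row_mx 0 (rsubmx z)) (row_mx (lsubmx z) 0).

End Orientation.

(** ** Marked Boyle exteriors and geometric markings *)

Section Marking.
Variable R : realType.
Implicit Types (T : 'rV[R]_(2 + 2 + 2) -> 'rV[R]_5)
  (tau : 'rV[R]_(2 + 2) -> 'rV[R]_4) (Phi : 'rV[R]_(4 + 2) -> 'rV[R]_5).

Definition nbhd_B T := tube (torus R) T.
Definition C_B T := exterior (torus R) T.
Definition dC_B T := exterior_bd (torus R) T.

Definition E_U tau := exterior (sphere R 2) tau.
Definition dE_U tau := exterior_bd (sphere R 2) tau.
Definition EUxS1 tau := rprod (E_U tau) (sphere R 2).
Definition dEUxS1 tau := rprod (dE_U tau) (sphere R 2).

Definition admissible_marking T (mu alpha beta : chain1 'rV[R]_5) : Prop :=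
  [/\ H1_basis3 (dC_B T) mu alpha beta,
      exists g, [/\ meridian (torus R) T g, homologous (dC_B T) mu (cls g) &
                    pi1_generator (C_B T) g] &
      H1_kernel_spanned2 (dC_B T) (C_B T) alpha beta].

Definition induces_up_to_inverse Phi (Y : set 'rV[R]_5)
    (g : R -> 'rV[R]_(4 + 2)) (a : chain1 'rV[R]_5) : Prop :=
  exists e : bool, homologous Y (cls (Phi \o g)) (a *~ (-1) ^+ e).

(** [m] and [lam] are a meridian and the preferred longitude of [U]. *)
Definition geometric_marking T (mu alpha beta : chain1 'rV[R]_5)
    tau (m lam : R -> 'rV[R]_4) Phi : Prop :=
  [/\ is_diffeo (dEUxS1 tau) (dC_B T) Phi,
      @orientation_reversing_bd R 2 1 3
        (EUxS1 tau) (dEUxS1 tau) (@normal_S3S1 R) (C_B T) (dC_B T) id Phi,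
      forall p q, dE_U tau p -> sphere R 2 q ->
        [/\ induces_up_to_inverse Phi (dC_B T) (fun t => row_mx (m t) q) alpha,
            induces_up_to_inverse Phi (dC_B T)
              (fun t => row_mx p (circ t)) beta &
            induces_up_to_inverse Phi (dC_B T)
              (fun t => row_mx (lam t) q) mu] &
      exists Psi : 'rV[R]_(4 + 2) -> 'rV[R]_5,
        is_diffeo (EUxS1 tau) (nbhd_B T) Psi /\
        forall z, dEUxS1 tau z -> Psi z = Phi z].

End Marking.

(* Main.v *)
Require Import Defs.
From HB Require Import structures.
From mathcomp Require Import all_boot all_order all_algebra.
From mathcomp Require Import all_classical all_reals all_analysis.
From mathcomp Require Import ring lra.

(** The sphere itself is a gluing of [E_U x S^1] to [C_B] along [Phi]: on the
    first piece it is the map [Psi], which identifies [E_U x S^1] with the tube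
    around [B] and extends [Phi], and on the second one the inclusion.  The
    tube and [C_B] cover the sphere and meet in their common boundary
    ([tube_cover], [tube_bd]).  So the theorem comes down to the uniqueness of
    gluings up to diffeomorphism ([gluing_unique]).

    Let [X] be another gluing.  The parametrization [T] of the tube turns the
    embedding of [E_U x S^1] into an embedding [g] of [T^2 x D^2] into [X].
    Together [g o T^-1] and the embedding [b] of [C_B] form a homeomorphism from
    the sphere to [X] which is smooth on both pieces, but whose derivatives may
    jump along the boundary, a 3-torus.  It is made smooth by changing it on
    a collar, on the side of the tube.

    A smooth left inverse [q] of [g], defined on the whole space by
    [smooth_extension] and retracted to [T^2 x R^2], gives coordinates of [X] on
    both sides of the 3-torus ([local_q]).  In these coordinates [b] becomes a
    map [phi] defined near the 3-torus in [T^2 x R^2] ([transition]).  It fixes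
    the 3-torus, and there its derivative sends inner normals to the inner side
    ([transition_derive]), because the images of [b] and [g] only meet in the
    boundary.  If a diffeomorphism [G] of [T^2 x D^2] agrees with [phi] near the
    boundary, then [b] and [g o G o T^-1] fit together to a diffeomorphism
    ([glued_diffeomorphic]).

    Such a [G] interpolates between [phi] and the identity ([torus_blend]).  In
    logarithmic polar coordinates [phi] is [Y + a Y] for a displacement [a] on
    [R^3 x R] which is periodic along [R^3] and vanishes on [R^3 x 0].  Multiply
    [a] by a cutoff function [chi] of the normal coordinate [t].  If the support
    of [chi] is small, [chi a] varies slowly along [R^3]; if moreover
    [t chi'(t)] is small, the normal component still increases at a definite
    rate.  So the cut off map increases distances at least by a fixed factor
    ([blend]).  A smooth map of [R^n] with this property is a diffeomorphism
    ([global_inverse]): where the distance of the image to a given point is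
    minimal that distance is zero, as the derivative is onto.

    All local statements are derived from such lower Lipschitz bounds.  They
    hold for maps with a smooth left inverse, even a one-sided one
    ([fat_stretch]), and in dimension four they give local inverses
    ([manifold_inverse]). *)

Set Implicit Arguments.
Unset Strict Implicit.
Unset Printing Implicit Defensive.

Import Order.TTheory GRing.Theory Num.Theory.
Import numFieldNormedType.Exports.

Local Open Scope classical_set_scope.
Local Open Scope ring_scope.

(** * Calculus of maps of class C^k *)

Section CkBasics.
Variables (R : realType) (V : normedModType R).
Implicit Types (W : normedModType R) (O : set V) (k : nat).

Lemma CkW W k O (f : V -> W) : Ck k.+1 O f -> Ck k O f.
Proof.
elim: k f => [|k IH] f [df dk] /=.
  by move=> x /df /differentiable_continuous.
by split=> // v; apply: IH; exact: dk.
Qed.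

Lemma Ck_sub W k O U (f : V -> W) : U `<=` O -> Ck k O f -> Ck k U f.
Proof.
move=> sO; elim: k f => [|k IH] f /=; first by move=> h x /sO /h.
by case=> df dk; split=> [x /sO /df//|v]; exact: IH.
Qed.

Lemma near_open O (P : V -> Prop) x :
  open O -> O x -> (forall y, O y -> P y) -> \forall y \near x, P y.
Proof. by move=> oO Ox h; apply: filterS h _; exact: open_nbhs_nbhs. Qed.

Lemma differentiable_near_eq W (f g : V -> W) x :
  (\forall y \near x, f y = g y) -> differentiable f x -> differentiable g x.
Proof.
move=> fg df; have gx : g x = f x by rewrite (nbhs_singleton fg).
have cdf : continuous ('d f x) by apply: diff_continuous.
have ex : g \o shift x = cst (g x) + 'd f x +o_ 0 id.
  apply/eqaddoE/eqaddoP => e e0.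
  have /diff_locallyP[_ /eqaddoP /(_ e e0) H] := df.
  have fg0 : \forall h \near (0 : V), f (h + x) = g (h + x).
    by move: fg; rewrite (near_shift 0) /= subr0.
  near=> h; rewrite /= gx.
  have e1 : g (h + x) = f (h + x) by apply/esym; near: h.
  have -> : (g \o +%R^~ x - (cst (f x) + 'd f x)) h =
            (f \o +%R^~ x - (cst (f x) + 'd f x)) h.
    by rewrite -![(_ - _) h]/(_ - _) /= e1.
  by near: h; exact: H.
by apply/diff_locallyP; rewrite (diff_unique cdf ex).
Unshelve. all: by end_near. Qed.

Lemma Ck_eq W k O (f g : V -> W) :
  open O -> (forall x, O x -> f x = g x) -> Ck k O f -> Ck k O g.
Proof.
move=> oO; elim: k f g => [|k IH] f g fg.
  move=> fc x Ox; have fgx : \forall y \near x, f y = g y.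
    exact: near_open fg.
  rewrite /prop_for /continuous_at -(fg x Ox).
  by apply: cvg_trans (fc x Ox); apply: near_eq_cvg.
case=> df dk; split=> [x Ox|v].
  by apply: differentiable_near_eq (df x Ox); exact: near_open fg.
apply: IH (dk v) => x Ox; apply: near_eq_derive; exact: near_open fg.
Qed.

(** What makes locally constructed maps, such as those cut off by a bump
    function, of class [C^k] on the whole space. *)
Lemma Ck_local W k O (f : V -> W) :
  (forall x, O x -> exists2 U : set V, U x & Ck k U f) -> Ck k O f.
Proof.
elim: k f => [|k IH] f h.
  by move=> x Ox; have [U Ux H] := h x Ox; exact: H.
split=> [x Ox|v]; first by have [U Ux [H _]] := h x Ox; exact: H.
by apply: IH => x Ox; have [U Ux [_ H]] := h x Ox; exists U => //; exact: H.
Qed.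

Lemma Ck_cst W k O (c : W) : Ck k O (fun _ : V => c).
Proof.
elim: k c => [|k IH] c; first by move=> x _; exact: cst_continuous.
split=> [x _|v]; first exact: differentiable_cst.
have -> : (fun x : V => 'D_v (fun=> c) x) = (fun=> 0) by apply/funext => x; exact: derive_cst.
exact: IH.
Qed.

Lemma CkD W k O (f g : V -> W) :
  open O -> Ck k O f -> Ck k O g -> Ck k O (fun x => f x + g x).
Proof.
move=> oO; elim: k f g => [|k IH] f g.
  by move=> fc gc x Ox; apply: continuousD; [exact: fc|exact: gc].
case=> df dfk [dg dgk]; split=> [x Ox|v].
  by apply: differentiableD; [exact: df|exact: dg].
apply: (Ck_eq oO _ (IH _ _ (dfk v) (dgk v))) => x Ox.
by rewrite (@deriveD R _ _ f g) //; apply: diff_derivable; [exact: df|exact: dg].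
Qed.

Lemma CkN W k O (f : V -> W) : open O -> Ck k O f -> Ck k O (fun x => - f x).
Proof.
move=> oO; elim: k f => [|k IH] f.
  by move=> fc x Ox; apply: continuousN; exact: fc.
case=> df dfk; split=> [x Ox|v].
  by apply: differentiableN; exact: df.
apply: (Ck_eq oO _ (IH _ (dfk v))) => x Ox.
by rewrite (@deriveN R _ _ f) //; apply: diff_derivable; exact: df.
Qed.

Lemma CkB W k O (f g : V -> W) :
  open O -> Ck k O f -> Ck k O g -> Ck k O (fun x => f x - g x).
Proof. by move=> oO Cf Cg; apply: CkD => //; exact: CkN. Qed.

Lemma CkM k O (f g : V -> R) :
  open O -> Ck k O f -> Ck k O g -> Ck k O (fun x => f x * g x).
Proof.
move=> oO; elim: k f g => [|k IH] f g.
  by move=> fc gc x Ox; apply: continuousM; [exact: fc|exact: gc].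
move=> Cf Cg; have [df dfk] := Cf; have [dg dgk] := Cg; split=> [x Ox|v].
  by apply: differentiableM; [exact: df|exact: dg].
apply: (Ck_eq oO _ (CkD oO (IH _ _ (CkW Cf) (dgk v)) (IH _ _ (CkW Cg) (dfk v)))) => x Ox.
by rewrite (@deriveM R _ f g) //; apply: diff_derivable; [exact: df|exact: dg].
Qed.

Lemma Ck_sum W k O I (r : seq I) (P : pred I) (f : I -> V -> W) :
  open O -> (forall i, P i -> Ck k O (f i)) ->
  Ck k O (fun x => \sum_(i <- r | P i) f i x).
Proof.
move=> oO h; elim: r => [|a r IH].
  by apply: (Ck_eq oO _ (Ck_cst k O (0 : W))) => x _; rewrite big_nil.
have -> : (fun x => \sum_(i <- a :: r | P i) f i x) =
    (fun x => if P a then f a x + \sum_(i <- r | P i) f i x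
              else \sum_(i <- r | P i) f i x).
  by apply/funext => x; rewrite big_cons.
by case Pa: (P a) => //; apply: CkD => //; exact: h.
Qed.

Lemma derive_coord m n (f : V -> 'M[R]_(m, n)) x v i j :
  differentiable f x -> 'D_v (fun x => f x i j) x = 'D_v f x i j.
Proof. by move=> df; rewrite (derive_mx (diff_derivable df)) mxE. Qed.

Lemma Ck_coord k n O (f : V -> 'rV[R]_n) j :
  open O -> Ck k O f -> Ck k O (fun x => f x 0 j : R).
Proof.
move=> oO; elim: k f => [|k IH] f.
  move=> fc x Ox; apply: (@continuous_comp _ _ _ f (fun M : 'rV[R]_n => M 0 j)).
    exact: fc.
  exact: coord_continuous.
case=> df dfk; split=> [x Ox|v].
  apply: (@differentiable_comp _ _ _ _ f (fun M : 'rV[R]_n => M 0 j : R)).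
    exact: df.
  exact: differentiable_coord.
apply: (Ck_eq oO _ (IH _ (dfk v))) => x Ox.
by rewrite derive_coord //; exact: df.
Qed.

Lemma Ck_row k n O (f : V -> 'rV[R]_n) :
  open O -> (forall j, Ck k O (fun x => f x 0 j : R)) -> Ck k O f.
Proof.
move=> oO; elim: k f => [|k IH] f h.
  rewrite (_ : f = fun x => \sum_j (f x 0 j) *: delta_mx 0 j); last first.
    by apply/funext => y; exact: row_sum_delta.
  apply: Ck_sum => // j _ x Ox; apply: cvgZr_tmp; exact: (h j).
have df x : O x -> differentiable f x.
  move=> Ox; rewrite (_ : f = \sum_j (fun x => (f x 0 j) *: delta_mx 0 j)); last first.
    by apply/funext => y; rewrite fct_sumE; exact: row_sum_delta.
  by apply: differentiable_sum => j; apply: differentiableZl; have [+ _] := h j; apply.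
split=> // v; apply: IH => j; have [_ dk] := h j.
apply: (Ck_eq oO _ (dk v)) => x Ox; rewrite derive_coord //; exact: df.
Qed.

Lemma derive_comp_row n (f : V -> 'rV[R]_n) (g : 'rV[R]_n -> R) x v :
  differentiable f x -> differentiable g (f x) ->
  'D_v (fun x => g (f x)) x =
  \sum_i 'D_v (fun x => f x 0 i) x * 'D_(delta_mx 0 i) g (f x).
Proof.
move=> df dg.
rewrite (@deriveE _ _ _ (g \o f)); last exact: differentiable_comp.
rewrite diff_comp //= -(deriveE v df) {1}(row_sum_delta ('D_v f x)) linear_sum /=.
apply: eq_bigr => i _; rewrite linearZ /= -deriveE //.
by rewrite derive_coord.
Qed.

(** By the chain rule the partial derivatives of the composite are sums of
    products of maps of one class less, to which the induction applies. *)
Lemma Ck_comp_row k n O U (f : V -> 'rV[R]_n) (g : 'rV[R]_n -> R) :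
  open O -> (forall x, O x -> U (f x)) -> Ck k O f -> Ck k U g ->
  Ck k O (fun x => g (f x)).
Proof.
move=> oO ff; elim: k f g ff => [|k IH] f g ff.
  by move=> fc gc x Ox; apply: (@continuous_comp _ _ _ f g);
    [exact: fc|apply: gc; exact: ff].
move=> Cf Cg; have [df dfk] := Cf; have [dg dgk] := Cg; split=> [x Ox|v].
  by apply: (@differentiable_comp _ _ _ _ f g); [exact: df|apply: dg; exact: ff].
suff : Ck k O (fun x => \sum_i 'D_v (fun x => f x 0 i) x * 'D_(delta_mx 0 i) g (f x)).
  apply: Ck_eq => // x Ox; rewrite derive_comp_row //; first exact: df.
  by apply: dg; exact: ff.
apply: Ck_sum => // i _; apply: CkM => //.
  by have [_ H] := Ck_coord i oO Cf; exact: H.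
exact: (IH f _ ff (CkW Cf) (dgk _)).
Qed.

Lemma derive_chain (f : V -> R) (g : R -> R) x v (dg : R) :
  differentiable f x -> is_derive (f x : R^o) (1 : R^o) g dg ->
  'D_v (fun x => g (f x)) x = 'D_v f x * dg.
Proof.
move=> df [Dg eg].
have dgx : differentiable (g : R^o -> R) (f x) by apply/derivable1_diffP.
have dgf : differentiable (g \o f) x by exact: differentiable_comp.
rewrite [LHS](deriveE v dgf) diff_comp //= -(deriveE v df).
have {1}-> : 'D_v f x = 'D_v f x *: (1 : R^o) by exact/esym/mulr1.
by rewrite linearZ /= -deriveE // eg.
Qed.

Lemma Ck_comp_scal k O U (f : V -> R) (g : R -> R) :
  open O -> (forall x, O x -> U (f x)) -> Ck k O f -> Ck k (U : set R^o) g ->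
  Ck k O (fun x => g (f x)).
Proof.
move=> oO ff; elim: k f g ff => [|k IH] f g ff.
  by move=> fc gc x Ox; apply: (@continuous_comp _ _ _ f g);
    [exact: fc|apply: gc; exact: ff].
move=> Cf Cg; have [df dfk] := Cf; have [dg dgk] := Cg; split=> [x Ox|v].
  by apply: (@differentiable_comp _ _ _ _ f g); [exact: df|apply: dg; exact: ff].
suff : Ck k O (fun x => 'D_v f x * 'D_1 g (f x)).
  apply: Ck_eq => // x Ox.
  have dgx : is_derive (f x : R^o) (1 : R^o) g ('D_1 g (f x)).
    by apply: DeriveDef => //; apply: diff_derivable; apply: dg; exact: ff.
  by rewrite (derive_chain v (df x Ox) dgx).
apply: CkM => //; [exact: dfk|exact: (IH f _ ff (CkW Cf) (dgk _))].
Qed.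

End CkBasics.

(** * Smooth functions of one variable *)

Definition Cinf (R : realType) (V W : normedModType R) (O : set V) (f : V -> W) :=
  forall k, Ck k O f.

Section OneVar.
Variable R : realType.
Implicit Types (O : set R^o) (f g : R -> R).

(** On the line all directional derivatives are multiples of one of them. *)
Lemma Ck1S k O f f' :
  (forall x, O x -> is_derive (x : R^o) (1 : R^o) f (f' x)) -> open O -> Ck k O (f' : R^o -> R) ->
  Ck k.+1 O (f : R^o -> R).
Proof.
move=> df oO Cf'.
have dff x : O x -> differentiable f x.
  by move=> /df h; apply/derivable1_diffP; exact: ex_derive.
split=> // v.
apply: (@Ck_eq _ _ _ _ _ (fun x => v * f' x)) => //; last first.
  by apply: CkM => //; exact: Ck_cst.
move=> x Ox; rewrite [RHS](deriveE v (dff x Ox)).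
have {2}-> : v = v *: (1 : R^o) by exact/esym/mulr1.
by rewrite linearZ /= -(deriveE _ (dff x Ox)); have [_ ->] := df x Ox.
Qed.

Lemma Ck1_continuous O f f' :
  (forall x, O x -> is_derive (x : R^o) (1 : R^o) f (f' x)) ->
  Ck 0 O (f : R^o -> R).
Proof.
move=> h x Ox; apply: differentiable_continuous; apply/derivable1_diffP.
by have := h x Ox => -[].
Qed.

Lemma Cinf_expR : Cinf (setT : set R^o) (@expR R : R^o -> R).
Proof.
elim=> [|k IH]; first by move=> x _; exact: continuous_expR.
exact: (Ck1S (fun x _ => is_derive_expR x) openT IH).
Qed.

Lemma Cinf_cos_sin k : Ck k (setT : set R^o) (@cos R : R^o -> R) /\
  Ck k (setT : set R^o) (@sin R : R^o -> R).
Proof.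
elim: k => [|k [IHc IHs]].
  by split=> x _; [exact: continuous_cos|exact: continuous_sin].
split; last exact: (Ck1S (fun x _ => is_derive_sin x) openT IHc).
exact: (Ck1S (fun x _ => is_derive_cos x) openT (CkN openT IHs)).
Qed.

Lemma open_neq0 : open ([set x | x != 0] : set R^o).
Proof. exact: open_neq. Qed.

Lemma open_pos : open ([set x | 0 < x] : set R^o).
Proof. exact: open_gt. Qed.

Lemma is_derive_inv (x : R) : x != 0 ->
  is_derive (x : R^o) (1 : R^o) (@GRing.inv R) (- (x^-1 * x^-1)).
Proof.
move=> x0; apply: DeriveDef; first exact: (@derivableV _ _ id).
by rewrite (@deriveV _ _ id) // derive_id -invfM; exact: mulr1.
Qed.

Lemma Cinf_inv : Cinf ([set x | x != 0] : set R^o) (@GRing.inv R : R^o -> R).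
Proof.
have dV := is_derive_inv.
elim=> [|k IH]; first exact: (Ck1_continuous dV).
exact: (Ck1S dV open_neq0 (CkN open_neq0 (CkM open_neq0 IH IH))).
Qed.

Lemma Cinf_ln : Cinf ([set x | 0 < x] : set R^o) (@ln R : R^o -> R).
Proof.
case=> [|k]; first exact: (Ck1_continuous (@is_derive1_ln R)).
apply: (Ck1S (@is_derive1_ln R) open_pos).
by apply: Ck_sub (Cinf_inv k) => x /=; exact: lt0r_neq0.
Qed.

Lemma Cinf_sqrt : Cinf ([set x | 0 < x] : set R^o) (@Num.sqrt R : R^o -> R).
Proof.
have op := open_pos.
elim=> [|k IH]; first exact: (Ck1_continuous (@is_derive1_sqrt R)).
apply: (Ck1S (@is_derive1_sqrt R) op).
apply: (Ck_comp_scal _ _ _ (Cinf_inv k)) => [//|x /= x0|].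
  by rewrite mulf_neq0 // ?pnatr_eq0 // lt0r_neq0 // sqrtr_gt0.
by apply: CkM => //; exact: Ck_cst.
Qed.

Lemma Ck_id k (O : set R^o) : Ck k O (id : R^o -> R).
Proof.
case: k => [|k]; first by move=> x _; exact: cvg_id.
apply: (@Ck_sub _ _ _ _ setT) => //.
exact: (Ck1S (fun x _ => is_derive_id x 1) openT (Ck_cst _ _ _)).
Qed.

Lemma Cinf_atan : Cinf (setT : set R^o) (@atan R : R^o -> R).
Proof.
have oT := @openT R^o.
case=> [|k]; first exact: (Ck1_continuous (fun x _ => is_derive1_atan x)).
apply: (Ck1S (fun x _ => is_derive1_atan x) oT).
apply: (Ck_comp_scal _ _ _ (Cinf_inv k)) => [//|x _ /=|].
  by rewrite gt_eqF // ltr_pwDl // sqr_ge0.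
exact: (CkD oT (Ck_cst _ _ _) (CkM oT (@Ck_id _ _) (@Ck_id _ _))).
Qed.

(** The functions [x^-n exp(-1/x)], extended by zero, are stable under
    differentiation, which makes the case [n = 0] smooth. *)
Definition flat n (x : R) : R :=
  if 0 < x then x^-1 ^+ n * expR (- x^-1) else 0.

(** Because [exp(u) >= u^(n+1) / (n+1)!] at [u = 1/x].  The linear bound gives
    both continuity and a zero derivative at the origin. *)
Lemma flat_le n x : 0 <= x -> `|flat n x| <= n.+1`!%:R * x.
Proof.
move=> x0; rewrite /flat; case: ifPn => [xp|_]; last first.
  by rewrite normr0 mulr_ge0 // ler0n.
have xV : 0 < x^-1 by rewrite invr_gt0.
rewrite ger0_norm; last by rewrite mulr_ge0 ?expR_ge0 // exprn_ge0 // ltW.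
rewrite expRN ler_pdivrMr ?expR_gt0 //.
have fp : (0 : R) < n.+1`!%:R by rewrite ltr0n fact_gt0.
have h : x^-1 ^+ n.+1 / n.+1`!%:R <= expR x^-1.
  by apply: le_trans (expR_ge1Dxn n (ltW xV)); rewrite lerDr.
apply: le_trans (_ : _ <= n.+1`!%:R * x * (x^-1 ^+ n.+1 / n.+1`!%:R)) _; last first.
  by rewrite ler_pM2l // mulr_gt0.
rewrite exprS le_eqVlt; apply/orP; left; apply/eqP; field.
by rewrite !gt_eqF.
Qed.

Lemma flat0 n x : x <= 0 -> flat n x = 0.
Proof. by move=> x0; rewrite /flat ltNge x0. Qed.

Lemma flat_norm n x : `|flat n x| <= n.+1`!%:R * `|x|.
Proof.
have [x0|x0] := leP 0 x; first by rewrite (ger0_norm x0) flat_le.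
by rewrite (flat0 n (ltW x0)) normr0 mulr_ge0 ?ler0n.
Qed.

Lemma is_derive_flat n (x : R) :
  is_derive (x : R^o) (1 : R^o) (flat n) (flat n.+2 x - n%:R * flat n.+1 x).
Proof.
have [x0|x0|->] := ltrgtP x 0.
- rewrite !(flat0 _ (ltW x0)) mulr0 subrr.
  apply: (near_eq_is_derive _ (is_derive_cst (0 : R) x 1)).
  near=> y; rewrite flat0 //; apply/ltW; near: y; exact: lt_nbhsl.
- rewrite /flat x0.
  have : is_derive (x : R^o) (1 : R^o) (fun y : R => y^-1 ^+ n * expR (- y^-1))
     (x^-1 ^+ n.+2 * expR (- x^-1) - n%:R * (x^-1 ^+ n.+1 * expR (- x^-1))).
    have dV := is_derive_inv (lt0r_neq0 x0).
    have dE := is_derive1_comp (is_derive_expR _) (is_deriveN dV).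
    have -> : (fun y : R => y^-1 ^+ n * expR (- y^-1)) =
      (@GRing.inv R ^+ n) * (@expR R \o (- @GRing.inv R)).
      by apply/funext => y; rewrite -[RHS]/(_ * _) exprfctE.
    apply: is_derive_eq (is_deriveM (is_deriveX n dV) dE) _.
    rewrite /GRing.scale /= exprfctE; set e := expR _; set y := x^-1.
    case: n => [|n] /=; first by rewrite !mul0r !expr0; ring.
    by rewrite !exprS; ring.
  apply: near_eq_is_derive; near=> y; rewrite ifT //; near: y; exact: lt_nbhsr.
- rewrite !flat0 // mulr0 subrr.
  have H : h^-1 *: (flat n (h *: 1 + 0) - flat n 0) @[h --> (0 : R)^'] --> (0 : R).
    apply/cvgrPdist_le => e e0; near=> h.
    have h0 : h != 0 by near: h; exact: nbhs_dnbhs_neq.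
    rewrite (flat0 n (lexx 0)) sub0r normrN subr0 addr0 [h *: 1]mulr1.
    have -> : h^-1 *: flat n h = flat n.+1 h.
      by rewrite /flat /GRing.scale /=; case: ifP => _; [rewrite exprS mulrA|rewrite mulr0].
    apply: le_trans (flat_norm _ _) _.
    have fp : (0 : R) < n.+2`!%:R by rewrite ltr0n fact_gt0.
    rewrite -ler_pdivlMl //; near: h.
    by apply: dnbhs0_le; rewrite mulr_gt0 // invr_gt0.
  apply: DeriveDef; first by apply/cvg_ex; exists 0.
  exact: cvg_lim H.
Unshelve. all: by end_near. Qed.

Lemma Cinf_flat n : Cinf (setT : set R^o) (flat n : R^o -> R).
Proof.
move=> k; elim: k n => [|k IH] n.
  exact: (Ck1_continuous (fun x _ => is_derive_flat n x)).
apply: (Ck1S (fun x _ => is_derive_flat n x) openT).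
exact: (CkB openT (IH _) (CkM openT (Ck_cst _ _ _) (IH _))).
Qed.

End OneVar.

(** * Globally defined smooth maps *)

(** Smooth maps of the whole space compose without any bookkeeping of domains.
    Locally defined maps are replaced by such maps with the same germ. *)
Definition smooth (R : realType) (V W : normedModType R) (f : V -> W) :=
  Cinf setT f.

Section Smooth.
Variables (R : realType) (V : normedModType R).

Lemma smooth_cst (W : normedModType R) (c : W) : smooth (fun _ : V => c).
Proof. by move=> k; exact: Ck_cst. Qed.

Lemma smoothD (W : normedModType R) (f g : V -> W) :
  smooth f -> smooth g -> smooth (fun x => f x + g x).
Proof. by move=> Cf Cg k; apply: CkD => //; exact: openT. Qed.

Lemma smoothN (W : normedModType R) (f : V -> W) :
  smooth f -> smooth (fun x => - f x).
Proof. by move=> Cf k; apply: CkN => //; exact: openT. Qed.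

Lemma smoothB (W : normedModType R) (f g : V -> W) :
  smooth f -> smooth g -> smooth (fun x => f x - g x).
Proof. by move=> Cf Cg; apply: smoothD => //; exact: smoothN. Qed.

Lemma smoothM (f g : V -> R) :
  smooth f -> smooth g -> smooth (fun x => f x * g x).
Proof. by move=> Cf Cg k; apply: CkM => //; exact: openT. Qed.

Lemma smoothX (f : V -> R) n : smooth f -> smooth (fun x => f x ^+ n).
Proof.
move=> Cf; elim: n => [|n IH].
  by rewrite (_ : (fun _ => _) = fun=> 1); [exact: smooth_cst|apply/funext].
rewrite (_ : (fun _ => _) = fun x => f x * f x ^+ n); first exact: smoothM.
by apply/funext => x; rewrite exprS.
Qed.

Lemma smooth_sum (W : normedModType R) I (r : seq I) (P : pred I) (f : I -> V -> W) :
  (forall i, P i -> smooth (f i)) -> smooth (fun x => \sum_(i <- r | P i) f i x).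
Proof. by move=> h k; apply: Ck_sum => [|i Pi]; [exact: openT|exact: h]. Qed.

Lemma smooth_coord n (f : V -> 'rV[R]_n) j :
  smooth f -> smooth (fun x => f x 0 j : R).
Proof. by move=> Cf k; apply: Ck_coord => //; exact: openT. Qed.

Lemma smooth_row n (f : V -> 'rV[R]_n) :
  (forall j, smooth (fun x => f x 0 j : R)) -> smooth f.
Proof. by move=> h k; apply: Ck_row => [|j]; [exact: openT|exact: h]. Qed.

Lemma smooth_comp n p (f : V -> 'rV[R]_n) (g : 'rV[R]_n -> 'rV[R]_p) :
  smooth f -> smooth g -> smooth (fun x => g (f x)).
Proof.
move=> Cf Cg; apply: smooth_row => j k.
apply: (Ck_comp_row openT _ (Cf k) (_ : Ck k setT (fun y => g y 0 j : R))) => //.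
exact: Ck_coord openT (Cg k).
Qed.

Lemma smooth_comp_row n (f : V -> 'rV[R]_n) (g : 'rV[R]_n -> R) :
  smooth f -> smooth g -> smooth (fun x => g (f x)).
Proof. by move=> Cf Cg k; exact: (Ck_comp_row openT _ (Cf k) (Cg k)). Qed.

Lemma smooth_comp_scal (f : V -> R) (g : R -> R) :
  smooth f -> Cinf (setT : set R^o) (g : R^o -> R) -> smooth (fun x => g (f x)).
Proof. by move=> Cf Cg k; exact: (Ck_comp_scal openT _ (Cf k) (Cg k)). Qed.

Lemma smooth_inv (f : V -> R) :
  (forall x, f x != 0) -> smooth f -> smooth (fun x => (f x)^-1).
Proof.
by move=> h Cf k; apply: (Ck_comp_scal openT _ (Cf k) (@Cinf_inv R k)) => x _; exact: h.
Qed.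

Lemma smooth_ln (f : V -> R) :
  (forall x, 0 < f x) -> smooth f -> smooth (fun x => ln (f x)).
Proof.
by move=> h Cf k; apply: (Ck_comp_scal openT _ (Cf k) (@Cinf_ln R k)) => x _; exact: h.
Qed.

Lemma smooth_sqrt (f : V -> R) :
  (forall x, 0 < f x) -> smooth f -> smooth (fun x => Num.sqrt (f x)).
Proof.
by move=> h Cf k; apply: (Ck_comp_scal openT _ (Cf k) (@Cinf_sqrt R k)) => x _; exact: h.
Qed.

Lemma smooth_scale n (f : V -> R) (g : V -> 'rV[R]_n) :
  smooth f -> smooth g -> smooth (fun x => f x *: g x).
Proof.
move=> Cf Cg; apply: smooth_row => j.
rewrite (_ : (fun _ => _) = fun x => f x * g x 0 j); last first.
  by apply/funext => x; rewrite mxE.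
by apply: smoothM => //; exact: smooth_coord.
Qed.

Lemma smooth_continuous (W : normedModType R) (f : V -> W) :
  smooth f -> continuous f.
Proof. by move=> Cf x; exact: (Cf 0 x). Qed.

Lemma smooth_differentiable (W : normedModType R) (f : V -> W) x :
  smooth f -> differentiable f x.
Proof. by move=> Cf; have [h _] := Cf 1; exact: h. Qed.

Lemma smooth_derive (W : normedModType R) (f : V -> W) v :
  smooth f -> smooth (fun x => 'D_v f x).
Proof. by move=> Cf k; have [_ h] := Cf k.+1; exact: h. Qed.

Lemma smooth_lsubmx m n (f : V -> 'rV[R]_(m + n)) :
  smooth f -> smooth (fun x => lsubmx (f x)).
Proof.
move=> Cf; apply: smooth_row => j.
rewrite (_ : (fun _ => _) = fun x => f x 0 (lshift n j)); last first.
  by apply/funext => x; rewrite mxE.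
exact: smooth_coord.
Qed.

Lemma smooth_rsubmx m n (f : V -> 'rV[R]_(m + n)) :
  smooth f -> smooth (fun x => rsubmx (f x)).
Proof.
move=> Cf; apply: smooth_row => j.
rewrite (_ : (fun _ => _) = fun x => f x 0 (rshift m j)); last first.
  by apply/funext => x; rewrite mxE.
exact: smooth_coord.
Qed.

Lemma smooth_row_mx m n (f : V -> 'rV[R]_m) (g : V -> 'rV[R]_n) :
  smooth f -> smooth g -> smooth (fun x => row_mx (f x) (g x)).
Proof.
move=> Cf Cg; apply: smooth_row => j.
case: (split_ordP j) => i ->.
  rewrite (_ : (fun _ => _) = fun x => f x 0 i); first exact: smooth_coord.
  by apply/funext => x; rewrite row_mxEl.
rewrite (_ : (fun _ => _) = fun x => g x 0 i); first exact: smooth_coord.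
by apply/funext => x; rewrite row_mxEr.
Qed.

Lemma smooth_normsq n (f : V -> 'rV[R]_n) :
  smooth f -> smooth (fun x => normsq (f x)).
Proof.
by move=> Cf; apply: smooth_sum => i _; apply: smoothX; exact: smooth_coord.
Qed.

End Smooth.

Lemma smooth_id (R : realType) n : smooth (id : 'rV[R]_n -> 'rV[R]_n).
Proof.
suff h (j : 'I_n) : smooth (fun x : 'rV[R]_n => x 0 j : R) by exact: smooth_row.
case=> [|k]; first by move=> x _; exact: coord_continuous.
split=> [x _|v]; first exact: differentiable_coord.
apply: (Ck_eq openT _ (Ck_cst k _ (v 0 j))) => x _.
have @f : {linear 'rV[R]_n -> R}.
  by exists (fun N : 'rV[R]_n => N 0 j); do 2![eexists]; do ?[constructor];
     rewrite ?mxE// => ? *; rewrite ?mxE//; move=> ?; rewrite !mxE.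
rewrite [RHS](deriveE v (@differentiable_coord R 1 n x 0 j)).
rewrite -[fun x : 'rV_n => x 0 j]/(f : 'rV[R]_n -> R) diff_lin //.
exact: coord_continuous.
Qed.

Section Cutoff.
Variable R : realType.
Implicit Types (x : R).

Lemma flat_gt0 x : 0 < x -> 0 < flat 0 x.
Proof. by move=> x0; rewrite /flat x0 expr0 mul1r expR_gt0. Qed.

Lemma flat_ge0 x : 0 <= flat 0 x.
Proof. by have [/flat0 ->//|/flat_gt0/ltW] := leP x 0. Qed.

(** Since [u exp(-u) <= 1]. *)
Lemma flat_le_id x : 0 <= x -> flat 0 x <= x.
Proof. by move=> x0; have := flat_le 0 x0; rewrite mul1r; apply: le_trans; exact: ler_norm. Qed.

(** Smoothly decreasing from 1 on the negative half line to 0 past 1. *)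
Definition step x := flat 0 (1 - x) / (flat 0 (1 - x) + flat 0 x).

Lemma step_den x : 0 < flat 0 (1 - x) + flat 0 x.
Proof.
have [x0|x0] := leP x 0; last by rewrite ltr_wpDl ?flat_ge0 // flat_gt0.
by rewrite ltr_pwDl ?flat_ge0 // flat_gt0 //; lra.
Qed.

Lemma smooth_step : smooth (step : R^o -> R).
Proof.
have h : smooth (fun x : R^o => flat 0 (1 - x)).
  apply: (smooth_comp_scal _ (@Cinf_flat R 0)).
  by apply: smoothB; [exact: smooth_cst|move=> k; exact: Ck_id].
apply: smoothM => //; apply: smooth_inv => [x|].
  by rewrite gt_eqF // step_den.
by apply: smoothD => // k; exact: Cinf_flat.
Qed.

Lemma step1 x : x <= 0 -> step x = 1.
Proof.
move=> x0; have := step_den x; rewrite /step (flat0 _ x0) addr0 => h.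
by rewrite divff // gt_eqF.
Qed.

Lemma step0 x : 1 <= x -> step x = 0.
Proof. by move=> x1; rewrite /step flat0 ?mul0r // subr_le0. Qed.

Lemma step_ge0 x : 0 <= step x.
Proof. by rewrite divr_ge0 ?flat_ge0 // ltW // step_den. Qed.

Lemma step_le1 x : step x <= 1.
Proof. by rewrite ler_pdivrMr ?step_den // mul1r lerDl flat_ge0. Qed.

End Cutoff.

Section NormSq.
Variable R : realType.

Lemma normsq_ge0 n (x : 'rV[R]_n) : 0 <= normsq x.
Proof. by apply: sumr_ge0 => i _; exact: sqr_ge0. Qed.

Lemma coord_le_norm n (x : 'rV[R]_n) j : `|x 0 j| <= `|x|.
Proof.
rewrite [leRHS]/Num.Def.normr/= mx_normrE.
exact: (le_bigmax _ (fun ij : 'I_1 * 'I_n => `|x ij.1 ij.2|) (0, j)).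
Qed.

Lemma norm_le n (x : 'rV[R]_n) c :
  0 <= c -> (forall j, `|x 0 j| <= c) -> `|x| <= c.
Proof.
move=> c0 h; rewrite [leLHS]/Num.Def.normr/= mx_normrE bigmax_le //= => -[i j] _ /=.
by rewrite (ord1 i).
Qed.

Lemma normsq_le_norm n (x : 'rV[R]_n) : normsq x <= n%:R * `|x| ^+ 2.
Proof.
have -> : n%:R * `|x| ^+ 2 = \sum_(i < n) `|x| ^+ 2.
  by rewrite sumr_const card_ord mulr_natl.
apply: ler_sum => i _; rewrite -[x 0 i ^+ 2]real_normK ?num_real //.
by rewrite lerXn2r ?nnegrE // coord_le_norm.
Qed.

Lemma norm_le_normsq n (x : 'rV[R]_n) : `|x| ^+ 2 <= normsq x.
Proof.
rewrite -[leRHS]sqr_sqrtr ?normsq_ge0 // lerXn2r ?nnegrE ?sqrtr_ge0 //.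
apply: norm_le => [|j]; first exact: sqrtr_ge0.
rewrite -sqrtr_sqr ler_wsqrtr // /normsq (bigD1 j) //= lerDl.
by apply: sumr_ge0 => i _; exact: sqr_ge0.
Qed.

Lemma normsq_eq0 n (x : 'rV[R]_n) : normsq x = 0 -> x = 0.
Proof.
move=> h; have := norm_le_normsq x; rewrite h => h2.
apply/eqP; rewrite -normr_eq0 -sqrf_eq0; apply/eqP/le_anti.
by rewrite h2 sqr_ge0.
Qed.

Lemma normsqZ n (a : R) (u : 'rV[R]_n) : normsq (a *: u) = a ^+ 2 * normsq u.
Proof. by rewrite /normsq mulr_sumr; apply: eq_bigr => i _; rewrite mxE exprMn. Qed.

(** A step function of the square of the Euclidean distance, which is smooth,
    compared with the maximum norm. *)
Lemma exists_bump n (x : 'rV[R]_n) (e : R) : 0 < e ->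
  exists (rho : 'rV[R]_n -> R) (d : R),
    [/\ smooth rho, 0 < d, forall y, `|y - x| < d -> rho y = 1,
        forall y, e <= `|y - x| -> rho y = 0 & forall y, 0 <= rho y <= 1].
Proof.
move=> e0; pose s := e ^+ 2 / 2.
have s0 : 0 < s by rewrite divr_gt0 // exprn_gt0.
have p0 : (0 : R) < n%:R + 1 by rewrite ltr_wpDl // ler0n.
exists (fun y => step (normsq (y - x) / s - 1)), (Num.sqrt (s / (n%:R + 1))).
split.
- apply: smooth_comp_scal; last exact: smooth_step.
  apply: smoothB; last exact: smooth_cst.
  apply: smoothM; last exact: smooth_cst.
  by apply: smooth_normsq; apply: smoothB; [exact: smooth_id|exact: smooth_cst].
- by rewrite sqrtr_gt0 divr_gt0.
- move=> y yx; apply: step1; rewrite subr_le0 ler_pdivrMr // mul1r.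
  apply: le_trans (normsq_le_norm _) _.
  have : `|y - x| ^+ 2 <= s / (n%:R + 1).
    rewrite -[leRHS]sqr_sqrtr; last by rewrite ltW // divr_gt0.
    by rewrite lerXn2r ?nnegrE ?sqrtr_ge0 // ltW.
  rewrite ler_pdivlMr // => h; have := sqr_ge0 `|y - x|; nra.
- move=> y yx; apply: step0; rewrite lerBrDr ler_pdivlMr //.
  have : e ^+ 2 <= normsq (y - x).
    by apply: le_trans (norm_le_normsq _); rewrite lerXn2r ?nnegrE // ltW.
  by rewrite /s; lra.
- by move=> y; rewrite step_ge0 step_le1.
Qed.

End NormSq.


(** * Extending smooth maps from subsets *)

Section Extension.
Variable R : realType.

Lemma nbhs_distP n (x : 'rV[R]_n) (A : set 'rV[R]_n) :
  nbhs x A <-> exists2 e : R, 0 < e & forall y, `|y - x| < e -> A y.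
Proof.
split.
  move=> /nbhs_ballP[e e0 h]; exists e => // y yx; apply: h.
  by rewrite -ball_normE /= distrC.
case=> e e0 h; apply/nbhs_ballP; exists e => // y.
by rewrite -ball_normE /= distrC; exact: h.
Qed.

Lemma near_dist n (x : 'rV[R]_n) (e : R) : 0 < e -> \forall y \near x, `|y - x| < e.
Proof. by move=> e0; apply/nbhs_distP; exists e. Qed.

Lemma open_distP n (A : set 'rV[R]_n) x : open A -> A x ->
  exists2 e : R, 0 < e & forall y, `|y - x| < e -> A y.
Proof. by move=> oA Ax; apply/nbhs_distP; exact: open_nbhs_nbhs. Qed.

Lemma continuous_dist m n (f : 'rV[R]_m -> 'rV[R]_n) x (e : R) :
  {for x, continuous f} -> 0 < e ->
  exists2 d : R, 0 < d & forall y, `|y - x| < d -> `|f y - f x| < e.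
Proof.
move=> fc e0; have : nbhs x (f @^-1` [set z | `|z - f x| < e]).
  by apply: fc; apply/nbhs_distP; exists e.
by case/nbhs_distP => d d0 h; exists d.
Qed.

Lemma open_far n (x : 'rV[R]_n) (e : R) : open [set y | e < `|y - x|].
Proof.
rewrite openE => y /= h; apply/nbhs_distP.
exists (`|y - x| - e) => [|z zy]; first by rewrite subr_gt0.
have := ler_normD (z - x) (y - z).
have -> : z - x + (y - z) = y - x by rewrite addrC subrKA.
by rewrite (distrC z y) in zy; rewrite /=; lra.
Qed.

(** Near each point a smooth map on a subset is the restriction of a map
    that is smooth on the whole space. *)
Lemma smooth_on_near m n (A : set 'rV[R]_m) (f : 'rV[R]_m -> 'rV[R]_n) x :
  smooth_on A f -> A x ->
  exists (g : 'rV[R]_m -> 'rV[R]_n) (r : R),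
    [/\ smooth g, 0 < r & forall y, A y -> `|y - x| < r -> f y = g y].
Proof.
move=> sf Ax; have [U [g [oU Ux Cg fg]]] := sf x Ax.
have [e e0 eU] := open_distP oU Ux.
have [rho [d [Crho d0 rho1 rho0 _]]] := @exists_bump R _ x _ (divr_gt0 e0 (ltr0n R 2)).
exists (fun y => rho y *: g y), (Num.min d e); split => [k||y Ay].
- apply: Ck_local => y _; have [ye|ye] := ltP `|y - x| e.
    exists U; first exact: eU.
    apply: Ck_row => // j.
    apply: (@Ck_eq _ _ _ _ _ (fun x => rho x * g x 0 j)) => //.
      by move=> z _; rewrite mxE.
    apply: CkM => //; last exact: Ck_coord.
    exact: Ck_sub (Crho k).
  exists [set y | e / 2 < `|y - x|] => /=; first by apply: lt_le_trans ye; lra.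
  apply: (@Ck_eq _ _ _ _ _ (fun=> 0)); [exact: open_far| |exact: Ck_cst].
  by move=> z /= ze; rewrite rho0 ?scale0r // ltW.
- by rewrite lt_min d0.
- rewrite lt_min => /andP[yd ye]; rewrite rho1 // scale1r fg //.
  exact: eU.
Qed.

Lemma smooth_on_continuous m n (A : set 'rV[R]_m) (f : 'rV[R]_m -> 'rV[R]_n) x (e : R) :
  smooth_on A f -> A x -> 0 < e ->
  exists2 d : R, 0 < d & forall y, A y -> `|y - x| < d -> `|f y - f x| < e.
Proof.
move=> sf Ax e0; have [g [r [Cg r0 fg]]] := smooth_on_near sf Ax.
have [d d0 h] := continuous_dist (smooth_continuous Cg (x:=x)) e0.
exists (Num.min d r); first by rewrite lt_min d0.
move=> y Ay; rewrite lt_min => /andP[yd yr].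
by rewrite !fg // ?subrr ?normr0 //; exact: h.
Qed.

Lemma smooth_smooth_on m n (A : set 'rV[R]_m) (f : 'rV[R]_m -> 'rV[R]_n) :
  (forall x, A x -> exists (g : 'rV[R]_m -> 'rV[R]_n) (r : R),
    [/\ smooth g, 0 < r & forall y, A y -> `|y - x| < r -> f y = g y]) ->
  smooth_on A f.
Proof.
move=> h x Ax; have [g [r [Cg r0 fg]]] := h x Ax.
exists [set y | `|y - x| < r], g; split => [||k|y Ay yr].
- have -> : [set y | `|y - x| < r] = ball x r.
    by apply/seteqP; split=> y; rewrite -ball_normE /= distrC.
  exact: ball_open.
- by rewrite /= subrr normr0.
- exact: Ck_sub (Cg k).
- by rewrite fg.
Qed.

Lemma smooth_on_compact m n (A : set 'rV[R]_m) (f : 'rV[R]_m -> 'rV[R]_n) :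
  compact A -> smooth_on A f -> compact (f @` A).
Proof.
move=> cA sf; apply: continuous_compact => //.
apply/subspace_continuousP => x Ax; apply/cvgrPdist_lt => e e0.
have [d d0 h] := smooth_on_continuous sf Ax e0.
rewrite near_withinE; apply/nbhs_distP; exists d => // y yd Ay.
by rewrite distrC; exact: h.
Qed.

Lemma smooth_on_comp m n p (A : set 'rV[R]_m) (B : set 'rV[R]_n)
  (f : 'rV[R]_m -> 'rV[R]_n) (g : 'rV[R]_n -> 'rV[R]_p) :
  smooth_on A f -> smooth_on B g -> (forall x, A x -> B (f x)) ->
  smooth_on A (g \o f).
Proof.
move=> sf sg AB; apply: smooth_smooth_on => x Ax.
have [f' [r [Cf r0 ff]]] := smooth_on_near sf Ax.
have [g' [s [Cg s0 gg]]] := smooth_on_near sg (AB _ Ax).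
have [d d0 h] := smooth_on_continuous sf Ax s0.
exists (fun x => g' (f' x)), (Num.min r d); split.
- exact: smooth_comp.
- by rewrite lt_min r0.
- move=> y Ay; rewrite lt_min => /andP[yr yd] /=.
  by rewrite gg; [rewrite ff|exact: AB|exact: h].
Qed.

Lemma smooth_on_sub m n (A B : set 'rV[R]_m) (f : 'rV[R]_m -> 'rV[R]_n) :
  A `<=` B -> smooth_on B f -> smooth_on A f.
Proof.
move=> AB sf x Ax; have [U [g [oU Ux Cg fg]]] := sf x (AB _ Ax).
by exists U, g; split=> // y /AB; exact: fg.
Qed.

Lemma smooth_on_global m n (A : set 'rV[R]_m) (f : 'rV[R]_m -> 'rV[R]_n) :
  smooth f -> smooth_on A f.
Proof. by move=> sf; apply: smooth_smooth_on => x _; exists f, 1. Qed.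

(** A partition of unity glues the local extensions. *)
Lemma smooth_extension m n (A : set 'rV[R]_m) (f : 'rV[R]_m -> 'rV[R]_n) :
  compact A -> smooth_on A f ->
  exists2 g : 'rV[R]_m -> 'rV[R]_n, smooth g & forall x, A x -> f x = g x.
Proof.
move=> cA sf.
have loc x : exists p : ('rV[R]_m -> 'rV[R]_n) * ('rV[R]_m -> R),
   A x -> [/\ smooth p.1, smooth p.2, p.2 x = 1, forall y, 0 <= p.2 y &
     forall y, A y -> p.2 y != 0 -> f y = p.1 y].
  have [Ax|nAx] := pselect (A x); last by exists (fun=> 0, fun=> 0).
  have [g [r [Cg r0 fg]]] := smooth_on_near sf Ax.
  have [rho [d [Crho d0 rho1 rho0 rho01]]] := @exists_bump R _ x _ r0.
  exists (g, rho) => _ /=; split=> //.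
  - by apply: rho1; rewrite subrr normr0.
  - by move=> y; have /andP[] := rho01 y.
  - move=> y Ay; have [yr _|yr] := ltP `|y - x| r; first exact: fg.
    by rewrite rho0 // eqxx.
have [p hp] := choice loc.
have := cA; rewrite compact_cover => /(_ _ A (fun x => [set y | 0 < (p x).2 y])) [].
- move=> x Ax; have [_ Crho _ _ _] := hp x Ax.
  apply: (@open_comp _ _ (p x).2 [set r | 0 < r]); last exact: open_gt.
  by move=> y _; exact: smooth_continuous.
- by move=> x Ax; exists x => //=; have [_ _ -> _ _] := hp x Ax.
move=> D0 D0A cov0; pose D' : seq 'rV[R]_m := finmap.enum_fset D0.
have D'A : {subset D' <= A} by move=> x xD; exact: D0A.
have cov y : A y -> exists2 x, x \in D' & 0 < (p x).2 y by move=> /cov0.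
pose s y := \sum_(x <- D') (p x).2 y.
have AD x : x \in D' -> A x by move=> /D'A; rewrite inE.
have Cs : smooth s.
  rewrite /s (_ : (fun _ => _) = fun y => \sum_(x <- D' | x \in D') (p x).2 y); last first.
    by apply/funext => y; rewrite big_seq.
  by apply: smooth_sum => x /AD Ax; have [] := hp x Ax.
have s0 y : 0 <= s y.
  by rewrite /s big_seq; apply: sumr_ge0 => x /AD Ax; have [] := hp x Ax.
have sA y : A y -> 0 < s y.
  move=> Ay; have [x /= xD' xy] := cov y Ay.
  rewrite /s (big_rem x) //= ltr_pwDl //.
  rewrite big_seq; apply: sumr_ge0 => z zD'.
  have /AD Az : z \in D' by apply: mem_rem zD'.
  by have [] := hp z Az.
have [A0|nA0] := pselect (A !=set0); last first.
  by exists (fun=> 0); [exact: smooth_cst|move=> x Ax; case: nA0; exists x].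
have [c /set_mem Ac cmin] :=
  EVT_min_rV A0 cA (continuous_subspaceT (smooth_continuous Cs)).
pose q y := s y + flat 0 (s c - s y).
have q0 y : 0 < q y.
  have [sy|sy] := ltP (s y) (s c).
    by rewrite ltr_wpDl // flat_gt0 // subr_gt0.
  by rewrite ltr_pwDl ?flat_ge0 // (lt_le_trans (sA _ Ac)).
have qA y : A y -> q y = s y.
  by move=> Ay; rewrite /q flat0 ?addr0 // subr_le0; apply: cmin; exact/mem_set.
exists (fun y => (q y)^-1 *: \sum_(x <- D') (p x).2 y *: (p x).1 y).
  apply: smooth_scale.
    apply: smooth_inv => [y|]; first by rewrite gt_eqF.
    apply: smoothD => //; apply: smooth_comp_scal; last exact: Cinf_flat.
    by apply: smoothB => //; exact: smooth_cst.
  rewrite (_ : (fun _ => _) = fun y => \sum_(x <- D' | x \in D') (p x).2 y *: (p x).1 y).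
    by apply: smooth_sum => x /AD Ax; have [? ? _ _ _] := hp x Ax; exact: smooth_scale.
  by apply/funext => y; rewrite big_seq.
move=> y Ay; rewrite qA //.
have -> : \sum_(x <- D') (p x).2 y *: (p x).1 y = s y *: f y.
  rewrite /s scaler_suml big_seq [RHS]big_seq; apply: eq_bigr => x /AD Ax.
  have [_ _ _ _ h] := hp x Ax.
  by have [->|/h ->//] := eqVneq ((p x).2 y) 0; rewrite !scale0r.
by rewrite scalerA mulVf ?scale1r // gt_eqF // sA.
Qed.

End Extension.


(** * Quantitative first order estimates *)

Section Lipschitz.
Variable R : realType.

Lemma mx_bound n p (M : 'M[R]_(n, p)) :
  exists2 C : R, 0 < C & forall u : 'rV[R]_n, `|u *m M| <= C * `|u|.
Proof.
pose S := \sum_i \sum_j `|M i j|.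
have S0 : 0 <= S by apply: sumr_ge0 => i _; apply: sumr_ge0.
exists (S + 1) => [|u]; first by rewrite ltr_wpDl.
apply: norm_le => [|j]; first by rewrite mulr_ge0 // addr_ge0.
rewrite mxE; apply: le_trans (ler_norm_sum _ _ _) _.
apply: (@le_trans _ _ (S * `|u|)); last by rewrite ler_wpM2r // lerDl.
rewrite mulr_suml; apply: ler_sum => i _.
rewrite normrM mulrC; apply: ler_pM => //; last exact: coord_le_norm.
by rewrite (bigD1 j) //= lerDl sumr_ge0.
Qed.

Lemma smooth_mulmxr n p (M : 'M[R]_(n, p)) : smooth (fun x : 'rV[R]_n => x *m M).
Proof.
apply: smooth_row => j.
rewrite (_ : (fun _ => _) = fun x : 'rV[R]_n => \sum_i x 0 i * M i j); last first.
  by apply/funext => x; rewrite mxE.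
apply: smooth_sum => i _; apply: smoothM; last exact: smooth_cst.
by apply: smooth_coord; exact: smooth_id.
Qed.

Lemma is_derive_line n (g : 'rV[R]_n -> R) x v s :
  differentiable g (x + s *: v) ->
  is_derive (s : R^o) (1 : R^o) (fun s : R => g (x + s *: v)) ('D_v g (x + s *: v)).
Proof.
move=> dg; have := diff_derivable (v := v) dg; rewrite /derivable => h.
have e : (fun h => h^-1 *: (g (x + (h *: (1 : R^o) + s) *: v) - g (x + s *: v))) =
  (fun h : R => h^-1 *: (g (h *: v + (x + s *: v)) - g (x + s *: v))).
  apply/funext => t; congr (_ *: (g _ - _)).
  by rewrite [t *: (1 : R^o)]mulr1 scalerDl addrCA.
by apply: DeriveDef; rewrite /derivable /derive /= e.
Qed.

Lemma derive_basis n p (f : 'rV[R]_n -> 'rV[R]_p) x v :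
  differentiable f x -> 'D_v f x = \sum_i v 0 i *: 'D_(delta_mx 0 i) f x.
Proof.
move=> df; rewrite (deriveE v df) {1}(row_sum_delta v) linear_sum /=.
by apply: eq_bigr => i _; rewrite linearZ /= (deriveE _ df).
Qed.

(** The mean value theorem on segments of the ball, which is convex. *)
Lemma lip_ball n p (f : 'rV[R]_n -> 'rV[R]_p) x (r K : R) :
  smooth f -> (forall z, `|z - x| < r -> forall i, `|'D_(delta_mx 0 i) f z| <= K) ->
  forall y z, `|y - x| < r -> `|z - x| < r -> `|f y - f z| <= n%:R * K * `|y - z|.
Proof.
move=> Cf h y z yr zr; pose v := y - z.
have K0 (i : 'I_n) : 0 <= K by apply: le_trans (h _ yr i).
have nK0 : 0 <= n%:R * K.
  case: n f x Cf h y z yr zr v K0 => [|n] *; first by rewrite mul0r.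
  by rewrite mulr_ge0 // (_ : 0 <= K) //; auto using ord0.
clear K0.
apply: norm_le => [|j]; first by rewrite mulr_ge0.
have dfj s : is_derive (s : R^o) (1 : R^o) (fun s : R => f (z + s *: v) 0 j)
    ('D_v f (z + s *: v) 0 j).
  have := @is_derive_line _ (fun u => f u 0 j) z v s.
  rewrite derive_coord; last exact: smooth_differentiable.
  by apply; apply: smooth_differentiable; exact: smooth_coord.
have [|c] := @MVT_segment _ (fun s : R => f (z + s *: v) 0 j) _ 0 1 ler01 (fun s _ => dfj s).
  apply: continuous_subspaceT => s.
  by apply: differentiable_continuous; apply/derivable1_diffP; case: (dfj s).
rewrite in_itv /= => /andP[c0 c1].
rewrite subr0 mulr1 => e.
have -> : (f y - f z) 0 j = 'D_v f (z + c *: v) 0 j.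
  by rewrite -e scale1r scale0r addr0 /v (addrC z) subrK !mxE.
have cb : `|z + c *: v - x| < r.
  have -> : z + c *: v - x = (1 - c) *: (z - x) + c *: (y - x).
    by apply/rowP => i; rewrite !mxE; ring.
  apply: le_lt_trans (ler_normD _ _) _; rewrite !normrZ !ger0_norm ?subr_ge0 //.
  pose M := Num.max `|z - x| `|y - x|.
  have Mr : M < r by rewrite /M gt_max zr yr.
  have zM : `|z - x| <= M by rewrite le_max lexx.
  have yM : `|y - x| <= M by rewrite le_max lexx orbT.
  apply: le_lt_trans Mr; have c1' : 0 <= 1 - c by rewrite subr_ge0.
  have := ler_wpM2l c1' zM; have := ler_wpM2l c0 yM.
  lra.
apply: le_trans (coord_le_norm _ _) _.
rewrite derive_basis; last exact: smooth_differentiable.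
apply: le_trans (ler_norm_sum _ _ _) _.
rewrite -mulrA mulr_natl -[X in _ *+ X]card_ord -sumr_const.
apply: ler_sum => i _; rewrite normrZ mulrC; apply: ler_pM => //.
  exact: h.
exact: coord_le_norm.
Qed.

Lemma near_forall_ball n (I : finType) (P : I -> 'rV[R]_n -> Prop) x :
  (forall i, exists2 r : R, 0 < r & forall z, `|z - x| < r -> P i z) ->
  exists2 r : R, 0 < r & forall z, `|z - x| < r -> forall i, P i z.
Proof.
move=> h.
have : \forall z \near x, forall i, P i z.
  apply: (@filter_forall _ I P _ (nbhs_filter x)) => i; apply/nbhs_distP; exact: h.
by case/nbhs_distP => r r0 hr; exists r.
Qed.

Lemma smooth_lipschitz n p (f : 'rV[R]_n -> 'rV[R]_p) x : smooth f ->
  exists (K r : R), [/\ 0 < K, 0 < r &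
    forall y z, `|y - x| < r -> `|z - x| < r -> `|f y - f z| <= K * `|y - z|].
Proof.
move=> Cf; pose K := \sum_(i < n) (`|'D_(delta_mx 0 i) f x| + 1).
have K0 : 0 <= K by apply: sumr_ge0 => i _; rewrite addr_ge0.
have [i|r r0 hr] := @near_forall_ball _ 'I_n (fun i z => `|'D_(delta_mx 0 i) f z| <= K) x.
  have [d d0 h] := continuous_dist (smooth_continuous (smooth_derive (delta_mx 0 i) Cf) (x := x)) ltr01.
  exists d => // z /h zd; apply: (@le_trans _ _ (`|'D_(delta_mx 0 i) f x| + 1)).
    by have := ler_normD ('D_(delta_mx 0 i) f x) ('D_(delta_mx 0 i) f z - 'D_(delta_mx 0 i) f x); rewrite addrC subrK; lra.
  by rewrite /K (bigD1 i) //= lerDl; apply: sumr_ge0 => k _; rewrite addr_ge0.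
exists (n%:R * K + 1), r; split => //.
  by rewrite ltr_wpDl // mulr_ge0.
move=> y z yr zr; apply: le_trans (lip_ball Cf hr yr zr) _.
by rewrite ler_wpM2r // lerDl.
Qed.

(** Smooth maps are strictly differentiable. *)
Lemma smooth_strict n p (f : 'rV[R]_n -> 'rV[R]_p) x (e : R) : smooth f -> 0 < e ->
  exists2 r : R, 0 < r & forall y z, `|y - x| < r -> `|z - x| < r ->
    `|f y - f z - (y - z) *m jacobian f x| <= e * `|y - z|.
Proof.
move=> Cf e0; pose h y := f y - y *m jacobian f x.
have Ch : smooth h by apply: smoothB => //; exact: smooth_mulmxr.
have Dh0 v : 'D_v h x = 0.
  have dJ : differentiable (fun y : 'rV[R]_n => y *m jacobian f x) x.
    by apply: smooth_differentiable; exact: smooth_mulmxr.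
  have df : differentiable f x by exact: smooth_differentiable.
  rewrite (@deriveB _ _ _ f); try exact: diff_derivable.
  rewrite [X in _ - X](deriveE v dJ).
  rewrite (diff_lin x (f := mulmxr (jacobian f x))); last first.
    exact: smooth_continuous (smooth_mulmxr _).
  by rewrite deriveEjacobian // subrr.
have n0 : (0 : R) < n%:R + 1 by rewrite ltr_wpDl.
have en0 : 0 < e / (n%:R + 1) by rewrite divr_gt0.
have [i|r r0 hr] := @near_forall_ball _ 'I_n (fun i z => `|'D_(delta_mx 0 i) h z| <= e / (n%:R + 1)) x.
  have [d d0 hd] := continuous_dist (smooth_continuous (smooth_derive (delta_mx 0 i) Ch) (x := x)) en0.
  by exists d => // z /hd; rewrite Dh0 subr0 => /ltW.
exists r => // y z yr zr.
have -> : f y - f z - (y - z) *m jacobian f x = h y - h z.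
  by rewrite /h mulmxBl; apply/rowP => i; rewrite !mxE; ring.
apply: le_trans (lip_ball Ch hr yr zr) _.
by rewrite ler_wpM2r // mulrA ler_pdivrMr // mulrC ler_wpM2l // ?lerDl ltW.
Qed.

(** The differential is chosen as some linear map with a first order expansion,
    so any such map gives differentiability and is the differential. *)
Lemma diff_intro (V W : normedModType R) (f : V -> W) (df : {linear V -> W}) x :
  continuous df ->
  (forall e : R, 0 < e -> \forall h \near (0 : V),
     `|f (h + x) - f x - df h| <= e * `|h|) ->
  differentiable f x /\ 'd f x = df :> (V -> W).
Proof.
move=> cdf H.
have ex : f \o shift x = cst (f x) + df +o_ 0 id.
  apply/eqaddoE/eqaddoP => e e0; apply: filterS (H e e0) => h.
  by rewrite -![(_ - _) h]/(_ - _) /= opprD addrA.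
have e := diff_unique cdf ex; split=> //.
by apply/diff_locallyP; rewrite e.
Qed.

End Lipschitz.


(** * Inverse functions *)

Section Inverse.
Variable R : realType.

(** Injectivity with a rate.  Unlike invertibility of a differential, this makes
    sense on arbitrary subsets and passes through compositions and restrictions. *)
Definition lower_lip n p (B : set 'rV[R]_n) (f : 'rV[R]_n -> 'rV[R]_p) (c : R) :=
  forall y z, B y -> B z -> c * `|y - z| <= `|f y - f z|.

Definition dball n (x : 'rV[R]_n) (r : R) : set 'rV[R]_n := [set y | `|y - x| < r].

Lemma open_dball n (x : 'rV[R]_n) r : open (dball x r).
Proof.
have -> : dball x r = ball x r.
  by apply/seteqP; split=> y; rewrite -ball_normE /dball /= distrC.
exact: ball_open.
Qed.

Lemma dball_self n (x : 'rV[R]_n) r : 0 < r -> dball x r x.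
Proof. by rewrite /dball /= subrr normr0. Qed.

Lemma small_multiple (a r : R) : 0 <= a -> 0 < r -> exists2 t : R, 0 < t & t * a < r.
Proof.
move=> a0 r0; exists (r / (a + 1)); first by rewrite divr_gt0 // ltr_wpDl.
by rewrite mulrAC ltr_pdivrMr ?ltr_wpDl // ltr_pM2l // ltrDl.
Qed.

Lemma lower_lip_jacobian n p (f : 'rV[R]_n -> 'rV[R]_p) x (c r : R) :
  smooth f -> 0 < c -> 0 < r -> lower_lip (dball x r) f c ->
  forall v : 'rV[R]_n, c / 2 * `|v| <= `|v *m jacobian f x|.
Proof.
move=> Cf c0 r0 L v.
have [s s0 hs] := smooth_strict x Cf (divr_gt0 c0 (ltr0n R 2)).
have m0 : 0 < Num.min r s by rewrite lt_min r0.
have [t t0 tv] := small_multiple (normr_ge0 v) m0.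
have ty : `|t *: v + x - x| < Num.min r s.
  by rewrite addrK normrZ gtr0_norm.
move: ty; rewrite lt_min => /andP[tr ts].
have x0 : `|x - x| < s by rewrite subrr normr0.
have xr : dball x r x by apply: dball_self.
have := L _ _ tr xr; have := hs _ _ ts x0.
rewrite addrK -scalemxAl normrZ gtr0_norm // => h1 h2.
have h3 := ler_normD (f (t *: v + x) - f x - t *: (v *m jacobian f x)) (t *: (v *m jacobian f x)).
rewrite subrK [X in _ <= _ + X]normrZ (gtr0_norm t0) in h3.
rewrite -(ler_pM2l t0); lra.
Qed.

(** By strict differentiability differences of [f] are those of its differential
    up to an arbitrarily small fraction of the distance. *)
Lemma jacobian_lower_lip n p (f : 'rV[R]_n -> 'rV[R]_p) x (c : R) :
  smooth f -> 0 < c -> (forall v : 'rV[R]_n, c * `|v| <= `|v *m jacobian f x|) ->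
  exists2 r : R, 0 < r & lower_lip (dball x r) f (c / 2).
Proof.
move=> Cf c0 h; have [r r0 hr] := smooth_strict x Cf (divr_gt0 c0 (ltr0n R 2)).
exists r => // y z yr zr; have h1 := hr _ _ yr zr; have h2 := h (y - z).
have h3 := ler_normD (f y - f z) ((y - z) *m jacobian f x - (f y - f z)).
rewrite addrCA subrr addr0 (distrC _ (f y - f z)) in h3; lra.
Qed.

Lemma lower_lip_unit n (f : 'rV[R]_n -> 'rV[R]_n) x (c r : R) :
  smooth f -> 0 < c -> 0 < r -> lower_lip (dball x r) f c ->
  jacobian f x \in unitmx.
Proof.
move=> Cf c0 r0 L; rewrite -row_free_unit; apply: inj_row_free => v vJ.
have := lower_lip_jacobian Cf c0 r0 L v; rewrite vJ normr0 => h.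
apply/eqP; rewrite -normr_le0; have c2 : 0 < c / 2 by rewrite divr_gt0.
by rewrite -(pmulr_rle0 _ c2).
Qed.

Lemma derive_normsq n (f : 'rV[R]_n -> 'rV[R]_n) a x v : smooth f ->
  'D_v (fun z => normsq (f z - a)) x = 2 * \sum_j (f x - a) 0 j * ('D_v f x) 0 j.
Proof.
move=> Cf; rewrite (_ : (fun _ => _) = \sum_j ((fun z => (f z - a) 0 j) ^+ 2)); last first.
  apply/funext => z; rewrite fct_sumE /normsq; apply: eq_bigr => j _.
  by rewrite exprfctE.
have Ca : smooth (fun z => f z - a) by apply: smoothB => //; exact: smooth_cst.
have dj j : derivable (fun z => (f z - a) 0 j) x v.
  by apply: diff_derivable; apply: smooth_differentiable; exact: smooth_coord.
rewrite derive_sum; last by move=> j; exact: derivableX.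
rewrite mulr_sumr; apply: eq_bigr => j _.
rewrite deriveX // expr1 -[_ *: _]/(_ * _) mulrA; congr (_ * _).
rewrite derive_coord; last exact: smooth_differentiable.
congr (fun_of_matrix _ _ _); rewrite (@deriveB _ _ _ f) ?derive_cst ?subr0 //.
exact/diff_derivable/smooth_differentiable.
Qed.

Lemma compact_cball n (x : 'rV[R]_n) (s : R) : compact [set z | `|z - x| <= s].
Proof.
apply: bounded_closed_compact.
  exists (`|x| + s); split; first exact: num_real.
  move=> M hM z /= zs; apply: le_trans (ltW hM).
  by have := ler_normD (z - x) x; rewrite subrK; lra.
have -> : [set z | `|z - x| <= s] = ~` [set z | s < `|z - x|].
  by apply/seteqP; split => z /=; rewrite leNgt => /negP.
by apply: open_closedC; exact: open_far.
Qed.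

(** A value [a] close to [f x] is attained where the squared distance of [f]
    to [a] is minimal, since that minimum is not on the boundary of the ball
    and the derivative of [f] is onto. *)
Lemma lower_lip_onto n (B : set 'rV[R]_n) (f : 'rV[R]_n -> 'rV[R]_n) (c s : R) x a :
  smooth f -> open B -> 0 < c -> lower_lip B f c -> 0 < s ->
  (forall z, `|z - x| <= s -> B z) -> `|a - f x| < c * s / (n%:R + 2) ->
  (f @` B) a.
Proof.
move=> Cf oB c0 L s0 sB; pose d := c * s / (n%:R + 2).
have n2 : (0 : R) < n%:R + 2 by rewrite ltr_wpDl.
have d0 : 0 < d by rewrite divr_gt0 // mulr_gt0.
have dE : c * s = (n%:R + 2) * d by rewrite /d [RHS]mulrC divfK // gt_eqF.
rewrite -/d; clearbody d => ad.
have Bx : B x by apply: sB; rewrite subrr normr0 ltW.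
pose K : set 'rV[R]_n := [set z | `|z - x| <= s].
have cK : compact K by exact: compact_cball.
have K0 : K !=set0 by exists x; rewrite /K /= subrr normr0 ltW.
pose N z := normsq (f z - a).
have CN : smooth N.
  by apply: smooth_normsq; apply: smoothB => //; exact: smooth_cst.
have [z /set_mem Kz zmin] := EVT_min_rV K0 cK (continuous_subspaceT (smooth_continuous CN)).
have zs : `|z - x| < s.
  rewrite lt_neqAle Kz andbT; apply/eqP => zs.
  have := zmin x (mem_set _); rewrite /K /= subrr normr0 (ltW s0) => /(_ isT).
  apply/negP; rewrite -ltNge.
  have h1 : normsq (f x - a) <= n%:R * d ^+ 2.
    apply: le_trans (normsq_le_norm _) _; rewrite ler_wpM2l // lerXn2r ?nnegrE ?(ltW d0) //.
    by rewrite distrC ltW.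
  have h2 : (n%:R + 1) * d <= `|f z - a|.
    have := L _ _ (sB _ Kz) Bx; rewrite zs.
    rewrite dE.
    have := ler_normD (f z - a) (a - f x); rewrite addrA subrK.
    lra.
  have h3 : ((n%:R + 1) * d) ^+ 2 <= normsq (f z - a).
    apply: le_trans (norm_le_normsq _); rewrite lerXn2r ?nnegrE //.
    by rewrite mulr_ge0 ?addr_ge0 ?(ltW d0).
  apply: le_lt_trans h1 (lt_le_trans _ h3); rewrite exprMn ltr_pM2r ?exprn_gt0 //.
  have := ler0n R n; nra.
have Bz := sB _ Kz.
have crit v : 'D_v N z = 0.
  have zs' : 0 < s - `|z - x| by rewrite subr_gt0.
  have [t t0 tv] := small_multiple (normr_ge0 v) zs'.
  have dl (u : R^o) : is_derive u (1 : R^o) (fun u : R => N (z + u *: v)) ('D_v N (z + u *: v)).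
    by apply: is_derive_line; exact: smooth_differentiable.
  have := @derive1_at_min R (fun u : R => N (z + u *: v)) (- t) t 0.
  case.
  - by lra.
  - by move=> u _; case: (dl u).
  - by rewrite in_itv /= oppr_lt0 t0.
  - move=> u; rewrite in_itv /= => /andP[u1 u2]; rewrite scale0r addr0.
    apply: zmin; apply/mem_set; rewrite /K /=.
    have -> : z + u *: v - x = z - x + u *: v by rewrite addrAC.
    apply: le_trans (ler_normD _ _) _; rewrite normrZ.
    have ut : `|u| <= t by rewrite ler_norml; lra.
    have := ler_wpM2r (normr_ge0 v) ut; lra.
  - by move=> _ <-; case: (dl 0) => _ ->; rewrite scale0r addr0.
exists z => //.
have Ju : jacobian f z \in unitmx.
  have [q q0 qB] := open_distP oB Bz.
  by apply: (lower_lip_unit Cf c0 q0) => y y' /qB By /qB By'; exact: L.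
have := crit ((f z - a) *m invmx (jacobian f z)).
rewrite /N derive_normsq // deriveEjacobian; last exact: smooth_differentiable.
rewrite mulmxKV // => /eqP; rewrite mulf_eq0 pnatr_eq0 /= => /eqP h.
apply/eqP; rewrite -subr_eq0; apply/eqP/normsq_eq0.
by rewrite -[RHS]h; apply: eq_bigr => j _; rewrite expr2.
Qed.

Lemma lower_lip_open n (B : set 'rV[R]_n) (f : 'rV[R]_n -> 'rV[R]_n) (c : R) :
  smooth f -> open B -> 0 < c -> lower_lip B f c -> open (f @` B).
Proof.
move=> Cf oB c0 L; rewrite openE => _ [x Bx <-].
have [r r0 rB] := open_distP oB Bx.
have s0 : 0 < r / 2 by rewrite divr_gt0.
apply/nbhs_distP; exists (c * (r / 2) / (n%:R + 2)).
  by rewrite divr_gt0 ?mulr_gt0 // ltr_wpDl.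
move=> a ad; apply: (lower_lip_onto Cf oB c0 L s0 _ ad) => z h.
by apply: rB; lra.
Qed.

Lemma Ck_prod (V : normedModType R) k (O : set V) I (r : seq I) (F : I -> V -> R) :
  open O -> (forall i, Ck k O (F i)) -> Ck k O (fun x => \prod_(i <- r) F i x).
Proof.
move=> oO h; elim: r => [|a r IH].
  by apply: (Ck_eq oO _ (Ck_cst k O (1 : R))) => x _; rewrite big_nil.
apply: (Ck_eq oO _ (CkM oO (h a) IH)) => x _.
by rewrite big_cons.
Qed.

Lemma Ck_det (V : normedModType R) k (O : set V) n (A : V -> 'M[R]_n) :
  open O -> (forall i j, Ck k O (fun x => A x i j : R)) ->
  Ck k O (fun x => \det (A x) : R).
Proof.
move=> oO h; apply: Ck_sum => // s _; apply: CkM => //; first exact: Ck_cst.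
exact: Ck_prod.
Qed.

Lemma Ck_invmx (V : normedModType R) k (O : set V) n (A : V -> 'M[R]_n) :
  open O -> (forall i j, Ck k O (fun x => A x i j : R)) ->
  (forall x, O x -> A x \in unitmx) ->
  forall i j, Ck k O (fun x => invmx (A x) i j : R).
Proof.
move=> oO h u i j.
apply: (@Ck_eq _ _ _ _ _ (fun x => (\det (A x))^-1 * \adj (A x) i j)) => //.
  by move=> x Ox; rewrite /invmx (u x Ox) [RHS]mxE.
apply: CkM => //.
  apply: (Ck_comp_scal oO _ _ (@Cinf_inv R k)); last exact: Ck_det.
  by move=> x /u; rewrite unitmxE unitfE.
apply: (@Ck_eq _ _ _ _ _ (fun x => (-1) ^+ (j + i) * \det (row' j (col' i (A x))))) => //.
  by move=> x Ox; rewrite mxE.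
apply: CkM => //; first exact: Ck_cst.
apply: Ck_det => // a b.
by apply: (Ck_eq oO _ (h (lift j a) (lift i b))) => x _; rewrite !mxE.
Qed.

Lemma jacobianE n p (f : 'rV[R]_n -> 'rV[R]_p) x i j :
  smooth f -> jacobian f x i j = ('D_(delta_mx 0 i) f x) 0 j.
Proof.
move=> Cf; rewrite deriveEjacobian; last exact: smooth_differentiable.
by rewrite -rowE [RHS]mxE.
Qed.

(** The inverse is Lipschitz, hence differentiable with the inverse matrix as
    differential.  The entries of that matrix are rational functions of the
    derivatives of [f] taken at [g y], so a class [C^k] of [g] improves itself. *)
Lemma inverse_smooth n (B : set 'rV[R]_n) (f g : 'rV[R]_n -> 'rV[R]_n) (c : R) :
  smooth f -> open B -> 0 < c -> lower_lip B f c ->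
  (forall x, B x -> g (f x) = x) -> Cinf (f @` B) g.
Proof.
move=> Cf oB c0 L gf; have oW := lower_lip_open Cf oB c0 L.
have pol_log y z : (f @` B) y -> (f @` B) z -> `|g y - g z| <= c^-1 * `|y - z|.
  move=> [x Bx <-] [x' Bx' <-]; rewrite !gf // ler_pdivlMl //; exact: L.
have Ju x : B x -> jacobian f x \in unitmx.
  move=> Bx; have [q q0 qB] := open_distP oB Bx.
  by apply: (lower_lip_unit Cf c0 q0) => y y' /qB By /qB By'; exact: L.
have gc y (e : R) : (f @` B) y -> 0 < e -> exists2 d : R, 0 < d &
    forall z, `|z - y| < d -> (f @` B) z /\ `|g z - g y| < e.
  move=> Wy e0; have [d d0 dW] := open_distP oW Wy.
  exists (Num.min d (c * e)); first by rewrite lt_min d0 mulr_gt0.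
  move=> z; rewrite lt_min => /andP[/dW Wz zy]; split=> //.
  by apply: le_lt_trans (pol_log _ _ Wz Wy) _; rewrite ltr_pdivrMl.
have dg y : (f @` B) y -> differentiable g y /\
    'd g y = mulmxr (invmx (jacobian f (g y))) :> ('rV_n -> 'rV_n).
  move=> [x Bx <-]; rewrite gf //; set J := jacobian f x.
  apply: diff_intro => [|e e0]; first exact: smooth_continuous (smooth_mulmxr _).
  have [M M0 hM] := mx_bound (invmx J).
  have eM : 0 < e * c / M by rewrite divr_gt0 // mulr_gt0.
  have [r r0 hr] := smooth_strict x Cf eM.
  have Wx : (f @` B) (f x) by exists x.
  have [d d0 hd] := gc _ _ Wx r0.
  apply/nbhs_distP; exists d => // h; rewrite subr0 => hd'.
  have [|Wz] := hd (h + f x); first by rewrite addrK.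
  rewrite gf //; case: Wz => z Bz fz; rewrite -fz gf // => zr.
  have xr : `|x - x| < r by rewrite subrr normr0.
  have := hr _ _ zr xr; rewrite fz addrK -/J => H.
  have -> : z - x - mulmxr (invmx J) h = - ((h - (z - x) *m J) *m invmx J).
    by rewrite /= mulmxBl mulmxK ?Ju // opprB.
  rewrite normrN; apply: le_trans (hM _) _; rewrite mulrC -ler_pdivlMr //.
  apply: le_trans H _.
  have := pol_log _ _ Wx (ex_intro2 _ _ z Bz fz).
  rewrite !gf //.
  have -> : g (h + f x) = z by rewrite -fz gf.
  rewrite distrC (distrC _ (h + f x)) addrK => H.
  have -> : e * `|h| / M = e * c / M * (c^-1 * `|h|).
    by field; rewrite !gt_eqF.
  by rewrite ler_wpM2l // ltW.
elim=> [|k IH].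
  move=> y Wy; apply: differentiable_continuous; by case: (dg y Wy).
split=> [y Wy|v]; first by case: (dg y Wy).
have E y : (f @` B) y -> v *m invmx (jacobian f (g y)) = 'D_v g y.
  by move=> Wy; have [d e] := dg y Wy; rewrite (deriveE v d) e.
apply: (Ck_eq oW E); apply: Ck_row => // j.
apply: (@Ck_eq _ _ _ _ _ (fun y => \sum_i v 0 i * invmx (jacobian f (g y)) i j)) => //.
  by move=> y _; rewrite mxE.
apply: Ck_sum => // i _; apply: CkM => //; first exact: Ck_cst.
apply: (Ck_invmx oW) => [a b|y [x Bx <-]]; last by rewrite gf // Ju.
apply: (@Ck_eq _ _ _ _ _ (fun y => ('D_(delta_mx 0 a) f (g y)) 0 b)) => //.
  by move=> y _; rewrite jacobianE.
apply: (Ck_comp_row oW _ IH (_ : Ck k setT (fun x => ('D_(delta_mx 0 a) f x) 0 b))) => //.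
by apply: smooth_coord; exact: smooth_derive.
Qed.

(** By [lower_lip_onto] the image contains balls of all radii. *)
Lemma global_inverse n (f : 'rV[R]_n -> 'rV[R]_n) (c : R) :
  smooth f -> 0 < c -> lower_lip setT f c ->
  exists g : 'rV[R]_n -> 'rV[R]_n, [/\ smooth g, cancel f g & cancel g f].
Proof.
move=> Cf c0 L.
have oT := @openT 'rV[R]_n.
have surj y : (f @` setT) y.
  have [t t0 ht] := small_multiple (normr_ge0 (y - f 0)) c0.
  have n2 : (0 : R) < n%:R + 2 by rewrite ltr_wpDl.
  have s0 : 0 < (n%:R + 2) / t by rewrite divr_gt0.
  apply: (lower_lip_onto (x := 0) Cf oT c0 L s0) => //.
  have -> : c * ((n%:R + 2) / t) / (n%:R + 2) = c / t by field; rewrite !gt_eqF.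
  by rewrite ltr_pdivlMr // mulrC.
have inj : injective f.
  move=> z z' e; have := L z z' I I; rewrite e subrr normr0 pmulr_rle0 //.
  by rewrite normr_le0 subr_eq0 => /eqP.
have /choice[g gK] : forall y, exists x, f x = y.
  by move=> y; have [x _ <-] := surj y; exists x.
have fK : cancel f g by move=> x; apply: inj.
exists g; split=> // k.
have := inverse_smooth Cf oT c0 L (fun x _ => fK x) k.
by apply: Ck_sub => y _.
Qed.

(** The inverse function theorem, the inverse being replaced by a map of the
    whole space with the same germ. *)
Lemma local_inverse n (f : 'rV[R]_n -> 'rV[R]_n) x (c r : R) :
  smooth f -> 0 < c -> 0 < r -> lower_lip (dball x r) f c ->
  exists (g : 'rV[R]_n -> 'rV[R]_n) (s : R), [/\ smooth g, 0 < s,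
    forall z, `|z - x| < s -> g (f z) = z &
    forall y, `|y - f x| < s -> f (g y) = y].
Proof.
move=> Cf c0 r0 L; have oB := @open_dball _ x r.
have inj z z' : dball x r z -> dball x r z' -> f z = f z' -> z = z'.
  move=> Bz Bz' e; have := L _ _ Bz Bz'; rewrite e subrr normr0 pmulr_rle0 //.
  by rewrite normr_le0 subr_eq0 => /eqP.
pose P y z := dball x r z /\ f z = y.
have /choice[g hg] : forall y, exists z, (f @` dball x r) y -> P y z.
  move=> y; have [[z Bz fz]|nW] := pselect ((f @` dball x r) y); first by exists z.
  by exists 0.
have gf z : dball x r z -> g (f z) = z.
  move=> Bz; have [Bg fg] : P (f z) (g (f z)) by apply: hg; exists z.
  exact: inj.
have Cg := inverse_smooth Cf oB c0 L gf.
have oW := lower_lip_open Cf oB c0 L.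
have Wx : (f @` dball x r) (f x) by exists x => //; exact: dball_self.
have sg : smooth_on (f @` dball x r) g.
  by move=> y Wy; exists (f @` dball x r), g; split.
have [g' [s [Cg' s0 gg']]] := smooth_on_near sg Wx.
have [d d0 hd] := open_distP oW Wx.
have sd0 : 0 < Num.min s d by rewrite lt_min s0.
have [t t0 ht] := continuous_dist (smooth_continuous Cf (x := x)) sd0.
exists g', (Num.min (Num.min t r) (Num.min s d)); split => //.
- by rewrite !lt_min t0 r0 s0.
- move=> z; rewrite !lt_min => /andP[/andP[zt zr] _].
  have := ht _ zt; rewrite lt_min => /andP[fs fd].
  by rewrite -gg' ?gf //; exists z.
- move=> y; rewrite !lt_min => /andP[_ /andP[ys yd]].
  have Wy := hd _ yd; rewrite -gg' //.
  by have [] := hg _ Wy.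
Qed.

End Inverse.


(** * Maps between submanifolds *)

Section Charts.
Variable R : realType.

Lemma near_comp n p (f : 'rV[R]_n -> 'rV[R]_p) x (P : 'rV[R]_p -> Prop) :
  smooth f -> (\forall y \near f x, P y) -> \forall z \near x, P (f z).
Proof. by move=> Cf; exact: (smooth_continuous Cf (x := x)). Qed.

(** A parametrization [c] and a coordinate map [l] near [z0].  Both are defined
    on whole spaces and only their germs matter, so that charts compose with
    arbitrary smooth maps of the ambient spaces. *)
Definition chart d m (Z : set 'rV[R]_m) z0 (c : 'rV[R]_d -> 'rV[R]_m)
    (l : 'rV[R]_m -> 'rV[R]_d) : Prop :=
  [/\ smooth c, smooth l, c (l z0) = z0,
      \forall p \near l z0, Z (c p) /\ l (c p) = p &
      \forall z \near z0, Z z -> c (l z) = z].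

(** The germ at [z0] of [f] on [A] is injective with a rate. *)
Definition stretch m n (A : set 'rV[R]_m) z0 (f : 'rV[R]_m -> 'rV[R]_n) : Prop :=
  exists (c r : R), [/\ 0 < c, 0 < r & lower_lip (A `&` dball z0 r) f c].

Lemma submanifold_chart d n (X : set 'rV[R]_n) x0 :
  submanifold d X -> X x0 ->
  exists (c : 'rV[R]_d -> 'rV[R]_n) (l : 'rV[R]_n -> 'rV[R]_d), chart X x0 c l.
Proof.
move=> subX Xx0; have [U [P [oU Ux0 oP [f [sf fP [g [sg gf]]]]]]] := subX _ Xx0.
have XU0 : (X `&` U) x0 by [].
have Pf x : (X `&` U) x -> P (f x) by move=> h; rewrite -fP; exists x.
have [l [r [Cl r0 fl]]] := smooth_on_near sf XU0.
have [c [s [Cc s0 gc]]] := smooth_on_near sg (Pf _ XU0).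
have fl0 : f x0 = l x0 by rewrite fl // subrr normr0.
have cl0 : c (l x0) = x0.
  by rewrite -fl0 -gc ?gf //; [exact: Pf|rewrite subrr normr0].
have nU : \forall z \near x0, U z by exact: open_nbhs_nbhs.
exists c, l; split => //.
- have nP : \forall p \near l x0, P p.
    by rewrite -fl0; apply: open_nbhs_nbhs; split=> //; exact: Pf.
  have nc : \forall p \near l x0, `|c p - x0| < r.
    by apply: (near_comp Cc (P := fun y => `|y - x0| < r)); rewrite cl0; exact: near_dist.
  near=> p.
  have Pp : P p by near: p.
  have gp : g p = c p.
    by apply: gc => //; rewrite fl0; near: p; exact: near_dist.
  have [x XUx fx] : (f @` (X `&` U)) p by rewrite fP.
  have cpx : c p = x by rewrite -gp -fx gf.
  have XUc : (X `&` U) (c p) by rewrite cpx.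
  split; first by case: XUc.
  rewrite -fl //; first by rewrite cpx.
  by near: p.
- have nls : \forall z \near x0, `|l z - l x0| < s.
    by apply: (near_comp Cl (P := fun y => `|y - l x0| < s)); exact: near_dist.
  near=> z => Xz; have XUz : (X `&` U) z by split=> //; near: z.
  have flz : f z = l z by apply: fl => //; near: z; exact: near_dist.
  rewrite -flz -gc ?gf //; first exact: Pf.
  by rewrite fl0 flz; near: z.
Unshelve. all: by end_near. Qed.

(** Because the left inverse is locally Lipschitz. *)
Lemma left_inverse_stretch m n (A : set 'rV[R]_m) z0 (f : 'rV[R]_m -> 'rV[R]_n)
    (k : 'rV[R]_n -> 'rV[R]_m) :
  smooth f -> smooth k -> (\forall z \near z0, A z -> k (f z) = z) ->
  stretch A z0 f.
Proof.
move=> Cf Ck /nbhs_distP[r r0 kf].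
have [K [s [K0 s0 hK]]] := smooth_lipschitz (f z0) Ck.
have [t t0 ht] := continuous_dist (smooth_continuous Cf (x := z0)) s0.
exists K^-1, (Num.min r t); split; rewrite ?invr_gt0 // ?lt_min ?r0 //.
move=> y z [Ay]; rewrite /dball /= lt_min => /andP[yr yt] [Az].
rewrite lt_min => /andP[zr zt].
rewrite ler_pdivrMl // -{1}(kf y) // -{1}(kf z) //.
by apply: hK; exact: ht.
Qed.

(** In charts this is [local_inverse]: the coordinate expression of [f] is
    injective with a rate, as a composition of such maps. *)
Lemma manifold_inverse d m n (Z : set 'rV[R]_m) z0 c l (X : set 'rV[R]_n) c' l'
    (f : 'rV[R]_m -> 'rV[R]_n) :
  @chart d m Z z0 c l -> @chart d n X (f z0) c' l' -> smooth f ->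
  (\forall z \near z0, Z z -> X (f z)) -> stretch Z z0 f ->
  exists g : 'rV[R]_n -> 'rV[R]_m, [/\ smooth g, g (f z0) = z0,
    \forall z \near z0, Z z -> g (f z) = z &
    \forall w \near f z0, X w -> Z (g w) /\ f (g w) = w].
Proof.
move=> [Cc Cl cl0 nc nl] [Cc' Cl' cl0' nc' nl'] Cf nf [a [r [a0 r0 La]]].
pose F p := l' (f (c p)).
have CF : smooth F by do 2 (apply: smooth_comp => //).
have [b [s [b0 s0 Lb]]] : stretch setT (l z0) c.
  apply: (left_inverse_stretch (k := l)) => //.
  by apply: filterS nc => p [_ e] _.
have [b' [s' [b0' s0' Lb']]] : stretch X (f z0) l'.
  by apply: (left_inverse_stretch (k := c')).
have near_l0 P : (\forall z \near z0, P z) -> \forall p \near l z0, P (c p).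
  by move=> h; apply: near_comp => //; rewrite cl0.
have near_f0 P : (\forall w \near f z0, P w) -> \forall p \near l z0, P (f (c p)).
  by move=> h; apply: (near_l0 (fun z => P (f z))); exact: near_comp.
have : \forall p \near l z0, [/\ `|p - l z0| < s, (Z `&` dball z0 r) (c p),
     X (f (c p)) & `|f (c p) - f z0| < s'].
  have h1 := near_l0 _ nf; have h2 := near_l0 _ (near_dist z0 r0).
  have h3 := near_f0 _ (near_dist (f z0) s0').
  near=> p; have [Zp _] : Z (c p) /\ l (c p) = p by near: p.
  split; first by near: p; exact: near_dist.
  - by split=> //; near: p.
  - by move: Zp; near: p.
  - by near: p.
case/nbhs_distP => t t0 ht.
have LF : lower_lip (dball (l z0) t) F (b' * a * b).
  move=> p q /ht[ps Zp Xp fps] /ht[qs Zq Xq fqs].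
  apply: le_trans (Lb' _ _ (conj Xp fps) (conj Xq fqs)).
  rewrite -!mulrA ler_pM2l //; apply: le_trans (La _ _ Zp Zq).
  by rewrite ler_pM2l //; exact: Lb.
have abb : 0 < b' * a * b by rewrite !mulr_gt0.
have [G [u [CG u0 GF FG]]] := local_inverse CF abb t0 LF.
have GF0 : G (F (l z0)) = l z0 by apply: GF; rewrite subrr normr0.
have F0 : F (l z0) = l' (f z0) by rewrite /F cl0.
exists (fun w => c (G (l' w))); split.
- by do 2 (apply: smooth_comp => //).
- by rewrite -F0 GF0.
- have h : \forall z \near z0, `|l z - l z0| < u.
    apply: (near_comp Cl (P := fun p => `|p - l z0| < u)); exact: near_dist.
  near=> z => Zz; have clz : c (l z) = z by apply: (near nl z).
  have -> : l' (f z) = F (l z) by rewrite /F clz.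
  by rewrite GF //; near: z.
- pose g w := c (G (l' w)); have Cg : smooth g by do 2 (apply: smooth_comp => //).
  have g0 : g (f z0) = z0 by rewrite /g -F0 GF0 cl0.
  have nG : \forall w \near f z0, Z (c (G (l' w))).
    apply: (near_comp (f := fun w => G (l' w)) (P := fun p => Z (c p))).
      exact: smooth_comp.
    by rewrite -F0 GF0; apply: filterS nc => p [].
  have h : \forall w \near f z0, Z (g w) -> X (f (g w)).
    by apply: (near_comp Cg (P := fun z => Z z -> X (f z))); rewrite g0.
  have h2 : \forall w \near f z0, X (f (g w)) -> c' (l' (f (g w))) = f (g w).
    apply: (near_comp (f := fun w => f (g w)) (P := fun w => X w -> c' (l' w) = w)).
      exact: smooth_comp.
    by rewrite g0.
  have h3 : \forall w \near f z0, `|l' w - F (l z0)| < u.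
    rewrite F0.
    by apply: (near_comp Cl' (P := fun y => `|y - l' (f z0)| < u)); exact: near_dist.
  near=> w => Xw; have Zg : Z (g w) by near: w.
  split=> //; rewrite -/(g w).
  have Xf : X (f (g w)) by move: Zg; near: w.
  have e : F (G (l' w)) = l' w by apply: FG; near: w.
  have e1 : c' (l' (f (g w))) = f (g w) by move: Xf; near: w.
  rewrite -e1 -/(F (G (l' w))) e.
  by move: Xw; near: w.
Unshelve. all: by end_near. Qed.

(** A map that is the identity on a set clustering its interior at [p0] has
    the identity as derivative there. *)
Lemma half_identity d (F : 'rV[R]_d -> 'rV[R]_d) (Q : set 'rV[R]_d) p0 :
  smooth F -> (forall p, Q p -> F p = p) ->
  (forall e : R, 0 < e -> exists p, `|p - p0| < e /\ \forall q \near p, Q q) ->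
  exists2 r : R, 0 < r & lower_lip (dball p0 r) F (1 / 2).
Proof.
move=> CF FQ fat.
have DF v : 'D_v F p0 = v.
  apply/eqP; rewrite -subr_eq0 -normr_le0; apply/ler_addgt0Pl => e e0; rewrite addr0.
  have [r r0 hr] := continuous_dist (smooth_continuous (smooth_derive v CF) (x := p0)) e0.
  have [p [pr nQ]] := fat r r0.
  have Dp : 'D_v F p = v.
    rewrite (near_eq_derive (g := id)) ?derive_id //.
    by apply: filterS nQ => q /FQ.
  by have := hr p pr; rewrite Dp distrC => /ltW.
apply: jacobian_lower_lip => // v; rewrite mul1r.
by rewrite -deriveEjacobian ?DF //; exact: smooth_differentiable.
Qed.

(** [z0] is in the closure of the interior of [E] relative to [Z]. *)
Definition fat m (Z E : set 'rV[R]_m) z0 : Prop :=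
  forall e : R, 0 < e ->
  exists z, [/\ `|z - z0| < e, Z z & \forall w \near z, Z w -> E w].

(** A one-sided left inverse is enough: the derivative of [k o f] at [z0] is a
    limit of derivatives at interior points of [E], where [k o f] is the
    identity.  In the coordinates of the chart [half_identity] applies, whatever
    [k] does off the image of [E]. *)
Lemma fat_stretch d m n (Z E : set 'rV[R]_m) z0 c l
    (f : 'rV[R]_m -> 'rV[R]_n) (k : 'rV[R]_n -> 'rV[R]_m) :
  @chart d m Z z0 c l -> smooth f -> smooth k -> fat Z E z0 ->
  (\forall z \near z0, E z -> k (f z) = z) -> stretch Z z0 f.
Proof.
move=> [Cc Cl cl0 nc nl] Cf Ck fatE kf.
pose F p := l (k (f (c p))).
have CF : smooth F by do 3 (apply: smooth_comp => //).
pose Q p := F p = p.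
have FQ p : Q p -> F p = p by [].
have fatQ e : 0 < e -> exists p, `|p - l z0| < e /\ \forall q \near p, Q q.
  move=> e0.
  have : \forall p \near l z0, (Z (c p) /\ l (c p) = p) /\ (E (c p) -> k (f (c p)) = c p).
    near=> p; split; first by near: p.
    near: p; apply: (near_comp Cc (P := fun z => E z -> k (f z) = z)).
    by rewrite cl0.
  case/nbhs_distP => r r0 hr.
  have re : 0 < Num.min r e by rewrite lt_min r0.
  have nz : \forall z \near z0, `|l z - l z0| < Num.min r e /\ (Z z -> c (l z) = z).
    near=> z; split; last by near: z.
    by near: z; apply: (near_comp Cl (P := fun p => `|p - l z0| < _)); exact: near_dist.
  case/nbhs_distP: nz => t t0 ht.
  have [z [zt Zz nE]] := fatE t t0.
  have [] := ht _ zt; rewrite lt_min => /andP[lr le] /(_ Zz) clz.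
  exists (l z); split=> //.
  have nr : \forall q \near l z, `|q - l z0| < r.
    apply/nbhs_distP; exists (r - `|l z - l z0|) => [|q ql]; first by rewrite subr_gt0.
    by have := ler_normD (q - l z) (l z - l z0); rewrite subrKA; lra.
  have nE' : \forall q \near l z, Z (c q) -> E (c q).
    by apply: (near_comp Cc (P := fun w => Z w -> E w)); rewrite clz.
  near=> q; have qr : `|q - l z0| < r by near: q.
  have [[Zq lq] kq] := hr q qr.
  have Eq : E (c q) by move: Zq; near: q.
  by rewrite /Q /F kq.
have [s s0 LF] := half_identity CF FQ fatQ.
have [K [t [K0 t0 hK]]] := smooth_lipschitz (f z0) (smooth_comp Ck Cl).
have [K' [t' [K0' t0' hK']]] := smooth_lipschitz (l z0) Cc.
have : \forall z \near z0, [/\ `|f z - f z0| < t, `|l z - l z0| < Num.min s t' &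
   Z z -> c (l z) = z].
  near=> z; split; near: z => //.
  - by apply: (near_comp Cf (P := fun y => `|y - f z0| < t)); exact: near_dist.
  - apply: (near_comp Cl (P := fun y => `|y - l z0| < Num.min s t')).
    by apply: near_dist; rewrite lt_min s0.
case/nbhs_distP => r r0 hr.
exists (K^-1 * (1 / 2) * K'^-1), r; split => //.
  by rewrite !mulr_gt0 // invr_gt0.
move=> y z [Zy /hr[fy ly cy]] [Zz /hr[fz lz cz]].
move: ly lz; rewrite !lt_min => /andP[ys yt] /andP[zs zt].
have h1 := hK _ _ fy fz; have h2 := hK' _ _ yt zt; have h3 := LF _ _ ys zs.
rewrite (cy Zy) (cz Zz) in h2; rewrite /F (cy Zy) (cz Zz) in h3.
have h4 : K'^-1 * `|y - z| <= `|l y - l z| by rewrite ler_pdivrMl.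
rewrite -!mulrA ler_pdivrMl //; apply: le_trans h1; apply: le_trans h3.
by move: h4; set u := K'^-1 * _; lra.
Unshelve. all: by end_near. Qed.

End Charts.


(** * Blending a collar map into the identity *)

Section Blend.
Variable R : realType.

Lemma mvt_line n (f : 'rV[R]_n -> R) x v : smooth f ->
  exists c : R, [/\ 0 <= c, c <= 1 & f (x + v) - f x = 'D_v f (x + c *: v)].
Proof.
move=> Cf.
have df (s : R^o) : is_derive s (1 : R^o) (fun s : R => f (x + s *: v)) ('D_v f (x + s *: v)).
  by apply: is_derive_line; exact: smooth_differentiable.
have [|c] := @MVT_segment _ (fun s : R => f (x + s *: v)) _ 0 1 ler01 (fun s _ => df s).
  apply: continuous_subspaceT => s.
  by apply: differentiable_continuous; apply/derivable1_diffP; case: (df s).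
rewrite in_itv /= => /andP[c0 c1] e; exists c; split=> //.
by move: e; rewrite scale1r scale0r addr0 subr0 mulr1.
Qed.

Lemma smooth_is_derive (f : R -> R) x : smooth (f : R^o -> R) ->
  is_derive (x : R^o) (1 : R^o) f ('D_1 (f : R^o -> R) x).
Proof.
move=> Cf; apply: DeriveDef => //; apply: diff_derivable.
exact: smooth_differentiable.
Qed.

(** There the step function is at its maximum or at its minimum. *)
Lemma derive_step_out (x : R) : x <= 0 \/ 1 <= x ->
  'D_(1 : R^o) (@step R : R^o -> R) x = 0.
Proof.
have ds (t : R) : derivable (@step R : R^o -> R) t 1.
  by have := smooth_is_derive t (@smooth_step R); case.
have lx : x - 1 <= x + 1 by lra.
have xin : x \in `]x - 1, x + 1[%R by rewrite in_itv /=; lra.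
case=> hx.
  have := @derive1_at_max R (@step R) _ _ x lx (fun t _ => ds t) xin.
  by case=> [t _|_ ->//]; rewrite (step1 hx) step_le1.
have := @derive1_at_min R (@step R) _ _ x lx (fun t _ => ds t) xin.
by case=> [t _|_ ->//]; rewrite (step0 hx) step_ge0.
Qed.

Lemma derive_step_bound :
  exists2 S : R, 0 < S & forall x, `|'D_(1 : R^o) (@step R : R^o -> R) x| <= S.
Proof.
pose D (x : R) := 'D_(1 : R^o) (@step R : R^o -> R) x.
pose f x := D x ^+ 2.
have cf : continuous (f : R^o -> R).
  apply: smooth_continuous; apply: (@smoothX _ _ (D : R^o -> R)).
  exact: smooth_derive (@smooth_step R).
have [c _ hc] := @EVT_max R f 0 1 ler01 (continuous_subspaceT cf).
have hf x : f x <= f c.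
  have [x0|x0] := leP x 0.
    by rewrite {1}/f /D (derive_step_out (or_introl x0)) expr0n sqr_ge0.
  have [x1|x1] := leP 1 x.
    by rewrite {1}/f /D (derive_step_out (or_intror x1)) expr0n sqr_ge0.
  by apply: hc; rewrite in_itv /= !ltW.
exists (f c + 1) => [|x]; first by rewrite ltr_wpDl // sqr_ge0.
have := hf x; rewrite {1}/f -/(D x) -real_normK ?num_real //.
have := normr_ge0 (D x); have := sqr_ge0 (`|D x| - 1); nra.
Qed.

(** A step function of [k ln (t^2 / e^2)]: then [t chi'(t)] is [2 k] times a
    bounded function, and [k] can be taken small.  Near the origin [t^2] is
    replaced by [p t] to keep the logarithm smooth; there the step function is
    already constant, because [p t <= c] whenever [t^2 <= c]. *)
Lemma slow_cutoff (eta e : R) : 0 < eta -> 0 < e ->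
  exists (chi : R -> R) (d : R),
    [/\ smooth (chi : R^o -> R), 0 < d /\ forall t, `|t| < d -> chi t = 1,
        forall t, e <= `|t| -> chi t = 0, forall t, 0 <= chi t <= 1 &
        forall t, `|t * 'D_(1 : R^o) (chi : R^o -> R) t| <= eta].
Proof.
move=> eta0 e0; have [S S0 hS] := derive_step_bound.
pose k := eta / (2 * S); have k0 : 0 < k by rewrite divr_gt0 // mulr_gt0.
pose c := e ^+ 2 * expR (- k^-1).
have c0 : 0 < c by rewrite mulr_gt0 ?expR_gt0 // exprn_gt0.
pose p (t : R) := t ^+ 2 + flat 0 (c - t ^+ 2).
have p0 t : 0 < p t.
  rewrite /p; have [h|h] := ltP (t ^+ 2) c.
    by rewrite ltr_wpDl ?sqr_ge0 // flat_gt0 // subr_gt0.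
  by rewrite flat0 ?subr_le0 // addr0 (lt_le_trans c0).
have Cid : smooth (id : R^o -> R) by move=> n; exact: Ck_id.
have Cp : smooth (p : R^o -> R).
  apply: smoothD; first exact: smoothX.
  apply: smooth_comp_scal; last exact: Cinf_flat.
  by apply: smoothB; [exact: smooth_cst|exact: smoothX].
have pc t : t ^+ 2 <= c -> p t <= c.
  move=> h; rewrite /p; have := @flat_le_id R (c - t ^+ 2).
  by rewrite subr_ge0 => /(_ h); lra.
pose arg t := 1 + k * ln (p t / e ^+ 2).
have e20 : 0 < e ^+ 2 by rewrite exprn_gt0.
have Carg : smooth (arg : R^o -> R).
  apply: smoothD; first exact: smooth_cst.
  apply: smoothM; first exact: smooth_cst.
  apply: smooth_ln => [t|]; first by rewrite divr_gt0.
  by apply: smoothM => //; exact: smooth_cst.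
have arg0 t : t ^+ 2 <= c -> arg t <= 0.
  move=> /pc h; rewrite /arg.
  have : ln (p t / e ^+ 2) <= - k^-1.
    rewrite -[leRHS]expRK ler_ln ?posrE ?divr_gt0 ?expR_gt0 //.
    by rewrite ler_pdivrMr // mulrC.
  rewrite -(ler_pM2l k0) mulrN divff ?gt_eqF //; lra.
exists (fun t => step (arg t)), (Num.sqrt c); split.
- by apply: (smooth_comp_scal _ (@smooth_step R)).
- split=> [|t tc]; first by rewrite sqrtr_gt0.
  rewrite step1 // arg0 // -[leRHS](sqr_sqrtr (ltW c0)) -real_normK ?num_real //.
  by rewrite lerXn2r ?nnegrE ?sqrtr_ge0 // ltW.
- move=> t te; apply: step0; rewrite /arg lerDl mulr_ge0 ?(ltW k0) // ln_ge0 //.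
  rewrite ler_pdivlMr // mul1r.
  have h : e ^+ 2 <= t ^+ 2.
    by rewrite -[t ^+ 2]real_normK ?num_real // lerXn2r ?nnegrE // ltW.
  by rewrite /p; have := @flat_ge0 R (c - t ^+ 2); lra.
- by move=> t; rewrite step_ge0 step_le1.
- move=> t; have ds := smooth_is_derive (arg t) (@smooth_step R).
  have da := smooth_is_derive t Carg.
  have [_ ->] := is_derive1_comp ds da.
  have [tc|tc] := leP (t ^+ 2) c.
    by rewrite (derive_step_out (or_introl (arg0 t tc))) mul0r mulr0 normr0 ltW.
  have t0 : t != 0 by apply: contraTneq tc => ->; rewrite expr0n /= -leNgt ltW.
  have -> : 'D_(1 : R^o) (arg : R^o -> R) t = k * (2 / t).
    have tc' : \forall y \near t, arg y = 1 + k * ln (y ^+ 2 / e ^+ 2).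
      have : \forall y \near t, c < y ^+ 2.
        have Ct : smooth (fun y : R^o => y ^+ 2 : R) by exact: smoothX.
        exact: (smooth_continuous Ct (x := t) (lt_nbhsr tc)).
      by apply: filterS => y yc; rewrite /arg /p flat0 ?addr0 // subr_le0 ltW.
    rewrite (near_eq_derive _ tc').
    have d1 := is_deriveM (is_deriveX 2 (is_derive_id t (1 : R^o))) (is_derive_cst (e ^- 2 : R^o) t 1).
    have q0 : 0 < ((id ^+ 2) * cst (e ^- 2)) t.
      by rewrite -[ltRHS]/(_ * _) exprfctE divr_gt0 // exprn_even_gt0.
    have d2 := is_derive1_comp (is_derive1_ln q0) d1.
    have d3 := is_deriveD (is_derive_cst (1 : R^o) t 1) (is_deriveM (is_derive_cst (k : R^o) t 1) d2).
    have -> : (fun y => 1 + k * ln (y ^+ 2 / e ^+ 2)) =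
       cst 1 + cst k * (@ln R \o ((id ^+ 2) * cst (e ^- 2))).
      by apply/funext => y; rewrite -[RHS]/(_ + _ * ln (_ * _)) exprfctE.
    have [_ ->] := d3; rewrite /GRing.scale /= -[((id ^+ 2) * cst (e ^- 2)) t]/(_ * _) exprfctE /=.
    by field; rewrite t0 gt_eqF.
  have := hS (arg t); set D : R := derive _ _ _ => hD.
  have -> : t * (D * (k * (2 / t))) = D * (2 * k) by field.
  rewrite normrM.
  have k2 : 0 < 2 * k by rewrite pmulr_rgt0.
  rewrite (gtr0_norm k2).
  have -> : eta = S * (2 * k) by rewrite /k; field; rewrite gt_eqF.
  by rewrite ler_wpM2r // ltW.
Qed.

(** [a] is the displacement of a map fixing the hyperplane [Theta_k = 0]
    pointwise and moving its normals to the right side.  Cutting [a] off slowly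
    enough yields a diffeomorphism preserving the sides of the hyperplane.
    Write [xi] for the displacement after the cutoff.  Along the hyperplanes
    parallel to the given one [xi] has a small Lipschitz constant [h], since the
    derivatives of [a] are there of the order of the distance to the hyperplane.
    In the normal direction [xi] is only Lipschitz, with some constant [C1], but
    the normal component of [G] has slope at least [c1]: it interpolates between
    the slopes [1] and [1 + D_k a_k], up to an error [chi' a_k] made small by
    the slow cutoff.  These estimates add up to a lower Lipschitz bound of
    [G]. *)
Lemma blend n (k : 'I_n) (a : 'rV[R]_n -> 'rV[R]_n) (C c d e : R) :
  smooth a -> 0 < C -> 0 < c -> 0 < d -> 0 < e ->
  (forall x : 'rV[R]_n, `|x 0 k| <= 1 -> `|a x| <= C * `|x 0 k|) ->
  (forall i (x : 'rV[R]_n), i != k -> `|x 0 k| <= 1 ->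
     `|'D_(delta_mx 0 i) a x| <= C * `|x 0 k|) ->
  (forall x : 'rV[R]_n, `|x 0 k| <= 1 -> `|'D_(delta_mx 0 k) a x| <= C) ->
  (forall x : 'rV[R]_n, `|x 0 k| <= d -> c <= 1 + 'D_(delta_mx 0 k) a x 0 k) ->
  exists (chi : R -> R) (s c' : R),
    let G (x : 'rV[R]_n) := x + chi (x 0 k) *: a x in
    [/\ smooth (chi : R^o -> R), 0 < s /\ forall t, `|t| < s -> chi t = 1,
        forall t, e <= `|t| -> chi t = 0, 0 < c' /\ lower_lip setT G c' &
        forall x, (0 <= G x 0 k) = (0 <= x 0 k)].
Proof.
move=> Ca C0 c0 d0 e0 H1 H2 H3 H4.
pose c1 := Num.min 1 c / 2.
have c1_0 : 0 < c1 by rewrite divr_gt0 // lt_min ltr01.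
have c1c : 2 * c1 <= c by rewrite /c1 mulrC divfK // ge_min lexx orbT.
have c11 : 2 * c1 <= 1 by rewrite /c1 mulrC divfK // ge_min lexx.
clearbody c1; pose C1 := c1 + C.
have C1_0 : 0 < C1 by rewrite addr_gt0.
(* [h] is so small that a tangential error [h |x|] and the normal error it
   causes are absorbed in the final estimate. *)
pose h := Num.min (1 / 4) (c1 / C1 / 4).
have h0 : 0 < h by rewrite lt_min !divr_gt0.
have n1 : (0 : R) < n%:R + 1 by rewrite ltr_wpDl.
pose e1 := Num.min (Num.min e 1) (Num.min d (h / (C * (n%:R + 1)))).
have e1_0 : 0 < e1 by rewrite !lt_min e0 ltr01 d0 divr_gt0 // mulr_gt0.
have [e1e e11 e1d e1h] : [/\ e1 <= e, e1 <= 1, e1 <= d & e1 <= h / (C * (n%:R + 1))].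
  by rewrite /e1 !ge_min !lexx /= ?orbT.
have eta0 : 0 < c1 / C by rewrite divr_gt0.
have [chi [s [Cchi [s0 chi1] chi0 chi01 chiD]]] := slow_cutoff eta0 e1_0.
pose ek : 'rV[R]_n := delta_mx 0 k.
pose xi (x : 'rV[R]_n) := chi (x 0 k) *: a x.
have Cchik : smooth (fun x : 'rV[R]_n => chi (x 0 k)).
  by apply: smooth_comp_scal => //; apply: smooth_coord; exact: smooth_id.
have Cxi : smooth xi by exact: smooth_scale.
have Cj (f : 'rV[R]_n -> 'rV[R]_n) j : smooth f -> smooth (fun x => f x 0 j) by exact: smooth_coord.
have Dchik x : 'D_ek (fun x : 'rV[R]_n => chi (x 0 k)) x = 'D_(1 : R^o) (chi : R^o -> R) (x 0 k).
  have E : (fun t : R => t^-1 *: (chi ((t *: ek + x) 0 k) - chi (x 0 k))) =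
           (fun t : R => t^-1 *: (chi (t *: (1 : R^o) + x 0 k) - chi (x 0 k))).
    by apply/funext => t; rewrite !mxE !eqxx mulr1 [t *: (1 : R^o)]mulr1.
  by rewrite /derive /= E.
have Dxi j x : 'D_ek (fun x => xi x 0 j) x =
    'D_(1 : R^o) (chi : R^o -> R) (x 0 k) * a x 0 j + chi (x 0 k) * 'D_ek a x 0 j.
  rewrite (_ : (fun x => xi x 0 j) = (fun x : 'rV[R]_n => chi (x 0 k)) * (fun x => a x 0 j)); last first.
    by apply/funext => y; rewrite mxE.
  rewrite deriveM; try by apply: diff_derivable; apply: smooth_differentiable => //; exact: Cj.
  rewrite Dchik derive_coord; last exact: smooth_differentiable.
  by rewrite addrC mulrC.
have out (x : 'rV[R]_n) : e1 <= `|x 0 k| -> xi x = 0 by move=> /chi0 hx; rewrite /xi hx scale0r.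
have Dchi0 (t : R) : e1 <= `|t| -> 'D_(1 : R^o) (chi : R^o -> R) t = 0.
  move=> ht; have lt : t - 1 <= t + 1 by lra.
  have tin : t \in `]t - 1, t + 1[%R by rewrite in_itv /=; lra.
  have [] // := @derive1_at_min R chi _ _ t lt _ tin.
    by move=> u _; have := smooth_is_derive u Cchi; case.
  by move=> u _; rewrite (chi0 _ ht); have /andP[] := chi01 u.
have line x j v : exists z, xi (x + v *: ek) 0 j - xi x 0 j = ('D_ek (fun x => xi x 0 j) z) * v.
  have [t [_ _ ->]] := mvt_line x (v *: ek) (Cj _ j Cxi).
  exists (x + t *: (v *: ek)).
  have df z : differentiable (fun x => xi x 0 j) z by apply: smooth_differentiable; exact: Cj.
  by rewrite !(deriveE _ (df _)) linearZ mulrC.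
(* Arbitrary components of [xi] in the normal direction. *)
have V1 x j v : exists b : R, `|b| <= C1 /\ xi (x + v *: ek) 0 j - xi x 0 j = b * v.
  have [z ->] := line x j v; exists ('D_ek (fun x => xi x 0 j) z); split => //.
  rewrite Dxi; have [hz|hz] := leP `|z 0 k| e1; last first.
    by rewrite (Dchi0 _ (ltW hz)) (chi0 _ (ltW hz)) !mul0r addr0 normr0 (ltW C1_0).
  have hz1 := le_trans hz e11.
  apply: le_trans (ler_normD _ _) _; rewrite /C1 !normrM; apply: lerD.
    have ha := le_trans (coord_le_norm (a z) j) (H1 z hz1).
    have := chiD (z 0 k); rewrite normrM => hc.
    have -> : c1 = c1 / C * C by rewrite divfK // gt_eqF.
    apply: le_trans (_ : _ <= `|'D_(1 : R^o) (chi : R^o -> R) (z 0 k)| * (C * `|z 0 k|)) _.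
      by rewrite ler_wpM2l.
    by rewrite [leLHS]mulrCA mulrC [X in X * C]mulrC ler_wpM2r // ltW.
  have ha := le_trans (coord_le_norm ('D_ek a z) j) (H3 z hz1).
  have /andP[x0 x1] := chi01 (z 0 k).
  rewrite (ger0_norm x0) -[leRHS]mul1r; apply: ler_pM => //.
(* The normal component of [G] in the normal direction. *)
have V2 x v : exists b : R, c1 <= b /\
   v + (xi (x + v *: ek) 0 k - xi x 0 k) = b * v.
  have [z ->] := line x k v; exists (1 + 'D_ek (fun x => xi x 0 k) z).
  split; last by rewrite mulrDl mul1r.
  rewrite Dxi; have [hz|hz] := leP `|z 0 k| e1; last first.
    by rewrite (Dchi0 _ (ltW hz)) (chi0 _ (ltW hz)) !mul0r !addr0; lra.
  have hz1 := le_trans hz e11.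
  have ha := le_trans (coord_le_norm (a z) k) (H1 z hz1).
  have := chiD (z 0 k); rewrite normrM => hc.
  have /andP[x0 x1] := chi01 (z 0 k).
  have hd := H4 z (le_trans hz e1d).
  have : `|'D_(1 : R^o) (chi : R^o -> R) (z 0 k) * a z 0 k| <= c1.
    have -> : c1 = c1 / C * C by rewrite divfK // gt_eqF.
    apply: le_trans (_ : _ <= `|'D_(1 : R^o) (chi : R^o -> R) (z 0 k)| * (C * `|z 0 k|)) _.
      by rewrite normrM ler_wpM2l.
    by rewrite [leLHS]mulrCA mulrC [X in X * C]mulrC ler_wpM2r // ltW.
  rewrite ler_norml => /andP[hl _]; move: hl hd.
  set A := _ * a z 0 k; set B : R := fun_of_matrix _ _ _; set X := chi _ in x0 x1 *.
  by move=> hl hd; have := mulr_ge0 x0 (_ : 0 <= 1 + B - c); rewrite subr_ge0 => /(_ hd) h2; clear -h2 hl x0 x1 c1c c11 c0; nra.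
(* On a hyperplane parallel to [x_k = 0]. *)
have Hor (x y : 'rV[R]_n) : x 0 k = y 0 k -> `|xi x - xi y| <= h * `|x - y|.
  move=> exy; have [hx|hx] := leP e1 `|x 0 k|.
    by rewrite !out // -?exy // subrr normr0 mulr_ge0 // ltW.
  have hx1 : `|x 0 k| <= 1 by apply: le_trans (ltW hx) e11.
  rewrite /xi -exy -scalerBr normrZ.
  have /andP[x0 x1] := chi01 (x 0 k); rewrite (ger0_norm x0).
  apply: (@le_trans _ _ `|a x - a y|); first by rewrite ler_piMl.
  apply: norm_le => [|j]; first by rewrite mulr_ge0 // ltW.
  have [t [t0 t1]] := mvt_line y (x - y) (Cj _ j Ca).
  have yx : y + (x - y) = x by rewrite addrC subrK.
  rewrite yx => E; rewrite !mxE E; set z := y + _.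
  have zk : z 0 k = x 0 k by rewrite /z !mxE exy subrr mulr0 addr0.
  rewrite derive_coord; last exact: smooth_differentiable.
  rewrite derive_basis; last exact: smooth_differentiable.
  rewrite summxE; apply: le_trans (ler_norm_sum _ _ _) _.
  apply: (@le_trans _ _ (\sum_(i < n) `|x - y| * (C * e1))).
    apply: ler_sum => i _; rewrite mxE normrM.
    have [->|ik] := eqVneq i k.
      by rewrite !mxE exy subrr normr0 mul0r mulr_ge0 // mulr_ge0 // ltW.
    apply: ler_pM => //; first exact: coord_le_norm.
    apply: le_trans (coord_le_norm _ _) _; apply: le_trans (H2 i z ik _) _; rewrite zk //.
    by rewrite ler_wpM2l // ltW.
  rewrite sumr_const card_ord -mulr_natl mulrCA mulrC.
  apply: ler_wpM2r => //.
  move: e1h; rewrite ler_pdivlMr ?mulr_gt0 // => e1h.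
  apply: le_trans e1h; rewrite [leRHS](_ : _ = (n%:R * (C * e1)) + e1 * C); last by ring.
  by rewrite lerDl mulr_ge0 // ltW.
pose M := 2 * (1 + C1 / c1).
have CC0 : 0 < C1 / c1 by rewrite divr_gt0.
have M0 : 0 < M by rewrite mulr_gt0 // addr_gt0.
pose L := M + (1 + M) / c1.
have L0 : 0 < L by rewrite addr_gt0 // divr_gt0 // addr_gt0.
have h14 : h <= 1 / 4 by rewrite ge_min lexx.
have hC : C1 / c1 * h <= 1 / 4.
  apply: (@le_trans _ _ (C1 / c1 * (c1 / C1 / 4))).
    by rewrite ler_wpM2l ?(ltW CC0) // ge_min lexx orbT.
  by rewrite le_eqVlt; apply/orP; left; apply/eqP; field; rewrite !gt_eqF.
exists chi, s, L^-1 => G; split => //.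
- by move=> t te; apply: chi0; exact: le_trans te.
- split; first by rewrite invr_gt0.
  move=> x y _ _; set g := `|G x - G y|.
  (* From [y] to [x] go first in the normal direction, to [z]. *)
  pose v := x 0 k - y 0 k; pose z := y + v *: ek.
  have zk : z 0 k = x 0 k by rewrite /z /v !mxE !eqxx mulr1 addrC subrK.
  have zj j : j != k -> z 0 j = y 0 j.
    by move=> jk; rewrite /z !mxE (negPf jk) andbF mulr0 addr0.
  have zE : z = y + v *: ek by [].
  clearbody z; have hxz := Hor x z (esym zk).
  have Ge j : (G x - G y) 0 j = (x 0 j - y 0 j) + (xi x - xi z) 0 j + (xi z 0 j - xi y 0 j).
    by rewrite /G /xi !mxE; ring.
  set w := `|x - z| in hxz; have w0 : 0 <= w by exact: normr_ge0.
  have hv : c1 * `|v| <= g + h * w.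
    have [b [cb eb]] := V2 y v.
    have Gk : (G x - G y) 0 k = (xi x - xi z) 0 k + b * v.
      by rewrite Ge -eb -zE /v; ring.
    have b0 : 0 < b by exact: lt_le_trans cb.
    have h1 := coord_le_norm (G x - G y) k; rewrite Gk -/g in h1.
    have h2 := le_trans (coord_le_norm (xi x - xi z) k) hxz.
    have h3 := ler_normB ((xi x - xi z) 0 k + b * v) ((xi x - xi z) 0 k).
    rewrite addrAC subrr add0r normrM (gtr0_norm b0) in h3.
    have h4 : c1 * `|v| <= b * `|v| by rewrite ler_wpM2r.
    lra.
  have gg : 0 <= g by exact: normr_ge0.
  have rhs0 : 0 <= g + h * w + C1 * `|v|.
    have a1 := mulr_ge0 (ltW h0) w0; have a2 := mulr_ge0 (ltW C1_0) (normr_ge0 v).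
    by rewrite !addr_ge0.
  have hw : w <= g + h * w + C1 * `|v|.
    apply: norm_le => // j.
    have [->|jk] := eqVneq j k.
      by rewrite !mxE zk subrr normr0.
    have [b [cb eb]] := V1 y j v.
    have h1 := coord_le_norm (G x - G y) j; rewrite -zE in eb; rewrite Ge eb -/g in h1.
    have h2 := le_trans (coord_le_norm (xi x - xi z) j) hxz.
    have -> : (x - z) 0 j = x 0 j - y 0 j by rewrite !mxE zj.
    have h3 : `|b * v| <= C1 * `|v| by rewrite normrM ler_wpM2r.
    move: h1 h2 h3; set A := x 0 j - _; set B := fun_of_matrix _ _ _; set D := b * v.
    rewrite !ler_norml => /andP[? ?] /andP[? ?] /andP[? ?]; lra.
  have hCv : C1 * `|v| <= C1 / c1 * g + w / 4.
    apply: (@le_trans _ _ (C1 / c1 * (g + h * w))).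
      by rewrite -mulrA ler_pM2l // ler_pdivlMl.
    rewrite mulrDr lerD2l mulrA mulrC; have := ler_wpM2l w0 hC; lra.
  have hw4 : h * w <= w / 4 by have := ler_wpM2r w0 h14; lra.
  have hwM : w <= M * g.
    rewrite /M; lra.
  rewrite ler_pdivrMl //.
  have Mc : 0 <= (1 + M) / c1 by rewrite divr_ge0 // ltW // addr_gt0.
  apply: norm_le => [|j]; first by rewrite mulr_ge0 // ltW.
  have [->|jk] := eqVneq j k.
    rewrite !mxE -/v.
    have : `|v| <= (1 + M) / c1 * g.
      rewrite mulrAC ler_pdivlMr // mulrC; apply: le_trans hv _; lra.
    by rewrite /L mulrDl; have := mulr_ge0 (ltW M0) gg; lra.
  have -> : (x - y) 0 j = (x - z) 0 j by rewrite !mxE zj.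
  apply: le_trans (coord_le_norm _ _) _; apply: le_trans hwM _.
  by rewrite /L mulrDl lerDl mulr_ge0.
- move=> x; pose y := x - x 0 k *: ek.
  have yk : y 0 k = 0 by rewrite /y !mxE !eqxx mulr1 subrr.
  have ay : xi y = 0.
    have := H1 y; rewrite yk normr0 mulr0 => /(_ ler01).
    by rewrite normr_le0 /xi => /eqP ->; rewrite scaler0.
  have yE : y + x 0 k *: ek = x by rewrite /y subrK.
  clearbody y; have [b [cb]] := V2 y (x 0 k).
  rewrite yE ay [X in _ - X]mxE subr0.
  have -> : x 0 k + xi x 0 k = G x 0 k by rewrite /G !mxE.
  by move=> ->; rewrite pmulr_rge0 //; exact: lt_le_trans cb.
Qed.

End Blend.


(** * Logarithmic coordinates on the torus times the plane *)

Section Torus.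
Variable R : realType.
Implicit Types (x y z : 'rV[R]_(2 + 2 + 2)) (u v w : 'rV[R]_2) (X Y : 'rV[R]_4).

Lemma ord2P (i : 'I_2) : i = 0 \/ i = 1.
Proof. by case: i => [[|[|//]]] h; [left|right]; apply: val_inj. Qed.

Lemma row2P u v : u 0 0 = v 0 0 -> u 0 1 = v 0 1 -> u = v.
Proof. by move=> h0 h1; apply/rowP => i; case: (ord2P i) => ->. Qed.

Lemma row2E0 (a b : R) : row2 a b 0 0 = a.
Proof. by rewrite mxE. Qed.

Lemma row2E1 (a b : R) : row2 a b 0 1 = b.
Proof. by rewrite mxE. Qed.

Definition row2E := (row2E0, row2E1).

Lemma normsq2 u : normsq u = u 0 0 ^+ 2 + u 0 1 ^+ 2.
Proof. by rewrite /normsq big_ord_recl big_ord1; congr (_ + u 0 _ ^+ 2); apply: val_inj. Qed.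

Lemma cmulC u v : cmul u v = cmul v u.
Proof. by apply: row2P; rewrite /cmul !row2E; ring. Qed.

Lemma cmulA u v w : cmul u (cmul v w) = cmul (cmul u v) w.
Proof. by apply: row2P; rewrite /cmul !row2E; ring. Qed.

Lemma cmul1 u : cmul (row2 1 0) u = u.
Proof. by apply: row2P; rewrite /cmul !row2E; ring. Qed.

Lemma normsq_cmul u v : normsq (cmul u v) = normsq u * normsq v.
Proof. by rewrite !normsq2 /cmul !row2E; ring. Qed.

Lemma cmulZ (a b : R) u v : cmul (a *: u) (b *: v) = (a * b) *: cmul u v.
Proof. by apply: row2P; rewrite /cmul [RHS]mxE !row2E !mxE; ring. Qed.

Lemma circ0 : circ 0 = row2 1 0 :> 'rV[R]_2.
Proof. by rewrite /circ mulr0 cos0 sin0. Qed.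

Lemma circD (s t : R) : circ (s + t) = cmul (circ s) (circ t).
Proof.
apply: row2P; rewrite /cmul /circ !row2E mulrDr; first exact: cosD.
by rewrite sinD; ring.
Qed.

Lemma normsq_circ (t : R) : normsq (circ t) = 1.
Proof. by rewrite normsq2 /circ !row2E cos2Dsin2. Qed.

Lemma smooth_row2 (V : normedModType R) (f g : V -> R) :
  smooth f -> smooth g -> smooth (fun p => row2 (f p) (g p)).
Proof.
move=> Cf Cg; apply: smooth_row => j; case: (ord2P j) => ->.
  by rewrite (_ : (fun _ => _) = f) //; apply/funext => x; rewrite row2E.
by rewrite (_ : (fun _ => _) = g) //; apply/funext => x; rewrite row2E.
Qed.

Lemma smooth_cmul (V : normedModType R) (f g : V -> 'rV[R]_2) :
  smooth f -> smooth g -> smooth (fun p => cmul (f p) (g p)).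
Proof.
move=> Cf Cg; apply: smooth_row2; [apply: smoothB|apply: smoothD];
  by apply: smoothM; exact: smooth_coord.
Qed.

Lemma smooth_circ (V : normedModType R) (f : V -> R) :
  smooth f -> smooth (fun p => circ (f p)).
Proof.
move=> Cf; apply: smooth_row2; apply: smooth_comp_scal.
- by apply: smoothM => //; exact: smooth_cst.
- by move=> k; have [] := @Cinf_cos_sin R k.
- by apply: smoothM => //; exact: smooth_cst.
- by move=> k; have [] := @Cinf_cos_sin R k.
Qed.

Lemma circ_onto u : normsq u = 1 -> exists2 t : R, `|t| <= 1 & circ t = u.
Proof.
rewrite normsq2 => h; have pi0 := @pi_gt0 R.
have u0 : -1 <= u 0 0 <= 1.
  by have := sqr_ge0 (u 0 1); nra.
pose s := acos (u 0 0) / (2 * pi).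
have s1 : 0 <= s <= 1.
  rewrite /s divr_ge0 ?acos_ge0 ?mulr_ge0 ?(ltW pi0) //=.
  rewrite ler_pdivrMr ?mulr_gt0 // mul1r.
  by have := acos_lepi u0; lra.
have cs : 2 * pi * s = acos (u 0 0) by rewrite /s mulrC divfK // gt_eqF // mulr_gt0.
have sn : sin (acos (u 0 0)) = `|u 0 1|.
  by rewrite sin_acos // -sqrtr_sqr; congr Num.sqrt; lra.
have [u1|u1] := leP 0 (u 0 1).
  exists s; first by rewrite ler_norml; lra.
  apply: row2P; rewrite /circ cs !row2E ?sn ?ger0_norm // acosK //.
exists (- s); first by rewrite ler_norml; lra.
apply: row2P; rewrite /circ mulrN cs !row2E ?cosN ?sinN ?sn ?ltr0_norm ?opprK // acosK //.
Qed.

(** An angle function, exact on the half plane of vectors [u] with [u_0 >= 1/2]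
    and smooth everywhere. *)
Definition ang u : R :=
  atan (u 0 1 * u 0 0 / (u 0 0 ^+ 2 + flat 0 (1 / 2 - u 0 0))) / (2 * pi).

Lemma smooth_ang : smooth ang.
Proof.
have C0 (i : 'I_2) : smooth (fun u => u 0 i) by apply: smooth_coord; exact: smooth_id.
apply: smoothM; last exact: smooth_cst.
apply: smooth_comp_scal; last exact: Cinf_atan.
apply: smoothM; first exact: smoothM.
apply: smooth_inv => [u|].
  have [->|u0] := eqVneq (u 0 0) 0.
    by rewrite expr0n add0r subr0 gt_eqF // flat_gt0 // divr_gt0.
  by rewrite gt_eqF // ltr_pwDl ?flat_ge0 // exprn_even_gt0.
apply: smoothD; first exact: smoothX.
apply: smooth_comp_scal; last exact: Cinf_flat.
by apply: smoothB => //; exact: smooth_cst.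
Qed.

Lemma angE u : 1 / 2 <= u 0 0 -> ang u = atan (u 0 1 / u 0 0) / (2 * pi).
Proof.
move=> h; rewrite /ang flat0 ?addr0; last by rewrite subr_le0.
by congr (atan _ / _); field; rewrite gt_eqF //; lra.
Qed.

(** The angle is computed with [atan], valid since the first coordinate is
    positive. *)
Lemma circ_ang u : 1 / 2 <= u 0 0 -> Num.sqrt (normsq u) *: circ (ang u) = u.
Proof.
move=> h; have pi0 := @pi_gt0 R; have u0 : 0 < u 0 0 by lra.
rewrite angE // /circ mulrC divfK; last by rewrite gt_eqF // mulr_gt0.
set q := u 0 1 / u 0 0.
have q0 : 0 < 1 + q ^+ 2 by rewrite ltr_pwDl // sqr_ge0.
have nE : Num.sqrt (normsq u) = u 0 0 * Num.sqrt (1 + q ^+ 2).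
  rewrite -{1}(ger0_norm (ltW u0)) -sqrtr_sqr -sqrtrM ?sqr_ge0 //; congr Num.sqrt.
  by rewrite normsq2 /q; field; rewrite gt_eqF.
have s0 : Num.sqrt (1 + q ^+ 2) != 0 by rewrite gt_eqF // sqrtr_gt0.
have cosE : cos (atan q) = (Num.sqrt (1 + q ^+ 2))^-1 by rewrite cos_atan.
have sinE : sin (atan q) = q * cos (atan q).
  have c0 : cos (atan q) != 0 by rewrite cosE invr_eq0.
  exact: (canRL (mulfVK c0) (atanK q)).
apply: row2P; rewrite mxE row2E nE ?sinE cosE.
  by rewrite mulfK.
by rewrite /q; field; rewrite s0 gt_eqF.
Qed.

Lemma ang_circ (t : R) : `|t| < 1 / 4 -> 1 / 2 <= cos (2 * pi * t) -> ang (circ t) = t.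
Proof.
move=> ht h; have pi0 := @pi_gt0 R.
rewrite angE /circ !row2E // -/(tan (2 * pi * t)) tanK.
  by rewrite mulrC mulKf // gt_eqF // mulr_gt0.
move: ht; rewrite ltr_norml in_itv /= => /andP[h1 h2]; apply/andP; split; nra.
Qed.

Definition U1 z := lsubmx (lsubmx z).
Definition U2 z := rsubmx (lsubmx z).
Definition W z : 'rV[R]_2 := rsubmx z.
Definition tri u v w : 'rV[R]_(2 + 2 + 2) := row_mx (row_mx u v) w.

Lemma U1E u v w : U1 (tri u v w) = u. Proof. by rewrite /U1 /tri !row_mxKl. Qed.
Lemma U2E u v w : U2 (tri u v w) = v. Proof. by rewrite /U2 /tri row_mxKl row_mxKr. Qed.
Lemma WE u v w : W (tri u v w) = w. Proof. by rewrite /W /tri row_mxKr. Qed.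
Definition triE := (U1E, U2E, WE).

Lemma triK z : tri (U1 z) (U2 z) (W z) = z.
Proof. by rewrite /tri /U1 /U2 /W !hsubmxK. Qed.

Lemma smooth_tri (V : normedModType R) (f g h : V -> 'rV[R]_2) :
  smooth f -> smooth g -> smooth h -> smooth (fun p => tri (f p) (g p) (h p)).
Proof. by move=> Cf Cg Ch; do 2 (apply: smooth_row_mx => //). Qed.

Lemma smooth_U1 : smooth U1. Proof. by do 2 apply: smooth_lsubmx; exact: smooth_id. Qed.
Lemma smooth_U2 : smooth U2. Proof. by apply: smooth_rsubmx; apply: smooth_lsubmx; exact: smooth_id. Qed.
Lemma smooth_W : smooth W. Proof. by apply: smooth_rsubmx; exact: smooth_id. Qed.

(** The torus times the plane as a subset of [C^3] with its multiplication. *)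
Definition tmul x y :=
  tri (cmul (U1 x) (U1 y)) (cmul (U2 x) (U2 y)) (cmul (W x) (W y)).

Lemma tmulC x y : tmul x y = tmul y x.
Proof. by rewrite /tmul (cmulC (U1 x)) (cmulC (U2 x)) (cmulC (W x)). Qed.

Lemma tmulA x y z : tmul x (tmul y z) = tmul (tmul x y) z.
Proof. by rewrite /tmul !triE !cmulA. Qed.

Lemma smooth_tmul (V : normedModType R) (f g : V -> 'rV[R]_(2 + 2 + 2)) :
  smooth f -> smooth g -> smooth (fun p => tmul (f p) (g p)).
Proof.
move=> Cf Cg; apply: smooth_tri; apply: smooth_cmul.
- exact: (smooth_comp Cf smooth_U1).
- exact: (smooth_comp Cg smooth_U1).
- exact: (smooth_comp Cf smooth_U2).
- exact: (smooth_comp Cg smooth_U2).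
- exact: (smooth_comp Cf smooth_W).
- exact: (smooth_comp Cg smooth_W).
Qed.

(** The torus times the plane, and the squared radius in the plane. *)
Definition T2R2 : set 'rV[R]_(2 + 2 + 2) := [set z | normsq (U1 z) = 1 /\ normsq (U2 z) = 1].
Definition rad2 z : R := normsq (W z).

Lemma smooth_rad2 : smooth rad2.
Proof. by apply: smooth_normsq; exact: smooth_W. Qed.

Definition i4 (j : nat) : 'I_4 := inord j.
Definition vec4 (a b c d : R) : 'rV[R]_4 := \row_j (nth 0 [:: a; b; c; d] j).

Lemma vec4E0 a b c d : vec4 a b c d 0 (i4 0) = a. Proof. by rewrite mxE inordK. Qed.
Lemma vec4E1 a b c d : vec4 a b c d 0 (i4 1) = b. Proof. by rewrite mxE inordK. Qed.
Lemma vec4E2 a b c d : vec4 a b c d 0 (i4 2) = c. Proof. by rewrite mxE inordK. Qed.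
Lemma vec4E3 a b c d : vec4 a b c d 0 (i4 3) = d. Proof. by rewrite mxE inordK. Qed.
Definition vec4E := (vec4E0, vec4E1, vec4E2, vec4E3).

Lemma ord4P (j : 'I_4) : [\/ j = i4 0, j = i4 1, j = i4 2 | j = i4 3].
Proof.
case: j => [[|[|[|[|//]]]]] h; [apply: Or41|apply: Or42|apply: Or43|apply: Or44];
  by apply: val_inj; rewrite /= inordK.
Qed.

Lemma smooth_vec4 (V : normedModType R) (a b c d : V -> R) :
  smooth a -> smooth b -> smooth c -> smooth d ->
  smooth (fun p => vec4 (a p) (b p) (c p) (d p)).
Proof.
move=> Ca Cb Cc Cd; apply: smooth_row => j; case: (ord4P j) => ->.
- by rewrite (_ : (fun _ => _) = a) //; apply/funext => x; rewrite vec4E.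
- by rewrite (_ : (fun _ => _) = b) //; apply/funext => x; rewrite vec4E.
- by rewrite (_ : (fun _ => _) = c) //; apply/funext => x; rewrite vec4E.
- by rewrite (_ : (fun _ => _) = d) //; apply/funext => x; rewrite vec4E.
Qed.

Lemma smooth_crd (j : 'I_4) : smooth (fun X => X 0 j).
Proof. by apply: smooth_coord; exact: smooth_id. Qed.

(** Logarithmic polar coordinates: a homomorphism from [R^4] to the product of
    two circles and the punctured plane.  The torus times the
    disc corresponds to [X_3 >= 0] and its boundary to [X_3 = 0]. *)
Definition pol X : 'rV[R]_(2 + 2 + 2) :=
  tri (circ (X 0 (i4 0))) (circ (X 0 (i4 1)))
      (expR (- X 0 (i4 3)) *: circ (X 0 (i4 2))).

Lemma smooth_pol : smooth pol.
Proof.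
apply: smooth_tri; try (apply: smooth_circ; exact: smooth_crd).
apply: smooth_scale; last by apply: smooth_circ; exact: smooth_crd.
by apply: smooth_comp_scal; [apply: smoothN; exact: smooth_crd|exact: Cinf_expR].
Qed.

Lemma polD X Y : pol (X + Y) = tmul (pol X) (pol Y).
Proof. by rewrite /pol /tmul !triE cmulZ -expRD !mxE opprD !circD. Qed.

Lemma pol0 : pol 0 = tri (row2 1 0) (row2 1 0) (row2 1 0).
Proof. by rewrite /pol !mxE oppr0 expR0 scale1r circ0. Qed.

Lemma tmul1 x : tmul (pol 0) x = x.
Proof. by rewrite /tmul pol0 !triE !cmul1 triK. Qed.

Lemma rad2_pol X : rad2 (pol X) = expR (- (2 * X 0 (i4 3))).
Proof.
by rewrite /rad2 /pol triE normsqZ normsq_circ mulr1 expr2 -expRD; congr expR; ring.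
Qed.

Lemma rad2_tmul x y : rad2 (tmul x y) = rad2 x * rad2 y.
Proof. by rewrite /rad2 /tmul triE normsq_cmul. Qed.

Lemma T2R2_pol X : T2R2 (pol X).
Proof. by split; rewrite /pol triE normsq_circ. Qed.

Lemma T2R2_tmul x y : T2R2 x -> T2R2 y -> T2R2 (tmul x y).
Proof. by move=> [x1 x2] [y1 y2]; split; rewrite triE normsq_cmul ?x1 ?y1 ?x2 ?y2 mulr1. Qed.

Lemma pol_eq3 X Y : pol X = pol Y -> X 0 (i4 3) = Y 0 (i4 3).
Proof.
move=> e; have := rad2_pol X; rewrite e rad2_pol => /expR_inj /oppr_inj.
by move=> /(mulfI (_ : (2 : R) != 0)) -> //; rewrite pnatr_eq0.
Qed.

Lemma pol_shift X Y V : pol X = pol Y -> pol (X + V) = pol (Y + V).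
Proof. by move=> e; rewrite !polD e. Qed.

Lemma pol_onto z : T2R2 z -> rad2 z != 0 ->
  exists X, pol X = z /\ (forall j, j != i4 3 -> `|X 0 j| <= 1).
Proof.
move=> [z1 z2] r0; have rp : 0 < rad2 z by rewrite lt_neqAle eq_sym r0 normsq_ge0.
have [a a1 ea] := circ_onto z1; have [b b1 eb] := circ_onto z2.
pose s := Num.sqrt (rad2 z); have s0 : 0 < s by rewrite sqrtr_gt0.
have : normsq (s^-1 *: W z) = 1.
  by rewrite normsqZ -/(rad2 z) exprVn sqr_sqrtr ?(ltW rp) // mulVf.
case/circ_onto => c c1 ec.
exists (vec4 a b c (- ln s)); split.
  by rewrite /pol !vec4E opprK lnK ?posrE // ea eb ec scalerA divff ?scale1r ?triK // gt_eqF.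
by move=> j; case: (ord4P j) => ->; rewrite ?vec4E // eqxx.
Qed.

End Torus.


Section Log.
Variable R : realType.
Implicit Types (x y z : 'rV[R]_(2 + 2 + 2)) (u v w : 'rV[R]_2) (X Y : 'rV[R]_4).

Lemma near_gt n (f : 'rV[R]_n -> R) p (c : R) :
  smooth f -> c < f p -> \forall q \near p, c < f q.
Proof. by move=> Cf h; exact: (smooth_continuous Cf (x := p) (lt_nbhsr h)). Qed.

Lemma near_lt n (f : 'rV[R]_n -> R) p (c : R) :
  smooth f -> f p < c -> \forall q \near p, f q < c.
Proof. by move=> Cf h; exact: (smooth_continuous Cf (x := p) (lt_nbhsl h)). Qed.

(** A smooth inverse of [pol] on a neighbourhood of its value at the origin. *)
Definition pol_log z : 'rV[R]_4 :=
  vec4 (ang (U1 z)) (ang (U2 z)) (ang (W z))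
       (- (ln (rad2 z + flat 0 (1 / 4 - rad2 z)) / 2)).

Lemma rad2_flat z : 0 < rad2 z + flat 0 (1 / 4 - rad2 z).
Proof.
have r0 : 0 <= rad2 z by exact: normsq_ge0.
have [h|h] := ltP (rad2 z) (1 / 4).
  by rewrite ltr_wpDl // flat_gt0 // subr_gt0.
by rewrite ltr_pwDl ?flat_ge0 //; lra.
Qed.

Lemma smooth_pol_log : smooth pol_log.
Proof.
apply: smooth_vec4; try apply: smooth_comp_row.
- exact: smooth_U1.
- exact: smooth_ang.
- exact: smooth_U2.
- exact: smooth_ang.
- exact: smooth_W.
- exact: smooth_ang.
apply: smoothN; apply: smoothM; last exact: smooth_cst.
apply: smooth_ln => [z|]; first exact: rad2_flat.
apply: smoothD; first exact: smooth_rad2.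
apply: smooth_comp_scal; last exact: Cinf_flat.
by apply: smoothB; [exact: smooth_cst|exact: smooth_rad2].
Qed.

Definition log_domain z : Prop :=
  [/\ 1 / 2 <= U1 z 0 0, 1 / 2 <= U2 z 0 0 & 1 / 2 <= W z 0 0].

Lemma near_log_domain z : `|z - pol 0| < 1 / 2 -> log_domain z.
Proof.
move=> h; split.
- have := le_lt_trans (coord_le_norm (z - pol 0) (lshift 2 (lshift 2 0))) h.
  have -> : (z - pol 0) 0 (lshift 2 (lshift 2 0)) = U1 z 0 0 - U1 (pol 0) 0 0 by rewrite !mxE.
  by rewrite pol0 !triE row2E ltr_norml; lra.
- have := le_lt_trans (coord_le_norm (z - pol 0) (lshift 2 (rshift 2 0))) h.
  have -> : (z - pol 0) 0 (lshift 2 (rshift 2 0)) = U2 z 0 0 - U2 (pol 0) 0 0 by rewrite !mxE.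
  by rewrite pol0 !triE row2E ltr_norml; lra.
- have := le_lt_trans (coord_le_norm (z - pol 0) (rshift (2 + 2) 0)) h.
  have -> : (z - pol 0) 0 (rshift (2 + 2) 0) = W z 0 0 - W (pol 0) 0 0 by rewrite !mxE.
  by rewrite pol0 !triE row2E ltr_norml; lra.
Qed.

Lemma pol_pol_log z : T2R2 z -> log_domain z -> pol (pol_log z) = z.
Proof.
move=> [z1 z2] [g1 g2 g3]; rewrite /pol /pol_log !vec4E opprK.
have e1 := circ_ang g1; rewrite z1 sqrtr1 scale1r in e1.
have e2 := circ_ang g2; rewrite z2 sqrtr1 scale1r in e2.
have r14 : 1 / 4 <= rad2 z.
  by rewrite /rad2 normsq2; have := sqr_ge0 (W z 0 1); nra.
have r0 : 0 < rad2 z by apply: lt_le_trans r14; rewrite divr_gt0.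
rewrite flat0 ?subr_le0 // addr0 e1 e2.
have -> : expR (ln (rad2 z) / 2) = Num.sqrt (rad2 z).
  apply/eqP; rewrite -(@eqrXn2 _ 2) ?expR_ge0 ?sqrtr_ge0 // sqr_sqrtr ?(ltW r0) //.
  by rewrite expr2 -expRD -splitr lnK.
by rewrite circ_ang // triK.
Qed.

Lemma pol_log0 : pol_log (pol 0) = 0.
Proof.
have ang1 : ang (row2 1 0) = 0 :> R.
  by rewrite angE ?row2E ?mul0r ?atan0 ?mul0r //; lra.
have h : rad2 (pol (0 : 'rV[R]_4)) = 1 by rewrite rad2_pol mxE mulr0 oppr0 expR0.
rewrite /pol_log h flat0; last by lra.
rewrite addr0 ln1 mul0r oppr0 pol0 !triE !ang1.
by apply/rowP => j; case: (ord4P j) => ->; rewrite vec4E mxE.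
Qed.

Lemma tmul_polN X : tmul (pol X) (pol (- X)) = pol 0.
Proof. by rewrite -polD subrr. Qed.

(** Near [pol X] the logarithm of the quotient by [pol X]. *)
Definition pol_lift X z := X + pol_log (tmul z (pol (- X))).

Lemma smooth_pol_lift X : smooth (pol_lift X).
Proof.
apply: smoothD; first exact: smooth_cst.
apply: smooth_comp; last exact: smooth_pol_log.
by apply: smooth_tmul; [exact: smooth_id|exact: smooth_cst].
Qed.

Lemma pol_pol_lift X z : T2R2 z -> log_domain (tmul z (pol (- X))) -> pol (pol_lift X z) = z.
Proof.
move=> Tz gz; rewrite polD pol_pol_log //; last by apply: T2R2_tmul => //; exact: T2R2_pol.
by rewrite (tmulC z) tmulA tmul_polN tmul1.
Qed.

Lemma near_pol_lift X : \forall z \near pol X, T2R2 z -> pol (pol_lift X z) = z.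
Proof.
have : \forall z \near pol X, log_domain (tmul z (pol (- X))).
  apply: (near_comp (f := fun z => tmul z (pol (- X)))).
    by apply: smooth_tmul; [exact: smooth_id|exact: smooth_cst].
  rewrite tmul_polN; apply/nbhs_distP; exists (1 / 2) => // y; exact: near_log_domain.
by apply: filterS => z gz Tz; exact: pol_pol_lift.
Qed.

(** The polar coordinates degenerate on the core, so the charts use Cartesian
    coordinates in the plane. *)
Lemma chart_T2R2 z0 : T2R2 z0 ->
  exists (c : 'rV[R]_4 -> 'rV[R]_(2 + 2 + 2)) (l : 'rV[R]_(2 + 2 + 2) -> 'rV[R]_4),
    chart (@T2R2 R) z0 c l.
Proof.
move=> [z1 z2]; have [a _ ea] := circ_onto z1; have [b _ eb] := circ_onto z2.
pose c X := tri (circ (X 0 (i4 0))) (circ (X 0 (i4 1))) (row2 (X 0 (i4 2)) (X 0 (i4 3))).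
pose l z := vec4 (a + ang (cmul (U1 z) (circ (- a)))) (b + ang (cmul (U2 z) (circ (- b))))
   (W z 0 0) (W z 0 1).
have C_crd j : smooth (fun X => X 0 (i4 j)) by exact: smooth_crd.
have Cc : smooth c.
  by apply: smooth_tri; [exact: smooth_circ|exact: smooth_circ|exact: smooth_row2].
have CU1 (t : R) : smooth (fun z => cmul (U1 z) (circ t)).
  by apply: smooth_cmul; [exact: smooth_U1|exact: smooth_cst].
have CU2 (t : R) : smooth (fun z => cmul (U2 z) (circ t)).
  by apply: smooth_cmul; [exact: smooth_U2|exact: smooth_cst].
have Cl : smooth l.
  apply: smooth_vec4.
  - by apply: smoothD; [exact: smooth_cst|apply: smooth_comp_row => //; exact: smooth_ang].
  - by apply: smoothD; [exact: smooth_cst|apply: smooth_comp_row => //; exact: smooth_ang].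
  - by apply: smooth_coord; exact: smooth_W.
  - by apply: smooth_coord; exact: smooth_W.
have circN (t : R) : cmul (circ t) (circ (- t)) = row2 1 0 by rewrite -circD subrr circ0.
have ang1 : ang (row2 1 0) = 0 :> R.
  by rewrite angE ?row2E ?mul0r ?atan0 ?mul0r //; lra.
have lz0 : l z0 = vec4 a b (W z0 0 0) (W z0 0 1).
  by rewrite /l -ea -eb !circN ang1 !addr0.
have back (t : R) u : normsq u = 1 -> 1 / 2 < cmul u (circ (- t)) 0 0 ->
    circ (t + ang (cmul u (circ (- t)))) = u.
  move=> u1 h; have e := circ_ang (ltW h).
  rewrite normsq_cmul u1 normsq_circ mulr1 sqrtr1 scale1r in e.
  by rewrite circD e cmulC -cmulA (cmulC (circ (- t))) circN cmulC cmul1.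
exists c, l; split => //.
- by rewrite lz0 /c !vec4E ea eb -[RHS]triK; congr tri; apply: row2P; rewrite row2E.
- have nc (t : R) (k : nat) : vec4 a b (W z0 0 0) (W z0 0 1) 0 (i4 k) = t ->
      \forall p \near l z0, t + ang (cmul (circ ((p : 'rV[R]_4) 0 (i4 k))) (circ (- t))) = p 0 (i4 k).
    move=> tk.
    have n1 : \forall p \near l z0, 1 / 2 < cos (2 * pi * ((p : 'rV[R]_4) 0 (i4 k) - t)).
      apply: (near_gt (f := fun X => cos (2 * pi * (X 0 (i4 k) - t)))).
        apply: smooth_comp_scal; last by move=> j; have [] := @Cinf_cos_sin R j.
        apply: smoothM; first exact: smooth_cst.
        by apply: smoothB => //; exact: smooth_cst.
      by rewrite lz0 tk subrr mulr0 cos0; lra.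
    have n2 : \forall p \near l z0, `|p - l z0| < 1 / 4 by apply/nbhs_distP; exists (1 / 4).
    near=> p; rewrite -circD ang_circ; first by rewrite addrC subrK.
      have h : `|p - l z0| < 1 / 4 by near: p.
      apply: le_lt_trans h; apply: le_trans (coord_le_norm _ (i4 k)).
      by rewrite lz0 2!mxE tk.
    by apply/ltW; near: p.
  have na := nc a 0 (vec4E0 _ _ _ _); have nb := nc b 1%N (vec4E1 _ _ _ _).
  near=> p; split; first by split; rewrite /c triE normsq_circ.
  have ha : a + ang (cmul (circ (p 0 (i4 0))) (circ (- a))) = p 0 (i4 0) by near: p.
  have hb : b + ang (cmul (circ (p 0 (i4 1))) (circ (- b))) = p 0 (i4 1) by near: p.
  rewrite /l /c !triE ha hb !row2E.
  by apply/rowP => j; case: (ord4P j) => ->; rewrite vec4E.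
- have n1 : \forall z \near z0, 1 / 2 < cmul (U1 z) (circ (- a)) 0 0.
    apply: (near_gt (f := fun z => cmul (U1 z) (circ (- a)) 0 0)).
      exact: smooth_coord.
    by rewrite -ea circN row2E; lra.
  have n2 : \forall z \near z0, 1 / 2 < cmul (U2 z) (circ (- b)) 0 0.
    apply: (near_gt (f := fun z => cmul (U2 z) (circ (- b)) 0 0)).
      exact: smooth_coord.
    by rewrite -eb circN row2E; lra.
  near=> z => -[t1 t2]; rewrite /c /l !vec4E !back //; try by near: z.
  by rewrite -[RHS]triK; congr tri; apply: row2P; rewrite row2E.
Unshelve. all: by end_near. Qed.

(** * Functions of the polar coordinates *)

(** The functions of [pol X].  They stand for functions on the compact torus
    times a line, which makes them bounded on the strips [|X_3| <= 1], and they
    are stable under differentiation. *)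
Definition polinv (T : Type) (f : 'rV[R]_4 -> T) := forall X Y, pol X = pol Y -> f X = f Y.

Lemma polinv_derive (V : normedModType R) (f : 'rV[R]_4 -> V) (v : 'rV[R]_4) :
  polinv f -> polinv (fun X => 'D_v f X).
Proof.
move=> fi X Y e.
have E : (fun h : R => h^-1 *: (f (h *: v + X) - f X)) =
         (fun h : R => h^-1 *: (f (h *: v + Y) - f Y)).
  apply/funext => h; rewrite (fi X Y e) (fi _ (h *: v + Y)) //.
  by rewrite addrC (addrC _ Y); exact: pol_shift.
by rewrite /derive /= E.
Qed.

Lemma polinv_rep X : exists Y, pol Y = pol X /\
  (`|X 0 (i4 3)| <= 1 -> `|Y| <= 1).
Proof.
have [|Y [e hY]] := @pol_onto R (pol X) (T2R2_pol X); first by rewrite rad2_pol gt_eqF // expR_gt0.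
exists Y; split=> // h; apply: norm_le => // j.
have [->|/hY//] := eqVneq j (i4 3).
by rewrite (pol_eq3 e).
Qed.

Lemma compact_unit n : compact [set Y : 'rV[R]_n | `|Y| <= 1].
Proof.
have -> : [set Y : 'rV[R]_n | `|Y| <= 1] = [set Y | `|Y - 0| <= 1].
  by apply/seteqP; split => z /=; rewrite subr0.
exact: compact_cball.
Qed.

Lemma polinv_bound (f : 'rV[R]_4 -> R) : smooth f -> polinv f ->
  exists2 C : R, 0 < C & forall X, `|X 0 (i4 3)| <= 1 -> `|f X| <= C.
Proof.
move=> Cf fi; pose K := [set Y : 'rV[R]_4 | `|Y| <= 1].
have K0 : K !=set0 by exists 0; rewrite /K /= normr0.
have C2 : smooth (fun X => f X ^+ 2) by exact: smoothX.
have [c _ hc] := EVT_max_rV K0 (@compact_unit 4) (continuous_subspaceT (smooth_continuous C2)).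
exists (f c ^+ 2 + 1) => [|X hX]; first by rewrite ltr_wpDl // sqr_ge0.
have [Y [e hY]] := polinv_rep X; rewrite -(fi _ _ e).
have := hc Y (mem_set (hY hX)); rewrite -(real_normK (num_real (f Y))).
have := sqr_ge0 (`|f Y| - 1); have := normr_ge0 (f Y); nra.
Qed.

Lemma polinv_boundv n (f : 'rV[R]_4 -> 'rV[R]_n) : smooth f -> polinv f ->
  exists2 C : R, 0 < C & forall X, `|X 0 (i4 3)| <= 1 -> `|f X| <= C.
Proof.
move=> Cf fi; have [||C C0 hC] := @polinv_bound (fun X => normsq (f X)).
- exact: smooth_normsq.
- by move=> X Y /fi ->.
exists (C + 1) => [|X /hC]; first by rewrite addr_gt0.
rewrite ger0_norm ?normsq_ge0 //; have := norm_le_normsq (f X).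
have := sqr_ge0 (`|f X| - 1); have := normr_ge0 (f X); nra.
Qed.

(** The normal derivative of [f] is bounded on the strip. *)
Lemma polinv_tube n (f : 'rV[R]_4 -> 'rV[R]_n) : smooth f -> polinv f ->
  (forall X, X 0 (i4 3) = 0 -> f X = 0) ->
  exists2 C : R, 0 < C & forall X, `|X 0 (i4 3)| <= 1 -> `|f X| <= C * `|X 0 (i4 3)|.
Proof.
move=> Cf fi f0; pose ek : 'rV[R]_4 := delta_mx 0 (i4 3).
have [C C0 hC] := polinv_boundv (smooth_derive ek Cf) (fun X Y => @polinv_derive _ f ek fi X Y).
exists C => // X hX; apply: norm_le => [|j]; first by rewrite mulr_ge0 // ltW.
set t := X 0 (i4 3); pose Y := X - t *: ek.
have Y3 : Y 0 (i4 3) = 0 by rewrite /Y !mxE !eqxx mulr1 subrr.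
have YX : Y + t *: ek = X by rewrite /Y subrK.
have Cj : smooth (fun X => f X 0 j) by exact: smooth_coord.
have [c [c0 c1]] := mvt_line Y (t *: ek) Cj.
rewrite YX (f0 Y) // [X in _ - X]mxE subr0 => ->.
set Z := Y + _; have Z3 : Z 0 (i4 3) = c * t.
  by rewrite /Z mxE Y3 add0r !mxE !eqxx mulr1.
have dfj : differentiable (fun X => f X 0 j) Z by exact: smooth_differentiable.
rewrite (deriveE _ dfj) linearZ /= normrZ mulrC -(deriveE _ dfj).
rewrite derive_coord; last exact: smooth_differentiable.
apply: ler_pM => //; apply: le_trans (coord_le_norm _ _) _; apply: hC.
by rewrite Z3 normrM (ger0_norm c0); apply: mulr_ile1.
Qed.

Lemma polinv_pos (f : 'rV[R]_4 -> R) : smooth f -> polinv f ->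
  (forall X, X 0 (i4 3) = 0 -> 0 < f X) ->
  exists (c d : R), [/\ 0 < c, 0 < d & forall X, `|X 0 (i4 3)| <= d -> c <= f X].
Proof.
move=> Cf fi f0; pose ek : 'rV[R]_4 := delta_mx 0 (i4 3).
pose pr X := X - X 0 (i4 3) *: ek.
have Cpr : smooth pr.
  apply: smoothB; first exact: smooth_id.
  by apply: smooth_scale; [exact: smooth_crd|exact: smooth_cst].
have pr3 X : pr X 0 (i4 3) = 0 by rewrite /pr !mxE !eqxx mulr1 subrr.
have pri X Y : pol X = pol Y -> pol (pr X) = pol (pr Y).
  by move=> e; rewrite /pr (pol_eq3 e); exact: pol_shift.
pose K := [set Y : 'rV[R]_4 | `|Y| <= 1].
have K0 : K !=set0 by exists 0; rewrite /K /= normr0.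
have Cfp : smooth (fun X => f (pr X)) by exact: smooth_comp_row.
have [c _ hc] := EVT_min_rV K0 (@compact_unit 4) (continuous_subspaceT (smooth_continuous Cfp)).
set m := f (pr c) in hc; have m0 : 0 < m by exact: f0.
have hm X : `|X 0 (i4 3)| <= 1 -> m <= f (pr X).
  move=> hX; have [Y [e hY]] := polinv_rep X; rewrite -(fi _ _ (pri _ _ e)).
  by apply: hc; apply: mem_set; exact: hY.
pose g X : 'rV[R]_1 := (f X - f (pr X))%:M.
have g00 X : g X 0 0 = f X - f (pr X) by rewrite !mxE eqxx mulr1n.
have [||X X3|C C0 hC] := @polinv_tube 1 g.
- apply: smooth_row => j; rewrite (ord1 j) (_ : (fun _ => _) = fun X => f X - f (pr X)).
    exact: smoothB.
  by apply/funext => X; rewrite g00.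
- by move=> X Y e; rewrite /g (fi _ _ e) (fi _ _ (pri _ _ e)).
- by rewrite /g /pr X3 scale0r subr0 subrr; apply/rowP => j; rewrite (ord1 j) !mxE mul0rn.
exists (m / 2), (Num.min 1 (m / (2 * C))); split.
- by rewrite divr_gt0.
- by rewrite lt_min ltr01 divr_gt0 // mulr_gt0.
move=> X; rewrite le_min => /andP[h1 h2].
have := le_trans (coord_le_norm (g X) 0) (hC X h1); rewrite g00.
have : C * `|X 0 (i4 3)| <= m / 2.
  move: h2; rewrite !ler_pdivlMr ?mulr_gt0 //; lra.
by move=> h3 h4; have := le_trans h4 h3; rewrite ler_norml; have := hm X h1; lra.
Qed.

End Log.


(** * Blending on the torus times the plane *)

Section TorusBlend.
Variable R : realType.
Implicit Types (z : 'rV[R]_(2 + 2 + 2)) (X Y : 'rV[R]_4).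

Lemma derive_flat (V W : normedModType R) (f : V -> W) x v :
  (forall h : R, f (h *: v + x) = f x) -> 'D_v f x = 0.
Proof.
move=> H; have E : (fun h : R => h^-1 *: (f (h *: v + x) - f x)) = (fun=> 0).
  by apply/funext => h; rewrite H subrr scaler0.
by rewrite /derive /= E; exact: lim_cst.
Qed.

Local Notation k3 := (i4 3).
Local Notation e3 := (delta_mx 0 (i4 3) : 'rV[R]_4).

Lemma i4_neq3 (j : 'I_4) (h : R) X : j != k3 -> (h *: delta_mx 0 j + X) 0 k3 = X 0 k3.
Proof. by move=> jk; rewrite !mxE eq_sym (negPf jk) andbF mulr0 add0r. Qed.

(** A map of the torus times the plane that fixes the torus times the circle
    and moves its normals to the right side agrees near there with a
    diffeomorphism preserving the torus times the disc.  Lifted to [R^4] by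
    [pol], the map becomes a displacement [a] periodic along the hyperplane
    [X_3 = 0], to which [blend] applies. *)
Lemma torus_blend (phi : 'rV[R]_(2 + 2 + 2) -> 'rV[R]_(2 + 2 + 2)) (d0 : R) :
  smooth phi -> (forall z, T2R2 z -> rad2 z = 1 -> phi z = z) ->
  0 < d0 -> (forall X, `|X 0 k3| < d0 -> T2R2 (phi (pol X))) ->
  (forall X, X 0 k3 = 0 -> 'D_e3 (fun X => rad2 (phi (pol X))) X < 0) ->
  exists (G G' : 'rV[R]_(2 + 2 + 2) -> 'rV[R]_(2 + 2 + 2)),
    [/\ smooth_on (@T2R2 R) G, smooth_on (@T2R2 R) G',
        forall z, T2R2 z -> [/\ T2R2 (G z), T2R2 (G' z), G' (G z) = z & G (G' z) = z],
        forall z, T2R2 z -> (rad2 (G z) <= 1) = (rad2 z <= 1) &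
        forall z0, T2R2 z0 -> rad2 z0 = 1 -> \forall z \near z0, T2R2 z -> G z = phi z].
Proof.
move=> Cphi phi1 d00 phiT phiD.
pose b X := tmul (phi (pol X)) (pol (- X)).
pose a X := pol_log (b X).
have CphiP : smooth (fun X => phi (pol X)) by exact: smooth_comp (@smooth_pol R) Cphi.
have Cb : smooth b.
  apply: smooth_tmul => //; apply: smooth_comp; last exact: smooth_pol.
  by apply: smoothN; exact: smooth_id.
have Ca : smooth a by apply: smooth_comp => //; exact: smooth_pol_log.
have polN X Y : pol X = pol Y -> pol (- X) = pol (- Y).
  move=> e; have := pol_shift (- X - Y) e.
  by rewrite addrA subrr add0r addrCA subrr addr0 => ->.
have bi : polinv b by move=> X Y e; rewrite /b e (polN _ _ e).
have ai : polinv a by move=> X Y /bi e; rewrite /a e.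
have rp X : X 0 k3 = 0 -> rad2 (pol X) = 1.
  by move=> h; rewrite rad2_pol h mulr0 oppr0 expR0.
have b0 X : X 0 k3 = 0 -> b X = pol 0.
  by move=> h; rewrite /b phi1 ?rp // ?tmul_polN //; exact: T2R2_pol.
have a0 X : X 0 k3 = 0 -> a X = 0 by move=> /b0 e; rewrite /a e pol_log0.
(* Bounds for [blend]: [a] and its tangential derivatives vanish on
   [X_3 = 0], so they are of the order of [X_3]. *)
have [Ct Ct0 ht] := polinv_tube Ca ai a0.
have [Cn Cn0 hn] := polinv_boundv (smooth_derive e3 Ca) (fun X Y => @polinv_derive _ _ a e3 ai X Y).
have hor (i : 'I_4) : exists C : R, 0 < C /\ (i != k3 -> forall X, `|X 0 k3| <= 1 ->
    `|'D_(delta_mx 0 i) a X| <= C * `|X 0 k3|).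
  have [->|ik] := eqVneq i k3; first by exists 1.
  have [|C C0 hC] := polinv_tube (smooth_derive (delta_mx 0 i) Ca)
     (fun X Y => @polinv_derive _ _ a (delta_mx 0 i) ai X Y).
    move=> X X3; apply: derive_flat => h; rewrite !a0 //.
    by rewrite i4_neq3.
  by exists C.
have [Ch hCh] := choice hor.
pose C := Ct + Cn + \sum_i Ch i.
have Ch0 : 0 <= \sum_i Ch i by apply: sumr_ge0 => i _; have [/ltW] := hCh i.
have C0 : 0 < C by rewrite ltr_pwDl // addr_gt0.
have H1 X : `|X 0 k3| <= 1 -> `|a X| <= C * `|X 0 k3|.
  by move=> h; apply: le_trans (ht X h) _; rewrite ler_wpM2r // /C; lra.
have H2 i X : i != k3 -> `|X 0 k3| <= 1 -> `|'D_(delta_mx 0 i) a X| <= C * `|X 0 k3|.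
  move=> ik h; have [_ /(_ ik X h) h2] := hCh i; apply: le_trans h2 _.
  rewrite ler_wpM2r // /C (bigD1 i) //=.
  have : 0 <= \sum_(j < 4 | j != i) Ch j by apply: sumr_ge0 => j _; have [/ltW] := hCh j.
  by move: Ct0 Cn0; lra.
have H3 X : `|X 0 k3| <= 1 -> `|'D_e3 a X| <= C.
  by move=> h; apply: le_trans (hn X h) _; rewrite /C; lra.
(* Near [X_3 = 0] the normal component of [X + a X] is [- ln (r X) / 2], where
   [r] is the squared radius of [phi (pol X)]. *)
have pos X : X 0 k3 = 0 -> 0 < 1 + 'D_e3 a X 0 k3.
  move=> X3; pose r Y := rad2 (phi (pol Y)).
  have Cr : smooth r by apply: smooth_comp_row => //; exact: smooth_rad2.
  have r1 : r X = 1 by rewrite /r phi1 ?rp //; exact: T2R2_pol.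
  have E : \forall Y \near X, - (ln (r Y) / 2) - Y 0 k3 = a Y 0 k3.
    have n1 : \forall Y \near X, 1 / 4 < rad2 (b Y).
      apply: (near_gt (f := fun Y => rad2 (b Y))).
        by apply: smooth_comp_row => //; exact: smooth_rad2.
      by rewrite b0 // rp ?mxE //; lra.
    have n2 : \forall Y \near X, 0 < r Y by apply: near_gt => //; rewrite r1.
    near=> Y; have h1 : 1 / 4 < rad2 (b Y) by near: Y.
    have h2 : 0 < r Y by near: Y.
    rewrite /a /pol_log vec4E flat0 ?subr_le0 ?ltW // addr0 /b rad2_tmul -/(r Y).
    by rewrite rad2_pol lnM ?posrE ?expR_gt0 // expRK mxE; field.
  rewrite -derive_coord; last exact: smooth_differentiable.
  rewrite -(near_eq_derive _ E).
  have D1 : 'D_e3 (fun Y => ln (r Y)) X = 'D_e3 r X.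
    have dln : is_derive (r X : R^o) (1 : R^o) (@ln R) 1.
      by rewrite r1; have := @is_derive1_ln R 1 ltr01; rewrite invr1.
    have drX : differentiable r X by exact: smooth_differentiable.
    by rewrite (derive_chain e3 drX dln) mulr1.
  have D2 : 'D_e3 (fun Y => Y 0 k3) X = 1.
    have dX : differentiable (fun Y => Y 0 k3) X by apply: smooth_differentiable; exact: smooth_crd.
    have hid : differentiable (id : 'rV[R]_4 -> 'rV[R]_4) X.
      by apply: smooth_differentiable; exact: smooth_id.
    by rewrite [LHS](@derive_coord R _ 1 4 id X e3 0 k3 hid) derive_id mxE !eqxx.
  have n2 : \forall Y \near X, 0 < r Y by apply: near_gt => //; rewrite r1.
  have dl : differentiable (fun Y => ln (r Y)) X.
    apply: (@differentiable_comp _ _ _ _ r (@ln R)); first exact: smooth_differentiable.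
    by apply/derivable1_diffP; have := @is_derive1_ln R (r X); rewrite r1 => /(_ ltr01) [].
  have -> : (fun Y => - (ln (r Y) / 2) - Y 0 k3) =
      (- (2^-1 *: (fun Y => ln (r Y)))) - (fun Y => Y 0 k3).
    by apply/funext => Y; rewrite -[RHS]/(- (_ *: _) - _) /GRing.scale /= mulrC.
  have dX : differentiable (fun Y => Y 0 k3) X by apply: smooth_differentiable; exact: smooth_crd.
  rewrite deriveB; [|by apply: diff_derivable; apply: differentiableN; apply: differentiableZ|exact: diff_derivable].
  rewrite deriveN; last by apply: diff_derivable; apply: differentiableZ.
  rewrite deriveZ; last exact: diff_derivable.
  rewrite D1 D2 addrC subrK /GRing.scale /= oppr_gt0 pmulr_rlt0 ?invr_gt0 //.
  exact: phiD.
have [c [d [c0 dd0 H4]]] : exists c d : R, [/\ 0 < c, 0 < d &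
    forall X, `|X 0 k3| <= d -> c <= 1 + 'D_e3 a X 0 k3].
  apply: (@polinv_pos R (fun X => 1 + 'D_e3 a X 0 k3) _ _ pos).
    apply: smoothD; first exact: smooth_cst.
    by apply: smooth_coord; exact: smooth_derive.
  by move=> X Y e; rewrite (@polinv_derive _ _ a e3 ai X Y e).
(* For [|X_3| < e] the point [b X] stays where [pol_log] inverts [pol]. *)
have [|||Cb0 Cb00 hb] := @polinv_tube R _ (fun X => b X - pol 0).
- by apply: smoothB => //; exact: smooth_cst.
- by move=> X Y /bi ->.
- by move=> X /b0 ->; rewrite subrr.
pose e := Num.min (Num.min 1 d0) (1 / (2 * Cb0) / 2).
have e0 : 0 < e by rewrite !lt_min ltr01 d00 !divr_gt0 // mulr_gt0.
have e1 : e <= 1 by rewrite /e !ge_min lexx.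
have ed : e <= d0 by rewrite /e !ge_min lexx orbT.
have eC : e <= 1 / (2 * Cb0) / 2 by rewrite /e !ge_min lexx !orbT.
have [chi [s [c' [Cchi [s0 chi1] chi0 [c'0 LG] side]]]] := blend Ca C0 c0 dd0 e0 H1 H2 H3 H4.
set Gt := (fun X => X + chi (X 0 k3) *: a X) in LG side.
have CGt : smooth Gt.
  apply: smoothD; first exact: smooth_id.
  by apply: smooth_scale => //; apply: smooth_comp_scal => //; exact: smooth_crd.
have [gt [Cgt GK gK]] := global_inverse CGt c'0 LG.
have se (t : R) : `|t| < s -> `|t| < e.
  move=> ts; rewrite ltNge; apply/negP => te; have h := chi0 t te.
  by have := chi1 t ts; rewrite h => /esym/eqP; rewrite oner_eq0.
have Gti X Y : pol X = pol Y -> pol (Gt X) = pol (Gt Y).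
  by move=> eXY; rewrite /Gt (pol_eq3 eXY) (ai _ _ eXY); exact: pol_shift.
have Gts X V : pol X = pol (X + V) -> Gt (X + V) = Gt X + V.
  by move=> eXY; rewrite /Gt -(pol_eq3 eXY) -(ai _ _ eXY) addrAC.
(* [Y - X] is a period of [pol], and adding it commutes with [Gt]. *)
have gti X Y : pol X = pol Y -> pol (gt X) = pol (gt Y).
  move=> eXY; pose V := Y - X.
  have hV : pol (gt X) = pol (gt X + V).
    have := pol_shift (gt X - X) eXY.
    by rewrite addrCA subrr addr0 addrCA => ->.
  have : Gt (gt X + V) = Gt (gt Y) by rewrite Gts // !gK /V addrC subrK.
  by move/(can_inj GK) => <-.
have far X : e <= `|X 0 k3| -> Gt X = X by move=> /chi0 h; rewrite /Gt h scale0r addr0.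
have farg X : e <= `|X 0 k3| -> gt X = X by move=> /far h; rewrite -{1}h GK.
have Gphi X : `|X 0 k3| < s -> pol (Gt X) = phi (pol X).
  move=> Xs; rewrite /Gt chi1 // scale1r.
  have Xe := se _ Xs; have X1 : `|X 0 k3| <= 1 by apply/ltW/(lt_le_trans Xe).
  have Tp : T2R2 (phi (pol X)) by apply: phiT; exact: lt_le_trans ed.
  have gb : log_domain (b X).
    apply: near_log_domain; apply: le_lt_trans (hb X X1) _.
    apply: (@le_lt_trans _ _ (Cb0 * (1 / (2 * Cb0) / 2))).
      by rewrite ler_pM2l // ltW // (lt_le_trans Xe).
    have -> : Cb0 * (1 / (2 * Cb0) / 2) = 1 / 4 by field; rewrite gt_eqF.
    lra.
  rewrite polD /a pol_pol_log //; last by apply: T2R2_tmul => //; exact: T2R2_pol.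
  by rewrite /b tmulC -tmulA (tmulC (pol (- X))) tmul_polN tmulC tmul1.
(* A map of [R^4] compatible with [pol] descends to the torus times the
   punctured plane, and extends by the identity when it is the identity far
   from [X_3 = 0]. *)
pose desc (h : 'rV[R]_4 -> 'rV[R]_4) z :=
  if rad2 z == 0 then z else pol (h (xget 0 [set X | pol X = z])).
have descE h X : polinv (fun X => pol (h X)) -> desc h (pol X) = pol (h X).
  move=> hi; rewrite /desc rad2_pol gt_eqF ?expR_gt0 //.
  by apply: hi; have := @xgetPex _ 0 [set Y | pol Y = pol X] (ex_intro _ X erefl).
have T2R2_cases z : T2R2 z -> rad2 z = 0 \/ exists X, pol X = z.
  move=> Tz; have [r0|r0] := eqVneq (rad2 z) 0; first by left.
  by right; have [X [eX _]] := pol_onto Tz r0; exists X.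
have desc_smooth (h : 'rV[R]_4 -> 'rV[R]_4) : smooth h -> polinv (fun X => pol (h X)) ->
    (forall X, e <= `|X 0 k3| -> h X = X) -> smooth_on (@T2R2 R) (desc h).
  move=> Ch' hi hfar; apply: smooth_smooth_on => z0 Tz0.
  have [r0|[X0 eX0]] := T2R2_cases _ Tz0.
    have nr : \forall z \near z0, rad2 z < expR (- 2).
      by apply: near_lt; [exact: smooth_rad2|rewrite r0 expR_gt0].
    case/nbhs_distP: nr => t t0 ht'.
    exists id, t; split=> // [|z Tz /ht' rz]; first exact: smooth_id.
    have [rz0|[X eX]] := T2R2_cases _ Tz; first by rewrite /desc rz0 eqxx.
    rewrite -eX descE // hfar //; move: rz; rewrite -eX rad2_pol ltr_expR => h3.
    apply: le_trans (ler_norm _); apply: le_trans e1 _; lra.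
  have [t t0 ht'] := (nbhs_distP _ _).1 (near_pol_lift X0); rewrite eX0 in ht'.
  exists (fun z => pol (h (pol_lift X0 z))), t; split=> //.
    apply: smooth_comp; last exact: smooth_pol.
    by apply: smooth_comp => //; exact: smooth_pol_lift.
  by move=> z Tz zt; rewrite -{1}(ht' z zt Tz) descE.
have Tdesc h z : T2R2 z -> T2R2 (desc h z).
  by move=> Tz; rewrite /desc; case: eqP => // _; exact: T2R2_pol.
exists (desc Gt), (desc gt); split.
- exact: desc_smooth.
- exact: desc_smooth.
- move=> z Tz; split; try exact: Tdesc.
    have [rz0|[X <-]] := T2R2_cases _ Tz; first by rewrite {2}/desc rz0 eqxx /desc rz0 eqxx.
    by rewrite !descE // GK.
  have [rz0|[X <-]] := T2R2_cases _ Tz; first by rewrite {2}/desc rz0 eqxx /desc rz0 eqxx.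
  by rewrite !descE // gK.
- move=> z Tz; have [rz0|[X <-]] := T2R2_cases _ Tz; first by rewrite /desc rz0 eqxx rz0.
  rewrite descE // !rad2_pol !expR_le1 !oppr_le0 !pmulr_rge0 //.
  exact: side.
- move=> z0 Tz0 rz0.
  have n1 : \forall z \near z0, expR (- (2 * s)) < rad2 z.
    apply: near_gt; first exact: smooth_rad2.
    by rewrite rz0 expR_lt1 oppr_lt0 mulr_gt0.
  have n2 : \forall z \near z0, rad2 z < expR (2 * s).
    apply: near_lt; first exact: smooth_rad2.
    by rewrite rz0 expR_gt1 mulr_gt0.
  near=> z => Tz; have [rz|[X eX]] := T2R2_cases _ Tz.
    have h0 : expR (- (2 * s)) < rad2 z by near: z.
    by move: h0; rewrite rz ltNge expR_ge0.
  rewrite -eX descE // Gphi //.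
  have h1 : expR (- (2 * s)) < rad2 (pol X) by rewrite eX; near: z.
  have h2 : rad2 (pol X) < expR (2 * s) by rewrite eX; near: z.
  by move: h1 h2; rewrite rad2_pol !ltr_expR ltr_norml => ? ?; lra.
Unshelve. all: by end_near. Qed.

End TorusBlend.


(** * Embeddings of the torus times the disc *)

Section Collar.
Variable R : realType.
Implicit Types (z : 'rV[R]_(2 + 2 + 2)).

(** The torus times the disc, here the parameter space of a tubular
    neighbourhood of a torus in the 4-sphere. *)
Definition T2D2 : set 'rV[R]_(2 + 2 + 2) := [set z | T2R2 z /\ rad2 z <= 1].

Lemma dist_near n (x : 'rV[R]_n) (P : 'rV[R]_n -> Prop) :
  (\forall y \near x, P y) -> exists2 e : R, 0 < e & forall y, `|y - x| < e -> P y.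
Proof. by move/nbhs_distP. Qed.

Lemma near_smooth_on m n (A : set 'rV[R]_m) (f : 'rV[R]_m -> 'rV[R]_n) :
  (forall x, A x -> exists g : 'rV[R]_m -> 'rV[R]_n, smooth g /\
     \forall y \near x, A y -> f y = g y) -> smooth_on A f.
Proof.
move=> h; apply: smooth_smooth_on => x Ax; have [g [Cg /dist_near[e e0 H]]] := h x Ax.
by exists g, e; split=> // y Ay ye; exact: H.
Qed.

Lemma smooth_on_nearE m n (A : set 'rV[R]_m) (f : 'rV[R]_m -> 'rV[R]_n) x :
  smooth_on A f -> A x -> exists g : 'rV[R]_m -> 'rV[R]_n, smooth g /\
     \forall y \near x, A y -> f y = g y.
Proof.
move=> sf Ax; have [g [e [Cg e0 H]]] := smooth_on_near sf Ax.
by exists g; split=> //; apply/nbhs_distP; exists e => // y ye Ay; exact: H.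
Qed.

Lemma compact_far n (A : set 'rV[R]_n) x : compact A -> ~ A x ->
  \forall y \near x, ~ A y.
Proof.
move=> cA nAx; have cl : closed A by exact: compact_closed (@norm_hausdorff _ _) cA.
by have : open (~` A) by [rewrite openC]; rewrite openE; apply.
Qed.

Lemma fat_refl n (Z E : set 'rV[R]_n) x : Z x ->
  (\forall w \near x, Z w -> E w) -> fat Z E x.
Proof. by move=> Zz h e e0; exists x; rewrite subrr normr0. Qed.

Lemma near_lt1 z0 : rad2 z0 < 1 -> \forall z \near z0, rad2 z < 1.
Proof. by apply: near_lt; exact: smooth_rad2. Qed.

Lemma fat_T2D2 z0 : T2D2 z0 -> fat (@T2R2 R) T2D2 z0.
Proof.
move=> [Tz0]; rewrite le_eqVlt => /orP[/eqP r1|r1]; last first.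
  by apply: fat_refl => //; apply: filterS (near_lt1 r1) => w h Tw; split=> //; exact: ltW.
move=> e e0.
pose f (t : R) := tri (U1 z0) (U2 z0) ((1 - t) *: W z0).
have [t t0 ht] := small_multiple (normr_ge0 (W z0)) e0.
pose s := Num.min t (1 / 2); have s0 : 0 < s by rewrite lt_min t0 divr_gt0.
have s12 : s <= 1 / 2 by rewrite ge_min lexx orbT.
have fr : rad2 (f s) < 1.
  rewrite /rad2 /f triE normsqZ -/(rad2 z0) r1 mulr1; nra.
exists (f s); split.
- have -> : f s - z0 = tri 0 0 (- s *: W z0).
    rewrite -[X in _ - X]triK /f /tri opp_row_mx opp_row_mx !add_row_mx !subrr.
    by congr (row_mx _ _); apply/rowP => i; rewrite !mxE; ring.
  apply: le_lt_trans ht; apply: (@le_trans _ _ (s * `|W z0|)); last first.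
    by rewrite ler_wpM2r // ge_min lexx.
  apply: norm_le => [|j]; first by rewrite mulr_ge0 // ltW.
  have sW : 0 <= s * `|W z0| by rewrite mulr_ge0 // ltW.
  rewrite /tri; case: (split_ordP j) => i ->.
    rewrite row_mxEl; case: (split_ordP i) => l ->.
      by rewrite row_mxEl mxE normr0.
    by rewrite row_mxEr mxE normr0.
  rewrite row_mxEr mxE normrM normrN (gtr0_norm s0).
  by rewrite ler_wpM2l ?(ltW s0) // coord_le_norm.
- by case: Tz0 => h1 h2; split; rewrite /f triE.
- by apply: filterS (near_lt1 fr) => w h Tw; split=> //; exact: ltW.
Qed.

Section Domain.
Variables (m : nat) (S : set 'rV[R]_m) (T : 'rV[R]_(2 + 2 + 2) -> 'rV[R]_m)
  (k : 'rV[R]_m -> 'rV[R]_(2 + 2 + 2)).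
Hypotheses (subS : submanifold 4 S) (CT : smooth T) (Ck : smooth k)
  (nS : forall z0, T2D2 z0 -> \forall z \near z0, S (T z))
  (kT : forall z, T2D2 z -> k (T z) = z).

(** The extension of [T] past the boundary of the torus times the disc is still
    a local diffeomorphism to [S], by [fat_stretch] with the left inverse [k] of
    [T], which is only given on the image of [T2D2]. *)
Lemma local_T z0 : T2D2 z0 -> exists h : 'rV[R]_m -> 'rV[R]_(2 + 2 + 2),
  [/\ smooth h, h (T z0) = z0, \forall z \near z0, T2R2 z -> h (T z) = z &
      \forall w \near T z0, S w -> T2R2 (h w) /\ T (h w) = w].
Proof.
move=> Ez0; have [Tz0 _] := Ez0.
have [c [l ch]] := chart_T2R2 Tz0.
have ST0 : S (T z0) by exact: nbhs_singleton (nS Ez0).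
have [c' [l' ch']] := submanifold_chart subS ST0.
apply: (manifold_inverse ch ch' CT).
  by apply: filterS (nS Ez0) => z h _.
apply: (fat_stretch ch CT Ck (fat_T2D2 Ez0)).
by apply/nbhs_distP; exists 1 => // z _; exact: kT.
Qed.

Lemma open_T z0 : T2R2 z0 -> rad2 z0 < 1 ->
  \forall w \near T z0, S w -> exists z, [/\ T2R2 z, rad2 z < 1 & T z = w].
Proof.
move=> Tz0 r0; have Ez0 : T2D2 z0 by split=> //; exact: ltW.
have [h [Ch h0 _ n2]] := local_T Ez0.
have n3 : \forall w \near T z0, rad2 (h w) < 1.
  by apply: (near_comp Ch (P := fun z => rad2 z < 1)); rewrite h0; exact: near_lt1.
near=> w => Sw; have [Th e] : T2R2 (h w) /\ T (h w) = w by move: Sw; near: w.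
by exists (h w); split=> //; near: w.
Unshelve. all: by end_near. Qed.

(** What the open torus times the disc leaves of [S], boundary included. *)
Definition outer : set 'rV[R]_m := [set x | S x /\ ~ exists z, [/\ T2R2 z, rad2 z < 1 & T z = x]].

Lemma compact_outer : compact S -> compact outer.
Proof.
move=> cS; apply: (subclosed_compact _ cS) => [|x []//].
have clS : closed S by exact: compact_closed (@norm_hausdorff _ _) cS.
move=> x clx; have Sx : S x by apply: clS; apply: closureS clx => y [].
split=> // -[z [Tz rz eT]]; have := open_T Tz rz; rewrite eT => n1.
by have [y [[Sy ny] /(_ Sy)]] := clx _ n1.
Qed.

Lemma T2D2_outer z : T2D2 z -> rad2 z = 1 -> outer (T z).
Proof.
move=> Ez rz; split; first exact: nbhs_singleton (nS Ez).
move=> [z' [Tz' rz' eT]]; have Ez' : T2D2 z' by split=> //; exact: ltW.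
by have := kT Ez'; rewrite eT kT // => ezz'; move: rz'; rewrite -ezz' rz ltxx.
Qed.

(** The extension of [T] maps the outer side of the boundary to the outside. *)
Lemma outside_T z0 : T2D2 z0 -> \forall z \near z0, T2R2 z -> 1 <= rad2 z -> outer (T z).
Proof.
move=> Ez0; have [h [Ch h0 n1 n2]] := local_T Ez0.
have n3 : \forall z \near z0, T2R2 (k (T z)) -> h (T (k (T z))) = k (T z).
  apply: (near_comp (f := fun z => k (T z)) (P := fun z => T2R2 z -> h (T z) = z)).
    exact: smooth_comp.
  by rewrite kT.
(* If [T z] were [T z'] with [z'] inside, [z' = k (T z)] would be close to [z0],
   where [T] is injective. *)
have n4 := nS Ez0.
near=> z => Tz rz; split; first by near: z.
move=> [z' [Tz' rz' eT]]; have Ez' : T2D2 z' by split=> //; exact: ltW.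
have kz : k (T z) = z' by rewrite -eT kT.
have : T2R2 (k (T z)) -> h (T (k (T z))) = k (T z) by near: z.
rewrite kz eT => /(_ Tz').
have hz : h (T z) = z by apply: (near n1 z).
by rewrite hz => e; move: rz'; rewrite -e ltNge rz.
Unshelve. all: by end_near. Qed.

End Domain.

(** Division by the Euclidean norm, modified near the origin to be smooth
    everywhere. *)
Definition nrm n (u : 'rV[R]_n) : 'rV[R]_n :=
  (Num.sqrt (normsq u + flat 0 (1 / 2 - normsq u)))^-1 *: u.

Lemma nrm_den n (u : 'rV[R]_n) : 0 < normsq u + flat 0 (1 / 2 - normsq u).
Proof.
have r0 := normsq_ge0 u; have [h|h] := ltP (normsq u) (1 / 2).
  by rewrite ltr_wpDl // flat_gt0 // subr_gt0.
by rewrite ltr_pwDl ?flat_ge0 //; lra.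
Qed.

Lemma smooth_nrm n : smooth (@nrm n).
Proof.
have Cn : smooth (fun u : 'rV[R]_n => normsq u) by apply: smooth_normsq; exact: smooth_id.
apply: smooth_scale; last exact: smooth_id.
apply: smooth_inv => [u|]; first by rewrite gt_eqF // sqrtr_gt0 nrm_den.
apply: smooth_sqrt => [u|]; first exact: nrm_den.
apply: smoothD => //; apply: smooth_comp_scal; last exact: Cinf_flat.
by apply: smoothB => //; exact: smooth_cst.
Qed.

Lemma nrmE n (u : 'rV[R]_n) : 1 / 2 <= normsq u -> nrm u = (Num.sqrt (normsq u))^-1 *: u.
Proof. by move=> h; rewrite /nrm flat0 ?addr0 // subr_le0. Qed.

Lemma normsq_nrm n (u : 'rV[R]_n) : 1 / 2 <= normsq u -> normsq (nrm u) = 1.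
Proof.
move=> h; have n0 : 0 < normsq u by lra.
by rewrite nrmE // normsqZ exprVn sqr_sqrtr ?(ltW n0) // mulVf // gt_eqF.
Qed.

Lemma nrm_id n (u : 'rV[R]_n) : normsq u = 1 -> nrm u = u.
Proof. by move=> h; rewrite nrmE h ?sqrtr1 ?invr1 ?scale1r //; lra. Qed.

(** A retraction of a neighbourhood of the torus times the plane onto it. *)
Definition rho z := tri (nrm (U1 z)) (nrm (U2 z)) (W z).

Lemma smooth_rho : smooth rho.
Proof.
apply: smooth_tri; last exact: smooth_W.
  exact: smooth_comp (@smooth_U1 R) (@smooth_nrm 2).
exact: smooth_comp (@smooth_U2 R) (@smooth_nrm 2).
Qed.

Lemma rho_id z : T2R2 z -> rho z = z.
Proof. by case=> h1 h2; rewrite /rho !nrm_id // triK. Qed.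

Lemma T2R2_rho z : 1 / 2 <= normsq (U1 z) -> 1 / 2 <= normsq (U2 z) -> T2R2 (rho z).
Proof. by move=> h1 h2; split; rewrite /rho triE normsq_nrm. Qed.

Lemma near_rho z0 : T2R2 z0 -> \forall z \near z0, T2R2 (rho z).
Proof.
move=> [h1 h2].
have n1 : \forall z \near z0, 1 / 2 < normsq (U1 z).
  apply: (near_gt (f := fun z => normsq (U1 z))); last by rewrite h1; lra.
  by apply: smooth_normsq; exact: smooth_U1.
have n2 : \forall z \near z0, 1 / 2 < normsq (U2 z).
  apply: (near_gt (f := fun z => normsq (U2 z))); last by rewrite h2; lra.
  by apply: smooth_normsq; exact: smooth_U2.
by near=> z; apply: T2R2_rho; apply/ltW; near: z.
Unshelve. all: by end_near. Qed.

Section Target.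
Variables (n : nat) (X : set 'rV[R]_n) (g : 'rV[R]_(2 + 2 + 2) -> 'rV[R]_n)
  (q : 'rV[R]_n -> 'rV[R]_(2 + 2 + 2)).
Hypotheses (subX : submanifold 4 X) (Cg : smooth g) (Cq : smooth q)
  (Xg : forall z, T2D2 z -> X (g z)) (qg : forall z, T2D2 z -> q (g z) = z).

(** Although [g] maps into [X] only from [T2D2], its smooth left inverse gives
    coordinates of [X] on both sides of the boundary of the image. *)
Lemma local_q z0 : T2D2 z0 -> exists r : 'rV[R]_(2 + 2 + 2) -> 'rV[R]_n,
  [/\ smooth r, r z0 = g z0, \forall x \near g z0, X x -> r (rho (q x)) = x &
      \forall z \near z0, T2R2 z -> X (r z) /\ rho (q (r z)) = z].
Proof.
move=> Ez0; have [Tz0 _] := Ez0.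
have [c [l ch]] := chart_T2R2 Tz0.
have [c' [l' ch']] := submanifold_chart subX (Xg Ez0).
have [Cc' Cl' cl0' nc' nl'] := ch'.
pose g' z := c' (l' (g z)).
have Cg' : smooth g' by do 2 (apply: smooth_comp => //).
have g'0 : g' z0 = g z0 by [].
have nX : \forall z \near z0, X (g' z).
  apply: (near_comp (f := fun z => l' (g z)) (P := fun p => X (c' p))).
    exact: smooth_comp.
  by apply: filterS nc' => p [].
have ng : \forall z \near z0, T2D2 z -> g' z = g z.
  have h : \forall z \near z0, X (g z) -> c' (l' (g z)) = g z by exact: near_comp nl'.
  by apply: filterS h => z h /Xg; exact: h.
have st : stretch (@T2R2 R) z0 g'.
  apply: (fat_stretch ch Cg' Cq (fat_T2D2 Ez0)).
  by apply: filterS ng => z e Ez; rewrite e // qg.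
have [j [Cj j0 nj1 nj2]] : exists j : 'rV[R]_n -> 'rV[R]_(2 + 2 + 2),
    [/\ smooth j, j (g' z0) = z0, \forall z \near z0, T2R2 z -> j (g' z) = z &
        \forall w \near g' z0, X w -> T2R2 (j w) /\ g' (j w) = w].
  apply: (manifold_inverse ch _ Cg' _ st); first by rewrite g'0; exact: ch'.
  by apply: filterS nX => z h _.
rewrite g'0 in j0 nj2; pose kap z := rho (q (g' z)).
have Ckap : smooth kap.
  by apply: smooth_comp; [exact: smooth_comp|exact: smooth_rho].
have kap0 : kap z0 = z0 by rewrite /kap g'0 qg // rho_id.
have nkT : \forall z \near z0, T2R2 (kap z).
  apply: (near_comp (f := fun z => q (g' z)) (P := fun z => T2R2 (rho z))).
    exact: smooth_comp.
  by rewrite g'0 qg //; exact: near_rho.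
have nkE : \forall z \near z0, T2D2 z -> kap z = z.
  by apply: filterS ng => z e Ez; rewrite /kap e // qg // rho_id //; case: Ez.
have kst : stretch (@T2R2 R) z0 kap.
  exact: (fat_stretch ch Ckap (@smooth_id R _) (fat_T2D2 Ez0)).
have [i [Ci i0 ni1 ni2]] : exists i : 'rV[R]_(2 + 2 + 2) -> 'rV[R]_(2 + 2 + 2),
    [/\ smooth i, i (kap z0) = z0, \forall z \near z0, T2R2 z -> i (kap z) = z &
        \forall w \near kap z0, T2R2 w -> T2R2 (i w) /\ kap (i w) = w].
  apply: (manifold_inverse ch _ Ckap _ kst); first by rewrite kap0; exact: ch.
  by apply: filterS nkT => z h _.
rewrite kap0 in i0 ni2.
exists (fun z => g' (i z)); split.
- exact: smooth_comp.
- by rewrite i0.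
- have nji : \forall x \near g z0, T2R2 (j x) -> i (kap (j x)) = j x.
    by apply: (near_comp Cj (P := fun z => T2R2 z -> i (kap z) = z)); rewrite j0.
  near=> x => Xx; have [Tj ej] : T2R2 (j x) /\ g' (j x) = x by move: Xx; near: x.
  have e : i (kap (j x)) = j x by move: Tj; near: x.
  have -> : rho (q x) = kap (j x) by rewrite /kap ej.
  by rewrite e.
- have nXi : \forall z \near z0, X (g' (i z)).
    by apply: (near_comp Ci (P := fun z => X (g' z))); rewrite i0.
  near=> z => Tz; have [_ e] : T2R2 (i z) /\ kap (i z) = z by move: Tz; near: z.
  by split; [near: z|].
Unshelve. all: by end_near. Qed.

End Target.

End Collar.


Lemma closed_smooth_le n (R : realType) (f : 'rV[R]_n -> R) (c : R) :
  smooth f -> closed [set x | f x <= c].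
Proof.
move=> Cf; have -> : [set x | f x <= c] = ~` [set x | c < f x].
  by apply/seteqP; split => x /=; rewrite leNgt => /negP.
by apply: open_closedC; rewrite openE => x; exact: near_gt.
Qed.

Lemma compact_T2D2 (R : realType) : compact (@T2D2 R).
Proof.
have CU1 : smooth (fun z => normsq (@U1 R z)) by apply: smooth_normsq; exact: smooth_U1.
have CU2 : smooth (fun z => normsq (@U2 R z)) by apply: smooth_normsq; exact: smooth_U2.
apply: bounded_closed_compact.
  exists 1; split; first exact: num_real.
  move=> M hM z /= [[z1 z2] z3]; apply: le_trans (ltW hM).
  have le1 (u : 'rV[R]_2) j : normsq u <= 1 -> `|u 0 j| <= 1.
    move=> h; apply: le_trans (coord_le_norm u j) _.
    have h2 := le_trans (norm_le_normsq u) h.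
    by rewrite -(@ler_pXn2r _ 2) ?nnegrE // expr1n.
  apply: norm_le => // j; case: (split_ordP j) => i ->; last first.
    by have := le1 (W z) i z3; rewrite mxE.
  case: (split_ordP i) => l ->.
    by have := le1 (U1 z) l; rewrite z1 => /(_ (lexx _)); rewrite !mxE.
  by have := le1 (U2 z) l; rewrite z2 => /(_ (lexx _)); rewrite !mxE.
have -> : @T2D2 R = [set z | normsq (U1 z) <= 1] `&` [set z | - normsq (U1 z) <= -1] `&`
   ([set z | normsq (U2 z) <= 1] `&` [set z | - normsq (U2 z) <= -1]) `&` [set z | rad2 z <= 1].
  apply/seteqP; split=> z /=.
    by move=> [[-> ->] ->]; rewrite !lexx.
  move=> [[[a1 a2] [b1 b2]] c]; split=> //; rewrite !lerN2 in a2 b2.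
  by split; apply/eqP; rewrite eq_le ?a1 ?b1.
have CN f : smooth f -> smooth (fun z : 'rV[R]_(2 + 2 + 2) => - f z : R) by exact: smoothN.
apply: closedI; last exact: closed_smooth_le (@smooth_rad2 R).
by apply: closedI; (apply: closedI; first exact: closed_smooth_le); apply: closed_smooth_le; exact: CN.
Qed.

(** * Uniqueness of the gluing *)

Section Gluing.
Variables (R : realType) (m n : nat) (S : set 'rV[R]_m) (X : set 'rV[R]_n)
  (T : 'rV[R]_(2 + 2 + 2) -> 'rV[R]_m) (k : 'rV[R]_m -> 'rV[R]_(2 + 2 + 2))
  (g : 'rV[R]_(2 + 2 + 2) -> 'rV[R]_n) (q : 'rV[R]_n -> 'rV[R]_(2 + 2 + 2))
  (b : 'rV[R]_m -> 'rV[R]_n) (bi : 'rV[R]_n -> 'rV[R]_m).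
Local Notation N := (outer S T).
Local Notation E := (@T2D2 R).
Hypotheses (subS : submanifold 4 S) (cS : compact S) (subX : submanifold 4 X)
  (CT : smooth T) (Ck : smooth k) (Cg : smooth g) (Cq : smooth q)
  (Cb : smooth b) (Cbi : smooth bi)
  (nS : forall z0, E z0 -> \forall z \near z0, S (T z))
  (kT : forall z, E z -> k (T z) = z)
  (Xg : forall z, E z -> X (g z)) (qg : forall z, E z -> q (g z) = z)
  (Xb : forall x, N x -> X (b x)) (bib : forall x, N x -> bi (b x) = x)
  (gb : forall z, E z -> rad2 z = 1 -> g z = b (T z))
  (inter : forall z x, E z -> N x -> g z = b x -> rad2 z = 1)
  (cover : forall y, X y -> (exists2 z, E z & g z = y) \/ (exists2 x, N x & b x = y)).
Implicit Types (z : 'rV[R]_(2 + 2 + 2)) (Y : 'rV[R]_4).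

Let localT z0 := local_T subS CT Ck nS kT (z0 := z0).
Let localq z0 := local_q subX Cg Cq Xg qg (z0 := z0).
Let rim_outer z := T2D2_outer nS kT (z := z).
Let outside z0 := outside_T subS CT Ck nS kT (z0 := z0).

(** The map [b] of the outside, read in the coordinates [T] of [S] and the
    coordinates [rho o q] of [X]. *)
Definition transition z := rho (q (b (T z))).
Local Notation phi := transition.

Lemma smooth_transition : smooth phi.
Proof.
apply: smooth_comp; last exact: smooth_rho.
by do 2 (apply: smooth_comp => //).
Qed.

Lemma transition_id z : T2R2 z -> rad2 z = 1 -> phi z = z.
Proof.
move=> Tz rz; have Ez : E z by split=> //; rewrite rz.
by rewrite /phi -gb // qg // rho_id.
Qed.

(** [q o b o T] is the identity on the boundary, and by periodicity its distance
    to the identity is controlled uniformly along the compact boundary. *)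
Lemma transition_T2R2 : exists2 d : R, 0 < d &
  forall Y, `|Y 0 (i4 3)| < d -> T2R2 (phi (pol Y)).
Proof.
pose P Y := q (b (T (pol Y))).
have CP : smooth P.
  by do 2 (apply: smooth_comp => //); exact: smooth_comp (@smooth_pol R) CT.
have Pi : polinv P by move=> Y Y' e; rewrite /P e.
pose f Y := row2 (normsq (U1 (P Y)) - 1) (normsq (U2 (P Y)) - 1).
have [|||C C0 hC] := @polinv_tube R 2 f.
- apply: smooth_row2; apply: smoothB; try exact: smooth_cst.
    by apply: smooth_normsq; exact: smooth_comp CP (@smooth_U1 R).
  by apply: smooth_normsq; exact: smooth_comp CP (@smooth_U2 R).
- by move=> Y Y' e; rewrite /f (Pi _ _ e).
- move=> Y Y3; have rY : rad2 (pol Y) = 1 by rewrite rad2_pol Y3 mulr0 oppr0 expR0.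
  have Ez : E (pol Y) by split; [exact: T2R2_pol|rewrite rY].
  have [h1 h2] := T2R2_pol Y.
  by rewrite /f /P -gb // qg // h1 h2 subrr; apply: row2P; rewrite row2E mxE.
exists (Num.min 1 (1 / 2 / C)); first by rewrite lt_min ltr01 !divr_gt0.
move=> Y; rewrite lt_min => /andP[Y1 Y2].
have hY : C * `|Y 0 (i4 3)| < 1 / 2 by rewrite ltr_pdivlMr // mulrC in Y2.
have fY := le_lt_trans (hC Y (ltW Y1)) hY.
have := le_lt_trans (coord_le_norm (f Y) 0) fY; have := le_lt_trans (coord_le_norm (f Y) 1) fY.
by rewrite !row2E !ltr_norml => h1 h2; apply: T2R2_rho; rewrite -/(P Y); lra.
Qed.

(** On the outer side the transition map is a composition of one-to-one maps
    with smooth inverses, and its values meet the inside at most on the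
    boundary, as the images of [b] and [g] do. *)
Lemma transition_inverse z0 : E z0 -> rad2 z0 = 1 ->
  exists2 h : 'rV[R]_(2 + 2 + 2) -> 'rV[R]_(2 + 2 + 2), smooth h &
  \forall z \near z0, T2R2 z -> 1 <= rad2 z ->
     h (phi z) = z /\ (E (phi z) -> rad2 (phi z) = 1).
Proof.
move=> Ez0 rz0; have [t [Ct t0 nt1 nt2]] := localT Ez0.
have [r [Cr r0 nr1 nr2]] := localq Ez0.
have phi0 : phi z0 = z0 by apply: transition_id => //; case: Ez0.
exists (fun z => t (bi (r z))); first by do 2 (apply: smooth_comp => //).
have nr1' : \forall z \near z0, X (b (T z)) -> r (phi z) = b (T z).
  apply: (near_comp (f := fun z => b (T z)) (P := fun x => X x -> r (rho (q x)) = x)).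
    exact: smooth_comp.
  by rewrite -gb.
have nr3 : \forall z \near z0, X (g (phi z)) -> r (rho (q (g (phi z)))) = g (phi z).
  apply: (near_comp (f := fun z => g (phi z)) (P := fun x => X x -> r (rho (q x)) = x)).
    by apply: smooth_comp => //; exact: smooth_transition.
  by rewrite phi0.
have nout := outside Ez0.
near=> z => Tz rz; have Nz : N (T z) by move: Tz rz; near: z.
have XbT := Xb Nz.
have er : r (phi z) = b (T z) by move: XbT; near: z.
split; first by rewrite er bib //; move: Tz; near: z.
move=> Ep; have Xp := Xg Ep.
have e : r (rho (q (g (phi z)))) = g (phi z) by move: Xp; near: z.
rewrite qg // rho_id in e; last by case: Ep.
by apply: (inter Ep Nz); rewrite -e er.
Unshelve. all: by end_near. Qed.

(** Points outside are sent outside: otherwise [b] and [g] would have a common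
    value away from the boundary. *)
Lemma transition_outside z0 : E z0 -> rad2 z0 = 1 ->
  \forall z \near z0, T2R2 z -> T2R2 (phi z) -> 1 < rad2 z -> 1 < rad2 (phi z).
Proof.
move=> Ez0 rz0; have [h Ch nh] := transition_inverse Ez0 rz0.
have phi0 : phi z0 = z0 by apply: transition_id => //; case: Ez0.
have nh2 : \forall z \near z0, T2R2 (phi z) -> 1 <= rad2 (phi z) ->
     h (phi (phi z)) = phi z /\ (E (phi (phi z)) -> rad2 (phi (phi z)) = 1).
  apply: (near_comp smooth_transition
    (P := fun z => T2R2 z -> 1 <= rad2 z -> h (phi z) = z /\ (E (phi z) -> rad2 (phi z) = 1))).
  by rewrite phi0.
near=> z => Tz Tp rz; rewrite ltNge; apply/negP => rp.
have Ep : E (phi z) by [].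
have [hz /(_ Ep) rp1] : h (phi z) = z /\ (E (phi z) -> rad2 (phi z) = 1).
  by move: Tz (ltW rz); near: z.
have [] : h (phi (phi z)) = phi z /\ (E (phi (phi z)) -> rad2 (phi (phi z)) = 1).
  have rp2 : 1 <= rad2 (phi z) by rewrite rp1.
  by move: Tp rp2; near: z.
rewrite (transition_id Tp rp1) hz => e _.
by move: rz; rewrite {1}e rp1 ltxx.
Unshelve. all: by end_near. Qed.

(** The transition map does not lose the collar: a point [z] outside is compared
    with the boundary point [pr (phi z)], which [phi] fixes.  Since [phi] has a
    Lipschitz inverse there, the distance of [z] to the boundary is at most a
    multiple of that of [phi z]. *)
Lemma transition_derive Y : Y 0 (i4 3) = 0 ->
  'D_(delta_mx 0 (i4 3)) (fun Y => rad2 (phi (pol Y))) Y < 0.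
Proof.
move=> Y3; pose e3 : 'rV[R]_4 := delta_mx 0 (i4 3); pose z0 := pol Y.
have Tz0 : T2R2 z0 by exact: T2R2_pol.
have rz0 : rad2 z0 = 1 by rewrite rad2_pol Y3 mulr0 oppr0 expR0.
have Ez0 : E z0 by split=> //; rewrite rz0.
have phi0 : phi z0 = z0 by exact: transition_id.
have [h Ch nh] := transition_inverse Ez0 rz0.
have nout := transition_outside Ez0 rz0.
have [K [rK [K0 rK0 hK]]] := smooth_lipschitz z0 Ch.
pose rd z : 'rV[R]_1 := (rad2 z)%:M.
have rd00 z : rd z 0 0 = rad2 z by rewrite mxE eqxx mulr1n.
have Crd : smooth rd.
  apply: smooth_row => j; rewrite (ord1 j) (_ : (fun _ => _) = @rad2 R); first exact: smooth_rad2.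
  by apply/funext => z; rewrite rd00.
have [L [rL [L0 rL0 hL]]] := smooth_lipschitz z0 Crd.
pose pr z := tri (U1 z) (U2 z) (nrm (W z)).
have Cpr : smooth pr.
  apply: smooth_tri; [exact: smooth_U1|exact: smooth_U2|].
  exact: smooth_comp (@smooth_W R) (@smooth_nrm R 2).
have pr0 : pr z0 = z0 by rewrite /pr nrm_id // triK.
have [d d0 hd] := transition_T2R2.
have npr : \forall z \near z0, `|pr (phi z) - z0| < Num.min rK rL.
  apply: (near_comp (f := fun z => pr (phi z)) (P := fun w => `|w - z0| < Num.min rK rL)).
    exact: smooth_comp smooth_transition Cpr.
  by rewrite phi0 pr0; apply: near_dist; rewrite lt_min rK0.
have nphi : \forall z \near z0, `|phi z - z0| < rK.
  apply: (near_comp smooth_transition (P := fun w => `|w - z0| < rK)).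
  by rewrite phi0; exact: near_dist.
have nhp : \forall z \near z0, T2R2 (pr (phi z)) -> 1 <= rad2 (pr (phi z)) ->
    h (phi (pr (phi z))) = pr (phi z) /\ (E (phi (pr (phi z))) -> rad2 (phi (pr (phi z))) = 1).
  apply: (near_comp (f := fun z => pr (phi z))
    (P := fun z => T2R2 z -> 1 <= rad2 z -> h (phi z) = z /\ (E (phi z) -> rad2 (phi z) = 1))).
    exact: smooth_comp smooth_transition Cpr.
  by rewrite phi0 pr0.
have nL : \forall z \near z0, `|z - z0| < rL by exact: near_dist.
pose c := 2 / (L * K).
have c0 : 0 < c by rewrite divr_gt0 // mulr_gt0.
have main : \forall z \near z0, T2R2 z -> T2R2 (phi z) -> 1 < rad2 z ->
    rad2 z - 1 <= L * K * (rad2 (phi z) - 1).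
  near=> z => Tz Tp rz.
  have rp : 1 < rad2 (phi z) by move: Tz Tp rz; near: z.
  have rw : normsq (W (pr (phi z))) = 1.
    by rewrite /pr triE normsq_nrm // -/(rad2 (phi z)); lra.
  have Tpr : T2R2 (pr (phi z)) by case: Tp => h1 h2; split; rewrite /pr triE.
  have phpr : phi (pr (phi z)) = pr (phi z) by exact: transition_id.
  have [hz _] : h (phi z) = z /\ (E (phi z) -> rad2 (phi z) = 1).
    by move: Tz (ltW rz); near: z.
  have [hpr _] : h (phi (pr (phi z))) = pr (phi z) /\
      (E (phi (pr (phi z))) -> rad2 (phi (pr (phi z))) = 1).
    have rpr : 1 <= rad2 (pr (phi z)) by rewrite /rad2 rw.
    by move: Tpr rpr; near: z.
  have : `|pr (phi z) - z0| < Num.min rK rL by near: z.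
  rewrite lt_min => /andP[pK pL].
  have pz : `|phi z - z0| < rK by near: z.
  have h1 := hK _ _ pz pK; rewrite phpr in hpr; rewrite hz hpr in h1.
  have zL : `|z - z0| < rL by near: z.
  have h2 := le_trans (coord_le_norm (rd z - rd (pr (phi z))) 0) (hL _ _ zL pL).
  have e2 : (rd z - rd (pr (phi z))) 0 0 = rad2 z - 1.
    by rewrite !mxE !eqxx !mulr1n; congr (_ - _).
  rewrite e2 gtr0_norm ?subr_gt0 // in h2.
  apply: le_trans h2 _; rewrite -mulrA ler_pM2l //; apply: le_trans h1 _.
  rewrite ler_pM2l //.
  set w := W (phi z); pose s := Num.sqrt (rad2 (phi z)).
  have s1 : 1 < s by rewrite -sqrtr1 ltr_sqrt // (lt_trans ltr01).
  have ss : s ^+ 2 = rad2 (phi z) by rewrite sqr_sqrtr //; apply/ltW/(lt_trans ltr01).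
  have dE : phi z - pr (phi z) = tri 0 0 ((1 - s^-1) *: w).
    rewrite -[X in X - _]triK /pr nrmE -/(rad2 (phi z)) -/s; last by lra.
    rewrite /tri !opp_row_mx !add_row_mx !subrr.
    by congr (row_mx _ _); rewrite scalerBl scale1r.
  have sV : s^-1 < 1 by rewrite invf_lt1 // (lt_trans ltr01).
  have wS (i : 'I_2) : `|w 0 i| <= s.
    apply: le_trans (coord_le_norm w i) _.
    have := norm_le_normsq w; rewrite -/(rad2 (phi z)) -ss.
    by rewrite ler_pXn2r ?nnegrE // ltW // (lt_trans ltr01).
  rewrite dE -ss; apply: norm_le => [|j]; first by rewrite subr_ge0 exprn_ege1 // ltW.
  rewrite /tri; case: (split_ordP j) => i ->.
    rewrite row_mxEl; case: (split_ordP i) => l ->.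
      by rewrite row_mxEl mxE normr0 subr_ge0 exprn_ege1 // ltW.
    by rewrite row_mxEr mxE normr0 subr_ge0 exprn_ege1 // ltW.
  rewrite row_mxEr mxE normrM gtr0_norm ?subr_gt0 //.
  apply: (@le_trans _ _ ((1 - s^-1) * s)); first by rewrite ler_wpM2l // subr_ge0 ltW.
  rewrite mulrBl mulVf ?mul1r; last by rewrite gt_eqF // (lt_trans ltr01).
  nra.
pose f Y := rad2 (phi (pol Y)).
have Cf : smooth f.
  apply: smooth_comp_row; last exact: smooth_rad2.
  by apply: smooth_comp; [exact: smooth_pol|exact: smooth_transition].
have f0 : f Y = 1 by rewrite /f -/z0 phi0.
suff : 'D_e3 f Y <= - c by move=> hc; apply: le_lt_trans hc _; rewrite oppr_lt0.
have Ls : \forall s \near (0 : R)^'-, s^-1 *: (f (s *: e3 + Y) - f Y) <= - c.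
  have nY : \forall Y' \near Y, T2R2 (pol Y') -> T2R2 (phi (pol Y')) -> 1 < rad2 (pol Y') ->
      rad2 (pol Y') - 1 <= L * K * (rad2 (phi (pol Y')) - 1).
    exact: (near_comp (@smooth_pol R) main).
  have [t t0 ht] := dist_near nY.
  have td : 0 < Num.min t d by rewrite lt_min t0.
  near=> s.
  have s0 : s < 0 by near: s; exact: nbhs_left_lt.
  have st : - Num.min t d < s by near: s; apply: nbhs_left_gt; rewrite oppr_lt0.
  have ns : `|s| < Num.min t d by rewrite ltr0_norm // ltrNl.
  move: ns; rewrite lt_min => /andP[nst nsd].
  have Y's : (s *: e3 + Y) 0 (i4 3) = s by rewrite !mxE !eqxx Y3 mulr1 addr0.
  have : `|s *: e3 + Y - Y| < t.
    rewrite addrK; apply: le_lt_trans nst; apply: norm_le => // j.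
    by rewrite !mxE normrM -[leRHS]mulr1 ler_wpM2l //; case: (_ && _); rewrite /= ?normr1 ?normr0.
  move=> /ht /(_ (T2R2_pol _)); rewrite -/(f _) => H.
  have Tp : T2R2 (phi (pol (s *: e3 + Y))) by apply: hd; rewrite Y's.
  have rs : 1 - 2 * s <= rad2 (pol (s *: e3 + Y)).
    by rewrite rad2_pol Y's; have := expR_ge1Dx (- (2 * s)); lra.
  have rs1 : 1 < rad2 (pol (s *: e3 + Y)) by lra.
  have {}H := H Tp rs1.
  rewrite f0 /GRing.scale /= ler_ndivrMl //.
  have -> : s * - c = - (2 * s) / (L * K) by rewrite /c; field; rewrite !gt_eqF.
  rewrite ler_pdivrMr ?mulr_gt0 // [leRHS]mulrC; apply: le_trans H; lra.
have df : derivable f Y e3 by apply: diff_derivable; exact: smooth_differentiable.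
have cvl : s^-1 *: (f (s *: e3 + Y) - f Y) @[s --> (0 : R)^'-] --> 'D_e3 f Y.
  exact: cvg_dnbhs_at_left df.
by apply: (cvgr_to_le cvl Ls).
Unshelve. all: by end_near. Qed.

(** The map [F] that is [b] outside and [g o T^-1] on the image of [T] is a
    bijection from [S] to [X], but in general it is not differentiable along the
    boundary.  Correct it by the diffeomorphism [G] of [T2D2] obtained from the
    transition map by [torus_blend]: let [F] be [g o G o T^-1] there.  Near the
    boundary [G] is the transition map, so on both sides [F] is [r o rho o q o b]
    for the local inverse [r] of the coordinates [rho o q], which is smooth.  In
    the same way the inverse map [H] is [T o G^-1 o rho o q] near the
    boundary. *)
Lemma glued_diffeomorphic : diffeomorphic X S.
Proof.
have [d d0 hd] := transition_T2R2.
have [G [G' [sG sG' hG rG nG]]] := torus_blend smooth_transition transition_id d0 hd transition_derive.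
pose D := T @` E; pose gE := g @` E; pose bN := b @` N.
have cE := @compact_T2D2 R.
have cimg p l (A : set 'rV[R]_p) (f : 'rV[R]_p -> 'rV[R]_l) : compact A -> smooth f -> compact (f @` A).
  by move=> cA Cf; apply: continuous_compact => //; exact: continuous_subspaceT (smooth_continuous Cf).
have cD : compact D by exact: cimg.
have cgE : compact gE by exact: cimg.
have cN : compact N by exact: compact_outer subS CT Ck nS kT cS.
have cbN : compact bN by exact: cimg.
have EG z : E z -> E (G z).
  by move=> [Tz rz]; have [TG _ _ _] := hG z Tz; split=> //; rewrite rG.
have EG' z : E z -> E (G' z).
  by move=> [Tz rz]; have [_ TG' _ e] := hG z Tz; split=> //; rewrite -rG // e.
have G1 z : T2R2 z -> rad2 z = 1 -> G z = z.
  move=> Tz rz; have h := nbhs_singleton (nG z Tz rz).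
  by rewrite h // transition_id.
have DS x : D x -> S x by case=> z Ez <-; exact: nbhs_singleton (nS Ez).
have DN x : D x -> N x -> E (k x) /\ rad2 (k x) = 1 /\ T (k x) = x.
  move=> [z Ez <-] [_ nx]; rewrite kT //; split=> //; split=> //.
  apply/eqP; rewrite eq_le; have [Tz ->] := Ez; rewrite leNgt; apply/negP => rz.
  by apply: nx; exists z.
have SDN x : S x -> D x \/ N x.
  move=> Sx; have [Dx|nDx] := pselect (D x); [by left|right; split=> //].
  by move=> [z [Tz rz e]]; apply: nDx; exists z => //; split=> //; exact: ltW.
pose F x := if `[< D x >] then g (G (k x)) else b x.
pose H y := if `[< gE y >] then T (G' (q y)) else bi y.
have FD z : E z -> F (T z) = g (G z).
  by move=> Ez; rewrite /F; case: asboolP => [Dx|nD]; [rewrite kT|case: nD; exists z].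
have FN x : N x -> F x = b x.
  move=> Nx; rewrite /F; case: asboolP => // Dx; have [Ek [rk e]] := DN x Dx Nx.
  by rewrite G1 //; [rewrite gb // e|case: Ek].
have HE z : E z -> H (g z) = T (G' z).
  by move=> Ez; rewrite /H; case: asboolP => [gz|ng]; [rewrite qg|case: ng; exists z].
have HN x : N x -> H (b x) = x.
  move=> Nx; rewrite /H; case: asboolP => [gx|ng]; last exact: bib.
  have [z Ez e] := gx.
  have rz := inter Ez Nx e; have [Tz _] := Ez.
  have [_ _ e2 _] := hG z Tz; rewrite G1 // in e2.
  by rewrite -e qg // e2 -(bib Nx) -e gb // bib //; exact: rim_outer.
have G'1 z : T2R2 z -> rad2 z = 1 -> G' z = z.
  by move=> Tz rz; have [_ _ + _] := hG z Tz; rewrite G1.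
have FS x : S x -> X (F x).
  case/SDN => [[z Ez <-]|Nx]; first by rewrite FD //; apply: Xg; exact: EG.
  by rewrite FN //; exact: Xb.
have HX y : X y -> S (H y).
  case/cover => [[z Ez <-]|[x Nx <-]]; last by rewrite HN //; case: Nx.
  by rewrite HE //; apply: DS; exists (G' z) => //; exact: EG'.
have FH y : X y -> F (H y) = y.
  case/cover => [[z Ez <-]|[x Nx <-]]; last by rewrite HN // FN.
  rewrite HE // FD; last exact: EG'.
  by have [Tz _] := Ez; have [_ _ _ ->] := hG z Tz.
have HF x : S x -> H (F x) = x.
  case/SDN => [[z Ez <-]|Nx]; last by rewrite FN // HN.
  rewrite FD // HE; last exact: EG.
  by have [Tz _] := Ez; have [_ _ -> _] := hG z Tz.
exists H; split.
- apply: near_smooth_on => y0 Xy0.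
  have [[z0 Ez0 e0]|ngE] := pselect (gE y0); last first.
    exists bi; split=> //; have nn := compact_far cgE ngE.
    near=> y => Xy; have ny : ~ gE y by near: y.
    by rewrite /H; case: asboolP.
  have [Tz0 rz0] := Ez0.
  have [G1' [CG1 nG1]] := smooth_on_nearE sG' Tz0.
  have nGq : \forall y \near y0, T2R2 (q y) -> G' (q y) = G1' (q y).
    by apply: (near_comp Cq (P := fun z => T2R2 z -> G' z = G1' z)); rewrite -e0 qg.
  move: rz0; rewrite le_eqVlt => /orP[/eqP rz1|rz1]; last first.
    have nbN : ~ bN y0.
      by move=> [x Nx e]; have := inter Ez0 Nx; rewrite e0 e => /(_ erefl) rz; rewrite rz ltxx in rz1.
    exists (fun y => T (G1' (q y))); split.
      by apply: smooth_comp => //; exact: smooth_comp.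
    have nn := compact_far cbN nbN.
    near=> y => Xy; have ny : ~ bN y by near: y.
    case: (cover Xy) => [[z Ez ez]|[x Nx ex]]; last by case: ny; exists x.
    rewrite -ez HE // qg //; have e : T2R2 (q y) -> G' (q y) = G1' (q y) by near: y.
    by rewrite -ez qg // in e; rewrite e //; case: Ez.
  have ez0 : y0 = b (T z0) by rewrite -e0 gb.
  have Nz0 : N (T z0) by exact: rim_outer.
  have [h [Ch h0 nh1 nh2]] := localT Ez0.
  pose Q y := rho (q y); have CQ : smooth Q by apply: smooth_comp => //; exact: smooth_rho.
  have Q0 : Q y0 = z0 by rewrite /Q -e0 qg // rho_id.
  exists (fun y => T (G1' (Q y))); split.
    by apply: smooth_comp => //; exact: smooth_comp.
  have nGQ : \forall y \near y0, T2R2 (Q y) -> G' (Q y) = G1' (Q y).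
    by apply: (near_comp CQ (P := fun z => T2R2 z -> G' z = G1' z)); rewrite Q0.
  have bi0 : bi y0 = T z0 by rewrite ez0 bib.
  have nb1 : \forall y \near y0, S (bi y) -> T2R2 (h (bi y)) /\ T (h (bi y)) = bi y.
    apply: (near_comp Cbi (P := fun w => S w -> T2R2 (h w) /\ T (h w) = w)).
    by rewrite bi0.
  have nb2 : \forall y \near y0, T2R2 (h (bi y)) -> G (h (bi y)) = phi (h (bi y)).
    apply: (near_comp (f := fun y => h (bi y)) (P := fun z => T2R2 z -> G z = phi z)).
      exact: smooth_comp.
    by rewrite bi0 h0; exact: nG.
  near=> y => Xy; have eG : T2R2 (Q y) -> G' (Q y) = G1' (Q y) by near: y.
  case: (cover Xy) => [[z Ez ez]|[x Nx ex]].
    have [Tz _] := Ez; have Qy : Q y = z by rewrite /Q -ez qg // rho_id.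
    by rewrite Qy in eG *; rewrite -ez HE // eG.
  have bx : bi y = x by rewrite -ex bib.
  have Sx : S x by case: Nx.
  have [Th eh] : T2R2 (h (bi y)) /\ T (h (bi y)) = bi y.
    by have Sb : S (bi y); [rewrite bx|move: Sb; near: y].
  have Gh : G (h (bi y)) = phi (h (bi y)) by move: Th; near: y.
  have Qy : Q y = G (h (bi y)) by rewrite Gh /phi eh bx /Q ex.
  have [TGh _ G'G _] := hG _ Th.
  by rewrite -eG Qy // G'G eh bx -ex HN.
- apply/seteqP; split=> [_ [y Xy <-]|x Sx]; first exact: HX.
  by exists (F x); [exact: FS|exact: HF].
exists F; split=> //.
apply: near_smooth_on => x0 Sx0.
have [[z0 Ez0 e0]|nD] := pselect (D x0); last first.
  exists b; split=> //; have nn := compact_far cD nD.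
  near=> x => Sx; have nx : ~ D x by near: x.
  by rewrite /F; case: asboolP.
have [Tz0 rz0] := Ez0.
have [G1' [CG1 nG1]] := smooth_on_nearE sG Tz0.
have nGk : \forall x \near x0, T2R2 (k x) -> G (k x) = G1' (k x).
  by apply: (near_comp Ck (P := fun z => T2R2 z -> G z = G1' z)); rewrite -e0 kT.
move: rz0; rewrite le_eqVlt => /orP[/eqP rz1|rz1]; last first.
  exists (fun x => g (G1' (k x))); split.
    by apply: smooth_comp => //; exact: smooth_comp.
  have nn := open_T subS CT Ck nS kT Tz0 rz1; rewrite e0 in nn.
  near=> x => Sx; have [z [Tz rz ez]] : exists z, [/\ T2R2 z, rad2 z < 1 & T z = x].
    by move: Sx; near: x.
  have Ez : E z by split=> //; exact: ltW.
  have e : T2R2 (k x) -> G (k x) = G1' (k x) by near: x.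
  by rewrite -ez kT // in e *; rewrite FD // e.
have [r [Cr r0 nr1 nr2]] := localq Ez0.
exists (fun x => r (rho (q (b x)))); split.
  apply: smooth_comp => //; apply: smooth_comp; last exact: smooth_rho.
  exact: smooth_comp.
have ez0 : b x0 = g z0 by rewrite -e0 gb.
have nb : \forall x \near x0, X (b x) -> r (rho (q (b x))) = b x.
  by apply: (near_comp Cb (P := fun y => X y -> r (rho (q y)) = y)); rewrite ez0.
have ng : \forall x \near x0, X (g (phi (k x))) ->
    r (rho (q (g (phi (k x))))) = g (phi (k x)).
  apply: (near_comp (f := fun x => g (phi (k x))) (P := fun y => X y -> r (rho (q y)) = y)).
    by apply: smooth_comp => //; apply: smooth_comp => //; exact: smooth_transition.
  by rewrite -e0 kT // transition_id.
have nGp : \forall x \near x0, T2R2 (k x) -> G (k x) = phi (k x).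
  apply: (near_comp Ck (P := fun z => T2R2 z -> G z = phi z)).
  by rewrite -e0 kT //; exact: nG.
near=> x => Sx; case: (SDN _ Sx) => [[z Ez ez]|Nx]; last first.
  rewrite FN //; have Xbx := Xb Nx.
  by have e : r (rho (q (b x))) = b x by [move: Xbx; near: x]; rewrite e.
have [Tz _] := Ez; have kx : k x = z by rewrite -ez kT.
have Gz : T2R2 (k x) -> G (k x) = phi (k x) by near: x.
rewrite kx in Gz; have {}Gz := Gz Tz.
have Xg' : X (g (phi (k x))) by rewrite kx -Gz; apply: Xg; exact: EG.
have e : r (rho (q (g (phi (k x))))) = g (phi (k x)) by move: Xg'; near: x.
rewrite kx -Gz qg in e; last exact: EG.
have [TG _ _ _] := hG z Tz.
rewrite rho_id // in e.
by rewrite -ez FD // -/(phi z) -Gz e.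
Unshelve. all: by end_near. Qed.

End Gluing.


(** * The 4-sphere *)

Section Sphere.
Variable R : realType.

Lemma normsq_lift d (i : 'I_d.+1) (y : 'rV[R]_d.+1) :
  normsq y = y 0 i ^+ 2 + normsq (\row_j y 0 (lift i j)).
Proof.
rewrite /normsq (bigD1_ord i) //=; congr (_ + _).
by apply: eq_bigr => j _; rewrite mxE.
Qed.

(** Each open hemisphere about a coordinate axis is a graph over the ball. *)
Lemma sphere_submanifold d : submanifold d (sphere R d.+1).
Proof.
move=> x Sx.
have [i xi] : exists i, x 0 i != 0.
  apply: contrapT => h; have x0 : x = 0.
    apply/rowP => i; rewrite mxE; apply/eqP/negPn/negP => xi.
    by apply: h; exists i.
  move: Sx; rewrite /sphere /= x0 /normsq big1 => [/eqP|j _]; last by rewrite mxE expr0n.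
  by rewrite eq_sym oner_eq0.
pose s := Num.sg (x 0 i).
have ss : s * s = 1 by rewrite -expr2 sqr_sg xi.
pose f (y : 'rV[R]_d.+1) : 'rV[R]_d := \row_j y 0 (lift i j).
pose g (p : 'rV[R]_d) : 'rV[R]_d.+1 :=
  \row_j (if unlift i j is Some k then p 0 k else s * Num.sqrt (1 - normsq p)).
have gi p : g p 0 i = s * Num.sqrt (1 - normsq p) by rewrite mxE unlift_none.
have gl p j : g p 0 (lift i j) = p 0 j by rewrite mxE liftK.
have fg p : f (g p) = p by apply/rowP => j; rewrite mxE gl.
pose U := [set y : 'rV[R]_d.+1 | 0 < s * y 0 i].
pose P := [set p : 'rV[R]_d | normsq p < 1].
have Cn : smooth (fun p : 'rV[R]_d => normsq p) by apply: smooth_normsq; exact: smooth_id.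
have oP : open P by rewrite openE => p; exact: near_lt.
have Cf : smooth f.
  apply: smooth_row => j; rewrite (_ : (fun _ => _) = fun y : 'rV[R]_d.+1 => y 0 (lift i j)).
    by apply: smooth_coord; exact: smooth_id.
  by apply/funext => y; rewrite mxE.
have CU : smooth (fun y : 'rV[R]_d.+1 => s * y 0 i).
  by apply: smoothM; [exact: smooth_cst|apply: smooth_coord; exact: smooth_id].
exists U, P; split => //.
- by rewrite openE => y; exact: near_gt.
- by rewrite /U /s /= -normrEsg normr_gt0.
exists f; split; first exact: smooth_on_global.
  apply/seteqP; split=> [_ [y [Sy Uy] <-]|p Pp].
    have := normsq_lift i y; rewrite (Sy : normsq y = 1) /P /= => e.
    have : 0 < y 0 i ^+ 2.
      by rewrite exprn_even_gt0 //=; apply: contraTneq Uy => h; rewrite /U /= h mulr0 ltxx.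
    by rewrite {1}e; lra.
  have q0 : 0 < 1 - normsq p by rewrite subr_gt0.
  exists (g p) => //; split.
    rewrite /sphere /= (normsq_lift i) -/(f (g p)) fg gi exprMn sqr_sqrtr ?(ltW q0) //.
    by rewrite expr2 ss mul1r subrK.
  by rewrite /U /= gi mulrA ss mul1r sqrtr_gt0.
exists g; split.
  move=> p Pp; exists P, g; split=> // k; apply: Ck_row => // j.
  case: (unliftP i j) => [l ->|->].
    have C : Ck k P (fun p : 'rV[R]_d => p 0 l : R).
      by apply: Ck_coord => //; exact: Ck_sub (@smooth_id R d k).
    by apply: (Ck_eq oP _ C) => q _; rewrite gl.
  suff C : Ck k P (fun p : 'rV[R]_d => s * Num.sqrt (1 - normsq p) : R).
    by apply: (Ck_eq oP _ C) => q _; rewrite gi.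
  apply: CkM => //; first exact: Ck_cst.
  apply: (Ck_comp_scal oP _ _ (@Cinf_sqrt R k)); first by move=> q Pq /=; rewrite subr_gt0.
  by apply: CkB => //; [exact: Ck_cst|exact: Ck_sub (Cn k)].
move=> y [Sy Uy]; apply/rowP => j; have e := normsq_lift i y.
rewrite (Sy : normsq y = 1) -/(f y) in e.
case: (unliftP i j) => [l ->|->]; first by rewrite gl mxE.
rewrite gi (_ : 1 - normsq (f y) = y 0 i ^+ 2); last by rewrite {1}e; ring.
have s1 : `|s| = 1 by rewrite /s normr_sg xi.
rewrite sqrtr_sqr -[`|_|]mul1r -s1 -normrM (gtr0_norm Uy).
by rewrite mulrA ss mul1r.
Qed.

Lemma compact_sphere d : compact (sphere R d).
Proof.
have Cn : smooth (fun p : 'rV[R]_d => normsq p) by apply: smooth_normsq; exact: smooth_id.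
apply: bounded_closed_compact.
  exists 1; split; first exact: num_real.
  move=> M hM x /= Sx; apply: le_trans (ltW hM).
  have := norm_le_normsq x; rewrite (Sx : normsq x = 1) => h.
  by rewrite -(@ler_pXn2r _ 2) ?nnegrE // expr1n.
have -> : sphere R d = [set x | normsq x <= 1] `&` [set x | - normsq x <= -1].
  apply/seteqP; split=> x /=; first by rewrite /sphere /= => ->; rewrite !lexx.
  by move=> [h1 h2]; apply/eqP; rewrite eq_le h1; rewrite lerN2 in h2.
exact: closedI (closed_smooth_le Cn) (closed_smooth_le (smoothN Cn)).
Qed.

End Sphere.

Section Uniqueness.
Variable R : realType.
Local Notation solid := (rprod (torus R) (cball R 2)).
Local Notation rim := (rprod (torus R) (sphere R 2)).

Lemma embedding_inverse m n (A : set 'rV[R]_m) (f : 'rV[R]_m -> 'rV[R]_n) :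
  compact A -> embedding A f ->
  exists f1 fi, [/\ smooth f1, smooth fi, forall x, A x -> f x = f1 x &
     forall x, A x -> fi (f x) = x].
Proof.
move=> cA [sf _ [h [sh hf]]].
have [f1 Cf1 ff1] := smooth_extension cA sf.
have [fi Cfi hfi] := smooth_extension (smooth_on_compact cA sf) sh.
by exists f1, fi; split=> // x Ax; rewrite -hfi ?hf.
Qed.

(** [glued_diffeomorphic] needs smooth maps of the whole spaces, which come from
    [smooth_extension] because the two pieces are compact.  That the outer piece
    is compact results from the openness of the image of the inner one. *)
Lemma gluing_unique n (X : set 'rV[R]_n) (T : 'rV[R]_(2 + 2 + 2) -> 'rV[R]_5)
    (g : 'rV[R]_(2 + 2 + 2) -> 'rV[R]_n) (b : 'rV[R]_5 -> 'rV[R]_n) :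
  embedding solid T -> T @` solid `<=` sphere R 5 -> submanifold 4 X ->
  embedding solid g -> embedding (exterior (torus R) T) b ->
  g @` solid `|` b @` exterior (torus R) T = X ->
  g @` solid `&` b @` exterior (torus R) T = g @` rim ->
  (forall z, rim z -> g z = b (T z)) ->
  diffeomorphic X (sphere R 5).
Proof.
move=> eT TS subX eg eb cov int gb.
have cE : compact solid := @compact_T2D2 R.
have [T1 [k [CT1 Ck TT1 kT]]] := embedding_inverse cE eT.
have [g1 [q [Cg1 Cq gg1 qg]]] := embedding_inverse cE eg.
pose T2 z := nrm (T1 z).
have CT2 : smooth T2 by apply: smooth_comp => //; exact: smooth_nrm.
have ST z : solid z -> sphere R 5 (T z) by move=> Ez; apply: TS; exists z.
have TT2 z : solid z -> T z = T2 z.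
  by move=> Ez; rewrite /T2 -TT1 // nrm_id //; exact: ST.
have nS z0 : T2D2 z0 -> \forall z \near z0, sphere R 5 (T2 z).
  move=> Ez0; have n1 : \forall z \near z0, 1 / 2 < normsq (T1 z).
    apply: (near_gt (f := fun z => normsq (T1 z))); first exact: smooth_normsq.
    by rewrite -TT1 // (ST _ Ez0 : normsq _ = 1); lra.
  by apply: filterS n1 => z h; apply: normsq_nrm; exact: ltW.
have kT2 z : T2D2 z -> k (T2 z) = z by move=> Ez; rewrite -TT2 // kT.
have cS := @compact_sphere R 5; have subS := @sphere_submanifold R 4.
have NE : exterior (torus R) T = outer (sphere R 5) T2.
  apply/seteqP; split=> x [Sx nx]; split=> //.
    move=> [z [Tz rz ez]]; apply: nx; exists z; first by split.
    by rewrite TT2 //; split=> //; exact: ltW.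
  move=> [z [Tz rz] ez]; apply: nx; exists z; split=> //.
  by rewrite -TT2 //; split=> //; exact: ltW.
rewrite NE in eb cov int.
have cN : compact (outer (sphere R 5) T2) by exact: compact_outer subS CT2 Ck nS kT2 cS.
have [b1 [bi [Cb1 Cbi bb1 bib]]] := embedding_inverse cN eb.
apply: (@glued_diffeomorphic R 5 n (sphere R 5) X T2 k g1 q b1 bi) => //.
- by move=> z Ez; rewrite -gg1 // -cov; left; exists z.
- by move=> z Ez; rewrite -gg1 // qg.
- by move=> x Nx; rewrite -bb1 // -cov; right; exists x.
- by move=> x Nx; rewrite -bb1 // bib.
- move=> z Ez rz; rewrite -gg1 // gb; last by case: Ez.
  by rewrite TT2 // bb1 //; exact: (T2D2_outer nS kT2).
- move=> z x Ez Nx; rewrite -gg1 // -bb1 // => e.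
  have : (g @` rim) (g z) by rewrite -int; split; [exists z|exists x].
  case=> z' [Tz' rz'] e'; have Ez' : solid z' by split=> //; rewrite /cball /= rz'.
  by have := qg _ Ez; rewrite -e' qg // => <-.
- move=> y; rewrite -cov => -[[z Ez e]|[x Nx e]].
    by left; exists z => //; rewrite -gg1.
  by right; exists x => //; rewrite -bb1.
Qed.

Lemma tube_cover n (A : set 'rV[R]_n) m (T : 'rV[R]_(n + 2) -> 'rV[R]_m) :
  tube A T `<=` sphere R m -> tube A T `|` exterior A T = sphere R m.
Proof.
move=> TS; apply/seteqP; split=> x; first by move=> [/TS|[]].
move=> Sx; have [tx|ntx] := pselect (tube A T x); [by left|right; split=> //].
by move=> [z [Az rz] e]; apply: ntx; exists z => //; split=> //; exact: ltW.
Qed.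

Lemma tube_bd n (A : set 'rV[R]_n) m (T : 'rV[R]_(n + 2) -> 'rV[R]_m) :
  embedding (rprod A (cball R 2)) T -> tube A T `<=` sphere R m ->
  tube A T `&` exterior A T = exterior_bd A T.
Proof.
move=> [_ _ [k [_ kT]]] TS.
have rim_in z : rprod A (sphere R 2) z -> rprod A (cball R 2) z.
  by move=> [Az rz]; split=> //; rewrite /cball /= (rz : normsq _ = 1).
apply/seteqP; split=> x.
  move=> [[z [Az rz] e] [Sx nx]]; exists z => //; split=> //.
  apply/eqP; rewrite eq_le; rewrite (rz : normsq _ <= 1) leNgt; apply/negP => rz'.
  by apply: nx; exists z.
move=> [z rz e]; have Tx : tube A T x by exists z => //; exact: rim_in.
split=> //; split; first exact: TS.
move=> [z' [Az' rz'] e']; have Ez' : rprod A (cball R 2) z' by split=> //; exact: ltW.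
have := kT _ Ez'; rewrite e' -e kT; last exact: rim_in.
move=> ezz; case: rz => _; rewrite ezz /sphere /= => h.
by move: rz'; rewrite /oball /= h ltxx.
Qed.

End Uniqueness.

Section Embeddings.
Variable R : realType.

Lemma embedding_id n (A : set 'rV[R]_n) : embedding A id.
Proof.
have sid B : smooth_on B (id : 'rV[R]_n -> 'rV[R]_n) by apply: smooth_on_global; exact: smooth_id.
by split=> //; exists id.
Qed.

Lemma diffeo_embedding m n (A : set 'rV[R]_m) (B : set 'rV[R]_n) f :
  is_diffeo A B f -> embedding A f.
Proof. by move=> [sf fB [h hh]]; split=> //; exists h; rewrite fB. Qed.

Lemma diffeo_inv m n (A : set 'rV[R]_m) (B : set 'rV[R]_n) f :
  is_diffeo A B f -> exists h, is_diffeo B A h /\ forall x, A x -> h (f x) = x.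
Proof.
move=> [sf fB [h [sh hf]]]; exists h; split=> //; split=> //.
  apply/seteqP; split=> [_ [y By <-]|x Ax].
    by move: By; rewrite -fB => -[x Ax <-]; rewrite hf.
  by exists (f x); [rewrite -fB; exists x|exact: hf].
by exists f; split=> // y; rewrite -fB => -[x Ax <-]; rewrite hf.
Qed.

Lemma embedding_comp m n p (A : set 'rV[R]_m) (B : set 'rV[R]_n)
    (f : 'rV[R]_m -> 'rV[R]_n) (h : 'rV[R]_n -> 'rV[R]_p) :
  embedding A f -> (forall x, A x -> B (f x)) -> embedding B h ->
  embedding A (h \o f).
Proof.
move=> [sf _ [fi [sfi fif]]] AB [sh _ [hi [shi hih]]]; split=> //.
  exact: smooth_on_comp sf sh AB.
exists (fi \o hi); split; last by move=> x Ax /=; rewrite hih ?fif //; exact: AB.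
apply: (smooth_on_comp (B := f @` A)) => //.
  apply: smooth_on_sub shi => _ [x Ax <-]; exists (f x) => //; exact: AB.
by move=> _ [x Ax <-]; exists x => //=; rewrite hih //; exact: AB.
Qed.

End Embeddings.

Theorem corollary4p2 (R : realType)
  (J : set 'rV[R]_3) (i : int) (B : set 'rV[R]_5)
  (T : 'rV[R]_(2 + 2 + 2) -> 'rV[R]_5)
  (mu alpha beta : chain1 'rV[R]_5)
  (U : set 'rV[R]_4) (tau : 'rV[R]_(2 + 2) -> 'rV[R]_4)
  (m lam : R -> 'rV[R]_4)
  (Phi : 'rV[R]_(4 + 2) -> 'rV[R]_5)
  (hB : turned_torus J i B)
  (hT : tubular (torus R) T B)
  (hmark : admissible_marking T mu alpha beta)
  (hU : unknot U)
  (htau : tubular (sphere R 2) tau U)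
  (hm : meridian (sphere R 2) tau m)
  (hlam : preferred_longitude tau lam)
  (hPhi : geometric_marking T mu alpha beta tau m lam Phi) :
  (exists (n : nat) (X : set 'rV[R]_n),
    smooth_gluing 4 (EUxS1 tau) (dEUxS1 tau) (C_B T) Phi X) /\
  (forall (n : nat) (X : set 'rV[R]_n),
    smooth_gluing 4 (EUxS1 tau) (dEUxS1 tau) (C_B T) Phi X ->
    diffeomorphic X (sphere R 5)).
Proof.
have [eT TS _] := hT.
have [dPhi _ _ [Psi [dPsi PsiPhi]]] := hPhi.
have Psi_bd : Psi @` dEUxS1 tau = dC_B T.
  have [_ <- _] := dPhi; apply/seteqP; split=> _ [z dz <-]; exists z => //.
    by rewrite PsiPhi.
  by rewrite PsiPhi.
split.
  exists 5, (sphere R 5); split; first exact: sphere_submanifold.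
  exists Psi, id; have [_ PsiE _] := dPsi; split.
  - exact: diffeo_embedding dPsi.
  - exact: embedding_id.
  - by rewrite image_id PsiE; exact: tube_cover.
  - by rewrite image_id PsiE Psi_bd; exact: tube_bd.
  - exact: PsiPhi.
move=> n X [subX [a [b [ea eb cov int ab]]]].
have [Psi' [dPsi' PsiK]] := diffeo_inv dPsi.
have [_ Psi'E _] := dPsi'.
have Tnbhd z : rprod (torus R) (cball R 2) z -> nbhd_B T (T z) by move=> Ez; exists z.
pose g := (a \o Psi') \o T.
have eg : embedding (rprod (torus R) (cball R 2)) g.
  apply: embedding_comp eT Tnbhd _; apply: embedding_comp (diffeo_embedding dPsi') _ ea.
  by move=> y By; rewrite -Psi'E; exists y.
have gimg : g @` rprod (torus R) (cball R 2) = a @` EUxS1 tau.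
  rewrite /g -(image_comp T (a \o Psi')) -(image_comp Psi' a); congr (a @` _); exact: Psi'E.
have dEU z : dEUxS1 tau z -> EUxS1 tau z.
  move=> [dz Sz]; split=> //; have [etau tauS _] := htau.
  by move: dz; rewrite /dE_U -(tube_bd etau tauS) => -[].
have grim : g @` rprod (torus R) (sphere R 2) = a @` dEUxS1 tau.
  rewrite /g -(image_comp T (a \o Psi')) -(image_comp Psi' a) -[T @` _]/(dC_B T) -Psi_bd [Psi' @` _]image_comp.
  congr (_ @` _); apply/seteqP; split=> [_ [z dz <-]|z dz].
    by rewrite /= PsiK //; exact: dEU.
  by exists z => //=; rewrite PsiK //; exact: dEU.
apply: (gluing_unique eT TS subX eg eb); rewrite ?gimg ?grim //.
move=> z rz; have : dC_B T (T z) by exists z.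
rewrite -Psi_bd => -[w dw e]; rewrite /g /= -e PsiK; last exact: dEU.
by rewrite ab // PsiPhi.
Qed.
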